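(* Let $(\mathcal N,\tau,\mathcal E,D(\mathcal E))$ be a Dirichlet space with a regular $C^*$-subalgebra $\mathcal A\subseteq\mathcal N$, such that $D(\mathcal E)$ is separable, let $\mathcal B:=D(\mathcal E)\cap\mathcal A$, let $\mathcal H$ be the associated Hilbert $\mathcal A$-bimodule and $\partial:D(\mathcal E)\to\mathcal H$ the gradient operator. Let $T>0$ and let $h:[0,T]\to\mathcal H$ be measurable and such that, for some constants $c_0,c_2>0$, $c_1\in\mathbb R$ and all $t\in[0,T]$, $u,\omega\in\mathcal B$: 1. $\Re\langle h(t)u,\partial u\rangle_{\mathcal H}\ge c_0\,\mathcal E[u]-c_1\|u\|^2_{L^2(\tau)}$; 2. $|\Re\langle h(t)u,\partial\omega\rangle_{\mathcal H}|\le c_2\|u\|_{\mathcal E}\|\omega\|_{\mathcal E}$, where $\|\cdot\|_{\mathcal E}:=(\mathcal E[\cdot]+\|\cdot\|^2_{L^2(\tau)})^{1/2}$. For each $t$ let $F(\cdot,\cdot;t)$ be the continuous real-bilinear form on $D(\mathcal E)$ extending $F(u,v;t):=\Re\langle h(t)u,\partial v\rangle_{\mathcal H}$, $u,v\in\mathcal B$. Then for every $u_0\in D(\mathcal E)$ and $b\in L^2([0,T];D(\mathcal E)^* )$ the continuity equation has a solution: there is $u\in L^2([0,T];D(\mathcal E))$ with weak derivative $\dot u\in L^2([0,T];D(\mathcal E)^* )$ such that $$\dot u(t)(v)+F(u(t),v;t)=b(t)(v)\quad\text{for all } v\in D(\mathcal E),\qquad u(0)=u_0,$$ for every $t\in[0,T]$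 (where elements of $L^2([0,T];\cdot)$ are classes of a.e. coinciding functions).
   Context: All inner products and sesquilinear forms are conjugate-linear in the first and linear in the second variable. Dirichlet space. $\mathcal N$ is a $W^*$-algebra with a normal faithful semi-finite trace $\tau$; $L^2(\tau)$ is the completion of $\mathfrak n:=\{a\in\mathcal N:\tau(a^*a)<\infty\}$ for $\langle a,b\rangle_{L^2(\tau)}=\tau(a^*b)$. A Markov semigroup on $\mathcal N$ is a family $(P_t)_{t\ge0}$ of completely positive, contractive, unital linear maps $\mathcal N\to\mathcal N$ with $P_{t+s}=P_tP_s$, $P_0=\mathrm{id}$, and $P_t(a)\to a$ weak$^*$ as $t\to0$ for every $a\in\mathcal N$. The trace $\tau$ is symmetric for it if $\tau(aP_t(b))=\tau(P_t(a)b)$ for $a,b\in\mathcal N^+$, $t\ge0$. Then $(P_t)$ induces a strongly continuous self-adjoint contraction semigroup $e^{-t\Delta_{(2)}}$ on $L^2(\tau)$, with $\Delta_{(2)}\ge0$ self-adjoint. The associated (completely) Dirichlet form is the closed Hermitian form $\mathcal E$ with domain $D(\mathcal E)=D(\Delta_{(2)}^{1/2})$ and $\mathcal E(a,b)=\langle a,\Delta_{(2)}b\rangle_{L^2(\tau)}$ for $a,b\in D(\Delta_{(2)})$; write $\mathcal E[a]=\mathcal E(a,a)$. $D(\mathcal E)$ is a Hilbert space with $\langle a,b\rangle_{\mathcal E}:=\langle a,b\rangle_{L^2(\tau)}+\mathcal E(a,b)$. The quadruple $(\mathcal N,\tau,\mathcal E,D(\mathcal E))$ obtained this way is called a Dirichlet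 space. Regular subalgebra. A $C^*$-subalgebra $\mathcal A\subseteq\mathcal N$ is regular if: (1) $\tau|_{\mathcal A}$ is a faithful norm-semi-finite trace (the positive elements of $\mathcal A$ of finite trace span a norm-dense subspace of $\mathcal A$); (2) $\mathcal A\cap\mathfrak n$ is norm dense in $\mathcal A$; (3) $\mathcal A\cap D(\mathcal E)$ is norm dense in $\mathcal A$; (4) $\mathcal A\cap D(\mathcal E)$ is dense in $D(\mathcal E)$ for $\langle\cdot,\cdot\rangle_{\mathcal E}$. Then $\mathcal B:=\mathcal A\cap D(\mathcal E)$ is a $*$-algebra. Gradient operator and bimodule (a known construction of Cipriani–Sauvageot). $\mathcal H$ is the Hilbert space obtained from $\mathcal B\otimes\mathcal B$ by dividing out the null space and completing with respect to the positive semi-definite form $$\langle c\otimes d,a\otimes b\rangle_{\mathcal H}=\tfrac12\big(\mathcal E(c,abd^* )+\mathcal E(cdb^*,a)-\mathcal E(db^*,c^*a)\big).$$ It is a Hilbert $\mathcal A$-bimodule (commuting bounded left and right actions, $\|ah\|,\|ha\|\le\|a\|\|h\|$) determined by $c(a\otimes b)=(ca)\otimes b-c\otimes(ab)$, $(b\otimes c)a=b\otimes(ca)$ for $a,b,c\in\mathcal B$; $h(t)u$ denotes the right action of $u$ on $h(t)$. There is a derivation $\partial:\mathcal B\to\mathcal H$ with $\partial(a)b=a\otimes b$ and $\mathcal E(a,b)=\langle\partial a,\partial b\rangle_{\mathcal H}$, closable from $L^2(\tau)$ to $\mathcal H$; its closure, again denoted $\partial$, has domain $D(\mathcal E)$.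 Evolution setting. Put $V=D(\mathcal E)$ with $\langle\cdot,\cdot\rangle_{\mathcal E}$ and $H=L^2(\tau)$, regarded as real Hilbert spaces with the real parts of their inner products; $V^*$ is the dual of $V$. The inclusion $j:V\to H$ and $j^*:H\to V^*$, $j^*(x)(v)=\Re\langle x,v\rangle_{L^2(\tau)}$, form a Gelfand triple, by which $V\subset H\subset V^*$. $L^2([0,T];X)$ is the Bochner space of (classes of a.e. equal) functions with $\int_0^T\|u(t)\|_X^2dt<\infty$. An element $\dot u\in L^2([0,T];V^* )$ is the weak derivative of $u\in L^2([0,T];V)$ if $\int_0^T\dot u(t)\phi(t)\,dt=-\int_0^Tu(t)\dot\phi(t)\,dt$ in $V^*$ for all smooth compactly supported $\phi$ on $(0,T)$. A function $u\in L^2([0,T];V)$ with $\dot u\in L^2([0,T];V^* )$ has a representative in $C([0,T];H)$, through which $u(0)$ is understood. *)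

(* Defs.v *)
From HB Require Import structures.
From mathcomp Require Import all_boot all_order all_algebra.
From mathcomp Require Import all_classical all_reals all_analysis.
From mathcomp Require Import measurable_realfun complex ring.

Set Implicit Arguments.
Unset Strict Implicit.
Unset Printing Implicit Defensive.

Import Order.TTheory GRing.Theory Num.Theory.
Import numFieldNormedType.Exports.

Local Open Scope classical_set_scope.
Local Open Scope ring_scope.

HB.mixin Record isHilbert (R : realType) H of CompleteNormedModule R[i] H := {
  inner : H -> H -> R[i];
  inner_linear : forall x, scalar (inner x);
  inner_conj : forall x y, inner y x = (inner x y)^*%C;
  inner_norm : forall x, inner x x = `|x| ^+ 2 }.

#[short(type="hilbertType")]
HB.structure Definition Hilbert (R : realType) :=
  {H of CompleteNormedModule R[i] H & isHilbert R H}.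

Reserved Notation "a ** b" (at level 40, left associativity).

(* The product is a field of the mixin: a join of the normed modules with the
   ring structures would sit above [Num.NumDomain], which is already closed. *)
HB.mixin Record isCStar (R : realType) A of CompleteNormedModule R[i] A := {
  cone : A;
  cmul : A -> A -> A;
  star : A -> A;
  cmulA : associative cmul;
  cmul1l : left_id cone cmul;
  cmul1r : right_id cone cmul;
  cmul_linearl : forall b, linear (cmul^~ b);
  cmul_linearr : forall a, linear (cmul a);
  starK : involutive star;
  star_linear : forall (k : R[i]) a b,
    star (k *: a + b) = k^*%C *: star a + star b;
  starM : forall a b, star (cmul a b) = cmul (star b) (star a);
  cstar_normM : forall a b, `|cmul a b| <= `|a| * `|b|;
  cstar_norm_star : forall a, `|cmul (star a) a| = `|a| ^+ 2 }.

#[short(type="cstarAlgType")]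
HB.structure Definition CStarAlgebra (R : realType) :=
  {A of CompleteNormedModule R[i] A & isCStar R A}.

Notation "a ** b" := (cmul a b) : ring_scope.

HB.mixin Record isWStar (R : realType) A of CStarAlgebra R A := {
  predual : completeNormedModType R[i];
  wpair : A -> predual -> R[i]^o;
  wpair_linearl : forall m, scalar (wpair^~ m);
  wpair_linearr : forall a, scalar (wpair a);
  wpair_le : forall a m, `|wpair a m| <= `|a| * `|m|;
  wpair_norm : forall a (c : R[i]), 0 <= c ->
    (forall m, `|wpair a m| <= c * `|m|) -> `|a| <= c;
  wpair_surj : forall f : predual -> R[i]^o,
    scalar f -> continuous f -> exists a, f = wpair a }.

#[short(type="wstarAlgType")]
HB.structure Definition WStarAlgebra (R : realType) :=
  {A of CStarAlgebra R A & isWStar R A}.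

(* Restriction of scalars; the real norm is [Re `|x|]. *)

Definition realified (R : realType) (X : normedModType R[i]) : Type := X.

Section realified.
Context {R : realType} (X : normedModType R[i]).
Local Notation XR := (realified X).

HB.instance Definition _ := GRing.Zmodule.on XR.

Let rscale (r : R) (x : XR) : XR := (r%:C%C *: (x : X)).

Let rscaleA a b x : rscale a (rscale b x) = rscale (a * b) x.
Proof. by rewrite /rscale scalerA -rmorphM. Qed.

Let rscale1 : left_id 1 rscale.
Proof. by move=> x; rewrite /rscale rmorph1 scale1r. Qed.

Let rscaleDr : right_distributive rscale +%R.
Proof. by move=> a x y; rewrite /rscale scalerDr. Qed.

Let rscaleDl x : {morph rscale^~ x : a b / a + b}.
Proof. by move=> a b; rewrite /rscale rmorphD scalerDl. Qed.

HB.instance Definition _ :=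
  GRing.Zmodule_isLmodule.Build R XR rscaleA rscale1 rscaleDr rscaleDl.

Let rnorm (x : XR) : R := complex.Re `|x : X|.

Let rnormE (x : X) : (rnorm x)%:C%C = `|x|.
Proof. by rewrite /rnorm RRe_real// ger0_real. Qed.

Let rnormD (x y : XR) : rnorm (x + y) <= rnorm x + rnorm y.
Proof. by rewrite -lecR rmorphD/= !rnormE ler_normD. Qed.

Let rnormZ (r : R) (x : XR) : rnorm (r *: x) = `|r| * rnorm x.
Proof.
apply: complexI; rewrite rmorphM/= !rnormE [LHS]normrZ.
by rewrite normc_def/= expr0n/= addr0 sqrtr_sqr.
Qed.

Let rnorm0 (x : XR) : rnorm x = 0 -> x = 0.
Proof. by move=> x0; apply/(@normr0_eq0 _ X); rewrite -rnormE x0. Qed.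

HB.instance Definition _ :=
  Lmodule_isNormed.Build R XR rnormD rnormZ rnorm0.

End realified.

Section dual.
Context {R : realType} (X : normedModType R).

Definition bounded_functional (f : X -> R^o) :=
  scalar f /\ exists M : R, forall x, `|f x| <= M * `|x|.

Definition bounded_functionals : {pred X -> R^o} :=
  [pred f | `[< bounded_functional f >]].

Record dual := Dual {
  dual_fun :> X -> R^o;
  dual_funP : dual_fun \in bounded_functionals }.

HB.instance Definition _ := [isSub for dual_fun].
HB.instance Definition _ := [Choice of dual by <:].

Let mem_bounded f : (f \in bounded_functionals) = `[< bounded_functional f >].
Proof. by []. Qed.

Let bounded_functionals_submod : submod_closed bounded_functionals.
Proof.
split=> [|a f g]; rewrite !mem_bounded.
  apply: asboolT; split=> [k x y|].
    exact: (esym (etrans (addr0 _) (mulr0 k))).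
  by exists 0 => x; rewrite mul0r [leLHS]normr0.
move=> /asboolP[lf [M fM]] /asboolP[lg [N gN]].
apply: asboolT; split=> [k x y|].
  by rewrite !fctE lf lg /GRing.scale/=; ring.
exists (`|a| * M + N) => x; rewrite !fctE mulrDl.
rewrite (le_trans (ler_normD _ _))// lerD// normrM -mulrA.
by rewrite ler_wpM2l.
Qed.

HB.instance Definition _ := GRing.isSubmodClosed.Build R (X -> R^o)
  bounded_functionals bounded_functionals_submod.
HB.instance Definition _ := [SubChoice_isSubLmodule of dual by <:].

Implicit Types f g : dual.

Let dual_bounded f : bounded_functional f.
Proof. exact/asboolP/dual_funP. Qed.

Definition dual_norm f : R := sup [set `|f x| | x in [set x | `|x| <= 1]].

Let dualZ f (k : R) x : f (k *: x) = k * f x.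
Proof.
have [lf _] := dual_bounded f.
have f0 : f 0 = 0.
  by have := lf (-1) 0 0; rewrite scaler0 addr0 mulN1r addNr.
by rewrite -[k *: x]addr0 lf f0 addr0.
Qed.

Let dual_norm_has_sup f : has_sup [set `|f x| | x in [set x | `|x| <= 1]].
Proof.
have [_ [M fM]] := dual_bounded f; split.
  by exists `|f 0|; exists 0 => //=; rewrite normr0.
exists `|M| => _ [x /= x1 <-]; rewrite (le_trans (fM x))//.
by rewrite (le_trans (ler_norm _))// normrM normr_id ler_piMr.
Qed.

Lemma dual_norm_ge0 f : 0 <= dual_norm f.
Proof.
rewrite (le_trans (normr_ge0 (f 0)))//.
apply: ub_le_sup; first by case: (dual_norm_has_sup f).
by exists 0 => //=; rewrite normr0.
Qed.

Lemma dual_normP f x : `|f x| <= dual_norm f * `|x|.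
Proof.
have [->|x0] := eqVneq x 0.
  by rewrite -(scale0r (0 : X)) dualZ mul0r normr0 scale0r normr0 mulr0.
have nx : 0 < `|x| by rewrite normr_gt0.
rewrite -ler_pdivrMr// mulrC.
have -> : `|x|^-1 * `|f x| = `|f (`|x|^-1 *: x)|.
  by rewrite dualZ normrM normfV normr_id.
apply: ub_le_sup; first by case: (dual_norm_has_sup f).
by exists (`|x|^-1 *: x) => //=; rewrite normrZ normfV normr_id mulVf// gt_eqF.
Qed.

Lemma dual_norm_le f M : 0 <= M -> (forall x, `|f x| <= M * `|x|) ->
  dual_norm f <= M.
Proof.
move=> M0 fM; apply: ge_sup; first by case: (dual_norm_has_sup f).
by move=> _ [x /= x1 <-]; rewrite (le_trans (fM x))// ler_piMr.
Qed.

Let dual_normD f g : dual_norm (f + g) <= dual_norm f + dual_norm g.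
Proof.
apply: dual_norm_le => [|x]; first by rewrite addr_ge0// dual_norm_ge0.
by rewrite mulrDl (le_trans (ler_normD _ _))// lerD// dual_normP.
Qed.

Let dual_normZ_le (k : R) f : dual_norm (k *: f) <= `|k| * dual_norm f.
Proof.
apply: dual_norm_le => [|x]; first by rewrite mulr_ge0// dual_norm_ge0.
by rewrite -mulrA [leLHS]normrM ler_wpM2l// dual_normP.
Qed.

Let dual_normZ (k : R) f : dual_norm (k *: f) = `|k| * dual_norm f.
Proof.
apply/eqP; rewrite eq_le dual_normZ_le/=.
have [->|k0] := eqVneq k 0; first by rewrite normr0 mul0r dual_norm_ge0.
rewrite -ler_pdivlMl ?normr_gt0//.
rewrite -{1}(scale1r f) -(mulVf k0) -scalerA.
by rewrite (le_trans (dual_normZ_le _ _))// normfV.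
Qed.

Let dual_norm0 f : dual_norm f = 0 -> f = 0.
Proof.
move=> f0; apply/val_inj/funext => x.
by have := dual_normP f x; rewrite f0 mul0r normr_le0 => /eqP.
Qed.

HB.instance Definition _ :=
  Lmodule_isNormed.Build R dual dual_normD dual_normZ dual_norm0.

End dual.

Section WStarTrace.
Context {R : realType} {N : wstarAlgType R}.
Implicit Types (a b c d : N) (tau : N -> \bar R) (P : R -> N -> N).

Definition positive a := exists b, a = star b ** b.

Definition cstar_le a b := positive (b - a).

(* [tau] is a weight: its values matter on the positive cone only. *)
Record normal_faithful_semifinite_trace tau : Prop := {
  trace_ge0 : forall a, positive a -> (0 <= tau a)%E;
  traceD : forall a b, positive a -> positive b ->
    tau (a + b) = (tau a + tau b)%E;
  traceZ : forall (r : R) a, 0 <= r -> positive a ->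
    tau (r%:C%C *: a) = (r%:E * tau a)%E;
  trace_tracial : forall a, tau (star a ** a) = tau (a ** star a);
  trace_normal : forall (S : set N) a,
    S `<=` positive -> S !=set0 ->
    (forall b c, S b -> S c -> exists d, [/\ S d, cstar_le b d & cstar_le c d]) ->
    (forall b, S b -> cstar_le b a) ->
    (forall c, (forall b, S b -> cstar_le b c) -> cstar_le a c) ->
    tau a = ereal_sup (tau @` S);
  trace_faithful : forall a, positive a -> tau a = 0%E -> a = 0;
  trace_semifinite : forall a, positive a -> a <> 0 ->
    exists b, [/\ positive b, b <> 0, cstar_le b a & (tau b < +oo)%E] }.

(* The linear extension of [tau] to the span of the positive elements of
   finite trace, as a relation. *)
Definition trace_ext tau (x : N) (z : R[i]) := exists a b c d,
  [/\ positive a, positive b, positive c & positive d] /\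
  [/\ (tau a < +oo)%E, (tau b < +oo)%E, (tau c < +oo)%E & (tau d < +oo)%E] /\
  x = a - b + 'i%C *: (c - d) /\
  z = Complex (fine (tau a) - fine (tau b)) (fine (tau c) - fine (tau d)).

Definition sq_integrable tau : set N := [set a | (tau (star a ** a) < +oo)%E].

Definition mx_positive n (B : 'M[N]_n) := exists C : 'M[N]_n,
  forall i j, B i j = \sum_k star (C k i) ** C k j.

Definition completely_positive (f : N -> N) :=
  forall n (B : 'M[N]_n), mx_positive B -> mx_positive (map_mx f B).

Record markov_semigroup P : Prop := {
  markov_linear : forall t, 0 <= t -> linear (P t);
  markov_cp : forall t, 0 <= t -> completely_positive (P t);
  markov_contractive : forall t a, 0 <= t -> `|P t a| <= `|a|;
  markov_unital : forall t, 0 <= t -> P t cone = cone;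
  markovD : forall s t, 0 <= s -> 0 <= t -> P (t + s) = P t \o P s;
  markov0 : P 0 = id;
  markov_weak_star : forall a (m : @predual _ N),
    wpair (P t a) m @[t --> 0^'+] --> wpair a m }.

(* For positive x and y, tau(xy) is tau(x^(1/2) y x^(1/2)), possibly +oo; here
   the two positive elements are c^2 and d^2. *)
Definition trace_symmetric tau P := forall t c d,
  0 <= t -> positive c -> positive d ->
  tau (c ** P t (d ** d) ** c) = tau (d ** P t (c ** c) ** d).

End WStarTrace.

Definition lin_span (R : realType) (X : lmodType R[i]) (S : set X) : set X :=
  [set x | exists n (c : 'I_n -> R[i]) (f : 'I_n -> X),
     (forall i, S (f i)) /\ x = \sum_i c i *: f i].

(* Unbounded operators are given by their graphs. *)

Section unbounded_operators.
Context {R : realType} {K : hilbertType R}.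
Implicit Types G Q : set (K * K).

Definition adjoint G : set (K * K) :=
  [set p | forall q, G q -> inner p.1 q.2 = inner p.2 q.1].

Definition self_adjoint G := dense (fst @` G) /\ G = adjoint G.

Definition positive_operator G := forall p, G p -> 0 <= inner p.1 p.2.

Definition is_sqrt Q G := [/\ self_adjoint Q, positive_operator Q
  & G = [set p | exists y, Q (p.1, y) /\ Q (y, p.2)]].

(* The operator D with [S t = exp (- t D)]. *)
Definition neg_generator (S : R -> K -> K) : set (K * K) :=
  [set p | (t^-1)%:C%C *: (p.1 - S t p.1) @[t --> 0^'+] --> p.2].

Record closed_hermitian_form (D : set K) (E : K -> K -> R[i]) : Prop := {
  form_dom0 : D 0;
  form_domP : forall (k : R[i]) x y, D x -> D y -> D (k *: x + y);
  form_linear : forall (k : R[i]) x y z, D x -> D y -> D z ->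
    E x (k *: y + z) = k * E x y + E x z;
  form_conj : forall x y, D x -> D y -> E y x = (E x y)^*%C;
  form_ge0 : forall x, D x -> 0 <= E x x;
  form_closed : forall (x_ : nat -> K) (x : K), (forall n, D (x_ n)) ->
    x_ n @[n --> \oo] --> x ->
    (forall e : R, 0 < e -> exists m, forall p q, (m <= p)%N -> (m <= q)%N ->
       complex.Re (E (x_ p - x_ q) (x_ p - x_ q)) < e) ->
    D x /\
    (complex.Re (E (x_ n - x) (x_ n - x)) : R^o) @[n --> \oo] --> (0 : R^o) }.

Definition form_norm (E : K -> K -> R[i]) (x : K) : R :=
  Num.sqrt (complex.Re (E x x) + complex.Re `|x| ^+ 2).

End unbounded_operators.

Section dirichlet_space.
Context {R : realType} {N : wstarAlgType R} (tau : N -> \bar R).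
Context {K : hilbertType R} (iota : N -> K).

Local Notation nn := (sq_integrable tau).

(* [K] is the completion of the square-integrable elements, [iota] the
   canonical map; [iota] is meaningful on these elements only. *)
Record is_L2 : Prop := {
  iota_linear : forall (k : R[i]) a b, nn a -> nn b ->
    iota (k *: a + b) = k *: iota a + iota b;
  iota_inner : forall a b, nn a -> nn b ->
    trace_ext tau (star a ** b) (inner (iota a) (iota b));
  iota_dense : dense (iota @` nn) }.

Record induced_semigroup (P : R -> N -> N) (S : R -> K -> K) : Prop := {
  induced_linear : forall t, 0 <= t -> linear (S t);
  induced_contractive : forall t x, 0 <= t -> `|S t x| <= `|x|;
  induced_iota : forall t a, 0 <= t -> nn a ->
    nn (P t a) /\ S t (iota a) = iota (P t a) }.

Definition dirichlet_form (D : set K) (E : K -> K -> R[i]) :=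
  exists P S Q,
    [/\ markov_semigroup P, trace_symmetric tau P & induced_semigroup P S] /\
    [/\ self_adjoint (neg_generator S),
        is_sqrt Q (neg_generator S), D = fst @` Q,
        closed_hermitian_form D E
      & forall p q, neg_generator S p -> neg_generator S q ->
          E p.1 q.1 = inner p.1 q.2].

Definition dirichlet_space D E :=
  [/\ normal_faithful_semifinite_trace tau, is_L2 & dirichlet_form D E].

Variables (D : set K) (E : K -> K -> R[i]).

(* [V] is the Hilbert space (D, <.,.>_E) and [j] its inclusion into [K]. *)
Record form_domain (V : hilbertType R) (j : V -> K) : Prop := {
  form_domain_linear : linear j;
  form_domain_range : range j = D;
  form_domain_inner : forall x y,
    inner x y = inner (j x) (j y) + E (j x) (j y) }.

Record cstar_subalgebra (A : set N) : Prop := {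
  subalg0 : A 0;
  subalgP : forall (k : R[i]) a b, A a -> A b -> A (k *: a + b);
  subalgM : forall a b, A a -> A b -> A (a ** b);
  subalg_star : forall a, A a -> A (star a);
  subalg_closed : closed A }.

(* A /\ D(E), inside the algebra. *)
Definition form_algebra (A : set N) : set N :=
  A `&` nn `&` iota @^-1` D.

Record regular_subalgebra (V : hilbertType R) (j : V -> K) (A : set N) :
    Prop := {
  regular_cstar : cstar_subalgebra A;
  regular_faithful : forall a, A a -> positive a -> tau a = 0%E -> a = 0;
  regular_semifinite :
    A `<=` closure (lin_span [set a | [/\ A a, positive a & (tau a < +oo)%E]]);
  regular_nn : A `<=` closure (A `&` nn);
  regular_form : A `<=` closure (form_algebra A);
  regular_core : dense (j @^-1` (iota @` form_algebra A)) }.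

Section gradient.
Variables (A : set N) (M : hilbertType R).
Variables (tens : N -> N -> M) (lact ract : N -> M -> M) (grad : K -> M).

Local Notation B := (form_algebra A).

(* [M] is the completion of the quotient of the tensor square of B by the null
   space; [tens a b] is the class of the tensor of [a], [b] in B. *)
Record tangent_bimodule : Prop := {
  tens_linearl : forall (k : R[i]) a b c, B a -> B b -> B c ->
    tens (k *: a + b) c = k *: tens a c + tens b c;
  tens_linearr : forall (k : R[i]) a b c, B a -> B b -> B c ->
    tens a (k *: b + c) = k *: tens a b + tens a c;
  tens_inner : forall a b c d, B a -> B b -> B c -> B d ->
    inner (tens c d) (tens a b) =
      2^-1 * (E (iota c) (iota (a ** b ** star d))
              + E (iota (c ** d ** star b)) (iota a)
              - E (iota (d ** star b)) (iota (star c ** a)));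
  tens_total : dense (lin_span [set tens p.1 p.2 | p in B `*` B]);
  lact_linear : forall a, A a -> linear (lact a);
  ract_linear : forall a, A a -> linear (ract a);
  lact_linearl : forall (k : R[i]) a b x, A a -> A b ->
    lact (k *: a + b) x = k *: lact a x + lact b x;
  ract_linearl : forall (k : R[i]) a b x, A a -> A b ->
    ract (k *: a + b) x = k *: ract a x + ract b x;
  lactM : forall a b x, A a -> A b -> lact (a ** b) x = lact a (lact b x);
  ractM : forall a b x, A a -> A b -> ract (a ** b) x = ract b (ract a x);
  act_comm : forall a b x, A a -> A b -> lact a (ract b x) = ract b (lact a x);
  lact_bounded : forall a x, A a -> `|lact a x| <= `|a| * `|x|;
  ract_bounded : forall a x, A a -> `|ract a x| <= `|a| * `|x|;
  lact_tens : forall a b c, B a -> B b -> B c ->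
    lact c (tens a b) = tens (c ** a) b - tens c (a ** b);
  ract_tens : forall a b c, B a -> B b -> B c ->
    ract a (tens b c) = tens b (c ** a) }.

(* [grad] is meaningful on D(E) only. *)
Record gradient : Prop := {
  grad_linear : forall (k : R[i]) x y, D x -> D y ->
    grad (k *: x + y) = k *: grad x + grad y;
  grad_derivation : forall a b, B a -> B b ->
    grad (iota (a ** b)) =
      ract b (grad (iota a)) + lact a (grad (iota b));
  grad_tens : forall a b, B a -> B b -> ract b (grad (iota a)) = tens a b;
  grad_form : forall a b, B a -> B b ->
    E (iota a) (iota b) = inner (grad (iota a)) (grad (iota b));
  grad_closure :
    [set (x, grad x) | x in D] =
      closure [set (iota a, grad (iota a)) | a in B] }.

End gradient.

End dirichlet_space.

Section bochner.
Context {R : realType} {X : normedModType R} (T : R).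
Implicit Types f : R -> X.

Local Notation mu := (@lebesgue_measure R).

Definition simple (s : R -> X) := finite_set (range s) /\
  forall x, measurable (s @^-1` [set x] : set (measurableTypeR R)).

Definition simple_integral (s : R -> X) : X :=
  \sum_(x \in range s) fine (mu (`[0, T] `&` s @^-1` [set x])) *: x.

Definition simple_approx (s : nat -> R -> X) f :=
  (forall n, simple (s n)) /\
  {ae mu, forall t, t \in `[0, T] -> s n t @[n --> \oo] --> f t}.

Definition strongly_measurable f := exists s, simple_approx s f.

Definition bochner_integral f (x : X) := exists s,
  [/\ simple_approx s f,
      (\int[mu]_(t in `[0%R, T]) `|f t - s n t|%:E)%E @[n --> \oo] --> 0%E
    & simple_integral (s n) @[n --> \oo] --> x].

Definition bochner_L2 f := strongly_measurable f /\
  (\int[mu]_(t in `[0%R, T]) (`|f t| ^+ 2)%:E < +oo)%E.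

End bochner.

Section evolution.
Context {R : realType} (T : R).

(* Measurability for the Lebesgue sigma-algebra on [0, T] and the Borel
   sigma-algebra of the target. *)
Definition lebesgue_measurable (X : topologicalType) (f : R -> X) :=
  forall U : set X, open U ->
    completed_algebra_gen (@lebesgue_measure R) (`[0, T] `&` f @^-1` U).

Definition test_function (phi : R -> R) :=
  (forall n t, derivable (derive1n n phi) t 1) /\
  exists a b, [/\ 0 < a, b < T & forall t, t \notin `[a, b] -> phi t = 0].

Context {V K : hilbertType R} (j : V -> K).

(* [insubd 0 f] is [f] when [f] is a bounded real-linear functional. *)
Definition gelfand (x : K) : dual (realified V) :=
  insubd 0 (fun v : realified V => complex.Re (inner x (j v)) : R^o).

Definition weak_derivative (u : R -> realified V)
    (u' : R -> dual (realified V)) :=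
  forall phi, test_function phi -> exists x,
    bochner_integral T (fun t => phi t *: u' t) x /\
    bochner_integral T (fun t => derive1 phi t *: gelfand (j (u t))) (- x).

(* The last condition says that u(0) = [u0] through the representative of [u]
   in C([0, T]; K). *)
Definition evolution_solution (F : R -> realified V -> realified V -> R)
    (b : R -> dual (realified V)) (u0 : V) :=
  exists (u : R -> realified V) (u' : R -> dual (realified V)),
    [/\ bochner_L2 T u, bochner_L2 T u', weak_derivative u u',
        forall t, t \in `[0, T] -> forall v, u' t v + F t (u t) v = b t v
      & exists w : R -> K,
          [/\ {within `[0, T], continuous w},
              {ae @lebesgue_measure R, forall t, t \in `[0, T] -> w t = j (u t)}
            & w 0 = j u0]].

End evolution.

Record continuity_form (R : realType) (N : wstarAlgType R)
    (V K M : hilbertType R) (iota : N -> K) (j : V -> K) (B : set N)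
    (ract : N -> M -> M) (grad : K -> M) (h : M)
    (F : realified V -> realified V -> R^o) : Prop := {
  cform_linearl : forall v, scalar (F^~ v);
  cform_linearr : forall u, scalar (F u);
  cform_continuous :
    continuous (fun p : realified V * realified V => F p.1 p.2);
  cform_ext : forall u v a b, B a -> B b -> j u = iota a -> j v = iota b ->
    F u v = complex.Re (inner (ract a h) (grad (iota b))) }.

(* Main.v *)
Require Import Defs.
From HB Require Import structures.
From mathcomp Require Import all_boot all_order all_algebra finmap.
From mathcomp Require Import all_classical all_reals all_analysis.
From mathcomp Require Import measurable_realfun complex ring lra.

Set Implicit Arguments.
Unset Strict Implicit.
Unset Printing Implicit Defensive.

Import Order.TTheory GRing.Theory Num.Theory.
Import numFieldNormedType.Exports.

Local Open Scope classical_set_scope.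
Local Open Scope ring_scope.

(* Replacing u by exp(-(c0 + c1) t) u makes the form F(., .; t) coercive. Let G
   and A be the operators on L^2([0, T]; V) representing the inner product of
   L^2(tau) and the form. The functions G u' + A u, for u a finite sum of C^1
   scalar functions times vectors with u(0) = 0, are dense in L^2([0, T]; V).
   For A = k a constant, this follows by testing an orthogonal function against
   primitives; in general, by perturbation from k = C^2 / c, where C bounds the
   form and c is its coercivity constant, because then |k - A| < k. The energy
   identity makes u_n Cauchy in L^2([0, T]; V), and uniformly Cauchy in L^2(tau),
   whenever G u_n' + A u_n converges; the limit solves the equation. The form is
   obtained from its values on the core by density. It is only Lebesgue
   measurable in t, so it is made Borel by a modification on a null set. *)

(** All estimates take place in one real Hilbert space [X], the form domain. Its dual is reached
    only at the end, through the Riesz isometry, and the weaker pivot norm enters as a second form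
    [g] with operator [G]. Approximants are finite sums because their derivatives are again
    [X]-valued and the product rule is then plain algebra; in the limit only G u' survives, so
    statements about limits carry the approximating sequences along. Elements of L^2 are functions,
    not classes: orthogonal projections become minimising sequences, and definiteness becomes
    vanishing almost everywhere. Separability supplies a dense sequence against which the
    measurability of norms and vanishing almost everywhere are tested. The initial value lies in the
    form domain, so it can be subtracted as a constant function, which leaves zero initial data. The
    equation is demanded at every t, while a limit gives it for almost every t: the derivative is
    therefore defined by the equation and only then identified with the limit almost everywhere. *)

Definition cauchy_for (R : realType) (S : Type) (dist : S -> S -> R)
    (x_ : nat -> S) :=
  forall e, 0 < e -> exists n0, forall m n, (n0 <= m)%N -> (n0 <= n)%N ->
    dist (x_ m) (x_ n) < e.

(** * Semi-inner products and Hilbert spaces *)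

Section semi_inner_product.
Context {R : realType} {S : lmodType R} (L : set S) (q : S -> S -> R).

(** Relative to a subset [L] because the square-integrable functions are a subset of all functions;
    only semi-definite because functions equal almost everywhere are not identified. *)
Record semi_inner : Prop := {
  si0 : L 0;
  siP : forall k x y, L x -> L y -> L (k *: x + y);
  si_linear : forall k x y z, L x -> L y -> L z ->
    q z (k *: x + y) = k * q z x + q z y;
  siC : forall x y, L x -> L y -> q x y = q y x;
  si_ge0 : forall x, L x -> 0 <= q x x }.

Hypothesis siq : semi_inner.

(** Squared distances keep the estimates polynomial; the price is the factor 2 in the triangle
    inequality [sqdist_triangle]. *)
Definition sqdist x y := q (x - y) (x - y).

Lemma siZ_mem k x : L x -> L (k *: x).
Proof. by move=> Lx; rewrite -[_ *: _]addr0; apply: siP => //; exact: si0. Qed.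

Lemma siD_mem x y : L x -> L y -> L (x + y).
Proof. by move=> Lx Ly; rewrite -[x]scale1r; exact: siP. Qed.

Lemma siN_mem x : L x -> L (- x).
Proof. by move=> Lx; rewrite -scaleN1r; exact: siZ_mem. Qed.

Lemma siB_mem x y : L x -> L y -> L (x - y).
Proof. by move=> Lx Ly; apply: siD_mem => //; exact: siN_mem. Qed.

Lemma si0r z : L z -> q z 0 = 0.
Proof.
move=> Lz; have := si_linear siq 1 (si0 siq) (si0 siq) Lz.
by rewrite scale1r addr0 mul1r => /eqP; rewrite -subr_eq0 opprD addNKr oppr_eq0 => /eqP.
Qed.

Lemma siDr x y z : L x -> L y -> L z -> q z (x + y) = q z x + q z y.
Proof. by move=> Lx Ly Lz; rewrite -{1}[x]scale1r si_linear// mul1r. Qed.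

Lemma siZr k x z : L x -> L z -> q z (k *: x) = k * q z x.
Proof.
move=> Lx Lz; rewrite -[k *: x]addr0 si_linear//; last exact: si0.
by rewrite si0r// addr0.
Qed.

Lemma siNr x z : L x -> L z -> q z (- x) = - q z x.
Proof. by move=> Lx Lz; rewrite -scaleN1r siZr// mulN1r. Qed.

Lemma siBr x y z : L x -> L y -> L z -> q z (x - y) = q z x - q z y.
Proof. by move=> Lx Ly Lz; rewrite siDr ?siNr//; exact: siN_mem. Qed.

Lemma siDl x y z : L x -> L y -> L z -> q (x + y) z = q x z + q y z.
Proof.
by move=> Lx Ly Lz; rewrite siC ?siDr// ?(siC siq Lz)//; exact: siD_mem.
Qed.

Lemma siZl k x z : L x -> L z -> q (k *: x) z = k * q x z.
Proof. by move=> Lx Lz; rewrite siC ?siZr// ?(siC siq Lz)//; exact: siZ_mem. Qed.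

Lemma siNl x z : L x -> L z -> q (- x) z = - q x z.
Proof. by move=> Lx Lz; rewrite -scaleN1r siZl// mulN1r. Qed.

Lemma siBl x y z : L x -> L y -> L z -> q (x - y) z = q x z - q y z.
Proof. by move=> Lx Ly Lz; rewrite siDl ?siNl//; exact: siN_mem. Qed.

Lemma si_sqrD x y : L x -> L y ->
  q (x + y) (x + y) = q x x + 2 * q x y + q y y.
Proof.
move=> Lx Ly; have Lxy := siD_mem Lx Ly.
by rewrite siDr// !siDl// (siC siq Ly Lx); ring.
Qed.

Lemma si_sqrZ k x : L x -> q (k *: x) (k *: x) = k ^+ 2 * q x x.
Proof. by move=> Lx; rewrite siZl ?siZr//; [ring | exact: siZ_mem]. Qed.

Lemma si_sqrN x : L x -> q (- x) (- x) = q x x.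
Proof. by move=> Lx; rewrite -scaleN1r si_sqrZ//; ring. Qed.

Lemma sqdistE x y : L x -> L y -> sqdist x y = q x x - 2 * q x y + q y y.
Proof.
move=> Lx Ly; rewrite /sqdist si_sqrD// ?si_sqrN// ?siNr//; [ring|].
exact: siN_mem.
Qed.

Lemma sqdistC x y : L x -> L y -> sqdist x y = sqdist y x.
Proof. by move=> Lx Ly; rewrite !sqdistE// (siC siq Lx Ly); ring. Qed.

Lemma sqdist_ge0 x y : L x -> L y -> 0 <= sqdist x y.
Proof. by move=> Lx Ly; apply: si_ge0 => //; exact: siB_mem. Qed.

Lemma si_sqrD_le x y : L x -> L y ->
  q (x + y) (x + y) <= 2 * q x x + 2 * q y y.
Proof.
move=> Lx Ly; have := sqdist_ge0 Lx Ly.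
by rewrite sqdistE// si_sqrD//; lra.
Qed.

Lemma sqdist_triangle x y z : L x -> L y -> L z ->
  sqdist x z <= 2 * sqdist x y + 2 * sqdist y z.
Proof.
move=> Lx Ly Lz; rewrite /sqdist.
have -> : x - z = (x - y) + (y - z) by rewrite addrA subrK.
by rewrite si_sqrD_le//; exact: siB_mem.
Qed.

Lemma si_cauchy_schwarz x y : L x -> L y -> q x y ^+ 2 <= q x x * q y y.
Proof.
move=> Lx Ly.
have H s : 0 <= q x x - 2 * (s * q x y) + s ^+ 2 * q y y.
  have Ls := siZ_mem s Ly.
  by have := sqdist_ge0 Lx Ls; rewrite sqdistE// si_sqrZ// siZr.
have [y0|y0] := eqVneq (q y y) 0.
  rewrite y0 mulr0; have [->|xy0] := eqVneq (q x y) 0; first by rewrite expr0n.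
  (* When [q y y = 0] the polynomial in [H] is affine in [s]; at this [s] it equals -1. *)
  have := H ((q x x + 1) / (2 * q x y)).
  have -> : 2 * ((q x x + 1) / (2 * q x y) * q x y) = q x x + 1 by field.
  by rewrite y0; lra.
have y_gt0 : 0 < q y y by rewrite lt_def y0 si_ge0.
have := H (q x y / q y y).
have -> : q x x - 2 * (q x y / q y y * q x y) + (q x y / q y y) ^+ 2 * q y y =
   (q x x * q y y - q x y ^+ 2) / q y y by field.
by rewrite pmulr_lge0 ?invr_gt0// subr_ge0.
Qed.

Lemma si_normr_le x y : L x -> L y ->
  `|q x y| <= Num.sqrt (q x x) * Num.sqrt (q y y).
Proof.
move=> Lx Ly; rewrite -sqrtrM ?si_ge0// -sqrtr_sqr ler_wsqrtr//.
exact: si_cauchy_schwarz.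
Qed.

(* Minimising sequences for the distance to a subspace are Cauchy, by the
   parallelogram identity; no completeness is needed. *)
Lemma si_almost_projection (Y : set S) x : L x -> Y `<=` L -> Y 0 ->
  (forall k y z, Y y -> Y z -> Y (k *: y + z)) ->
  exists y_ : nat -> S, [/\ forall n, Y (y_ n), cauchy_for sqdist y_
    & forall y, Y y -> q (x - y_ n) y @[n --> \oo] --> 0].
Proof.
move=> Lx YL Y0 YP.
pose dists := [set sqdist x y | y in Y].
have infd : has_inf dists.
  split; first by exists (sqdist x 0), 0.
  by exists 0 => _ [y Yy <-]; apply: sqdist_ge0 => //; exact: YL.
have inf_le y : Y y -> inf dists <= sqdist x y.
  by move=> Yy; apply: ge_inf; [exact: infd.2|exists y].
have near_inf n : exists2 y, Y y & sqdist x y < inf dists + n.+1%:R^-1.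
  have [|_ [y Yy <-] ?] := @inf_adherent _ dists n.+1%:R^-1 _ infd; last by exists y.
  by rewrite invr_gt0 ltr0n.
pose y_ n := projT1 (cid2 (near_inf n)).
have Yy n : Y (y_ n) by rewrite /y_; case: cid2.
have dy n : sqdist x (y_ n) < inf dists + n.+1%:R^-1 by rewrite /y_; case: cid2.
have inv_small (e : R) : 0 < e -> exists n0, forall n, (n0 <= n)%N -> n.+1%:R^-1 < e.
  move=> e0; have [n0 _ H] := near_infty_natSinv_lt (PosNum e0).
  by exists n0 => n nn0; exact: H.
exists y_; split=> //.
  move=> e e0.
  (* Since the midpoint of [y_ m] and [y_ n] is no closer to [x] than the infimum, the parallelogram
     identity bounds their squared distance by 2 / (m + 1) + 2 / (n + 1). *)
  have [|n0 Hn0] := inv_small (e / 4); first by rewrite divr_gt0.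
  exists n0 => m n /Hn0 Hm /Hn0 Hn.
  have [Lm Ln] := (YL _ (Yy m), YL _ (Yy n)).
  have Ymid : Y (2^-1 *: y_ m + 2^-1 *: y_ n).
    by apply: (YP _ _ _ (Yy m)); rewrite -[_ *: _]addr0; exact: YP.
  have := inf_le _ Ymid; have := dy m; have := dy n.
  have [Lm2 Ln2] := (siZ_mem 2^-1 Lm, siZ_mem 2^-1 Ln).
  have Lmid := siD_mem Lm2 Ln2.
  rewrite !sqdistE// (siDr Lm2 Ln2)// (siDr Lm2 Ln2)// !(siDl Lm2 Ln2)//.
  rewrite !siZl// !siZr// (siC siq Ln Lm).
  by move: Hm Hn; set a := m.+1%:R^-1; set b := n.+1%:R^-1; lra.
move=> y Yy'; have Ly := YL _ Yy'.
apply/cvgrPdist_lt => e e0.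
(* Moving [y_ n] by a / Q times [y], where a = q (x - y_ n) y, lowers the squared distance by at
   least a^2 / Q, which is thus below 1 / (n + 1). The summand 1 keeps [Q] positive when [q y y]
   vanishes. *)
pose Q := q y y + 1; have Q0 : 0 < Q by rewrite ltr_pwDr// si_ge0.
have [|n0 Hn0] := inv_small (e ^+ 2 / Q); first by rewrite divr_gt0// exprn_gt0.
exists n0 => // n /= /Hn0 Hn.
have Ln := YL _ (Yy n); have Lxn := siB_mem Lx Ln.
pose a := q (x - y_ n) y; rewrite sub0r normrN -/a.
have Yn : Y ((a / Q) *: y + y_ n) by exact: YP.
have Lay := siZ_mem (a / Q) Ly.
have := inf_le _ Yn; have := dy n.
have -> : sqdist x ((a / Q) *: y + y_ n) = sqdist (x - y_ n) ((a / Q) *: y).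
  by rewrite /sqdist opprD addrA addrAC.
rewrite (sqdistE Lxn Lay) siZr// si_sqrZ// -/a -/(sqdist x (y_ n)).
have -> : 2 * (a / Q * a) = 2 * (a ^+ 2 / Q) by ring.
have -> : (a / Q) ^+ 2 * q y y = a ^+ 2 / Q - a ^+ 2 / Q ^+ 2.
  have -> : q y y = Q - 1 by rewrite addrK.
  by field; rewrite gt_eqF.
have : 0 <= a ^+ 2 / Q ^+ 2 by rewrite divr_ge0// sqr_ge0.
move: Hn; set i := n.+1%:R^-1 => Hi aQ H1 H2.
have : a ^+ 2 / Q < e ^+ 2 / Q by lra.
by rewrite ltr_pM2r ?invr_gt0// -(real_normK (num_real a)) ltr_pXn2r// nnegrE ltW.
Qed.

Lemma si_cvgl (x_ : nat -> S) x y : (forall n, L (x_ n)) -> L x -> L y ->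
  sqdist (x_ n) x @[n --> \oo] --> 0 -> q (x_ n) y @[n --> \oo] --> q x y.
Proof.
move=> Lx_ Lx Ly x_x; apply/cvgrPdist_lt => e e0.
have Q0 : 0 < q y y + 1 by rewrite ltr_pwDr// si_ge0.
have e1 : 0 < e ^+ 2 / (q y y + 1) by rewrite divr_gt0// exprn_gt0.
move/cvgrPdist_lt : x_x => /(_ _ e1)[n0 _ H]; exists n0 => // n /H /=.
rewrite sub0r normrN ger0_norm ?sqdist_ge0// ltr_pdivlMr// => Hn.
have Lxx := siB_mem (Lx_ n) Lx.
rewrite distrC -siBl// -(@ltr_pXn2r _ 2) ?nnegrE// ?ltW//.
rewrite real_normK ?num_real//; apply: le_lt_trans Hn.
apply: (le_trans (si_cauchy_schwarz Lxx Ly)).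
by rewrite ler_wpM2l ?si_ge0// lerDl.
Qed.

Lemma si_cvg (x_ y_ : nat -> S) x y : (forall n, L (x_ n)) -> L x ->
  (forall n, L (y_ n)) -> L y ->
  sqdist (x_ n) x @[n --> \oo] --> 0 -> sqdist (y_ n) y @[n --> \oo] --> 0 ->
  q (x_ n) (y_ n) @[n --> \oo] --> q x y.
Proof.
move=> Lx_ Lx Ly_ Ly x_x y_y.
have H n : q (x_ n) (y_ n) = q (x_ n) y + q (y_ n) x - q x y +
    q (x_ n - x) (y_ n - y).
  rewrite siBr ?siBl ?(siC siq (Ly_ n) Lx)//; [ring|exact: siB_mem].
have -> : (fun n => q (x_ n) (y_ n)) = fun n => q (x_ n) y + q (y_ n) x -
  q x y + q (x_ n - x) (y_ n - y) by apply/funext.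
suff : q (x_ n) y + q (y_ n) x - q x y + q (x_ n - x) (y_ n - y) @[n --> \oo]
  --> q x y + q x y - q x y + 0 by rewrite addr0 addrK.
apply: cvgD; last first.
  apply/norm_cvg0P; apply: (@squeeze_cvgr _ _ _ _ (cst 0) (fun n =>
    Num.sqrt (sqdist (x_ n) x) * Num.sqrt (sqdist (y_ n) y))).
  - apply: nearW => n; rewrite normr_ge0/=.
    by apply: si_normr_le; exact: siB_mem.
  - exact: cvg_cst.
  - rewrite -[X in _ --> X](mulr0 (Num.sqrt 0)) -{2}(@sqrtr0 R).
    by apply: cvgM; [apply: (cvg_comp _ _ x_x)|apply: (cvg_comp _ _ y_y)];
      exact: sqrt_continuous.
apply: cvgB; last exact: cvg_cst.
apply: cvgD; first exact: si_cvgl.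
by rewrite (siC siq Lx Ly); exact: si_cvgl.
Qed.

Lemma cvg_sqdist_cauchy (x_ : nat -> S) x : (forall n, L (x_ n)) -> L x ->
  sqdist (x_ n) x @[n --> \oo] --> 0 -> cauchy_for sqdist x_.
Proof.
move=> Lx_ Lx x_x e e0.
have e4 : 0 < e / 4 by rewrite divr_gt0.
move/cvgrPdist_lt : x_x => /(_ _ e4)[n0 _ H]; exists n0 => m n /H/= Hm /H/= Hn.
apply: le_lt_trans (sqdist_triangle (Lx_ m) Lx (Lx_ n)) _.
rewrite (sqdistC Lx (Lx_ n)).
move: Hm Hn; rewrite !sub0r !normrN !ger0_norm ?sqdist_ge0//; lra.
Qed.

End semi_inner_product.

(** * Real Hilbert spaces and the Riesz representation theorem *)

Section real_hilbert.
Context {R : realType} {X : normedModType R} (ip : X -> X -> R).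

(** The inner product is a parameter rather than a structure on the type, because [realified V]
    carries only a real normed structure and its inner product is a real part. *)
Record real_hilbert : Prop := {
  ip_semi_inner :> semi_inner setT ip;
  ip_norm : forall x, ip x x = `|x| ^+ 2;
  hilbert_complete : forall x_ : nat -> X, cauchy_for (fun x y => `|x - y|) x_ ->
    exists x, `|x_ n - x| @[n --> \oo] --> 0 }.

Hypothesis hX : real_hilbert.

Let siX : semi_inner setT ip := hX.

Lemma ipC x y : ip x y = ip y x. Proof. exact: (siC siX). Qed.
Lemma ipDr z x y : ip z (x + y) = ip z x + ip z y.
Proof. exact: (siDr siX). Qed.
Lemma ipDl x y z : ip (x + y) z = ip x z + ip y z.
Proof. exact: (siDl siX). Qed.
Lemma ipBr z x y : ip z (x - y) = ip z x - ip z y.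
Proof. exact: (siBr siX). Qed.
Lemma ipBl x y z : ip (x - y) z = ip x z - ip y z.
Proof. exact: (siBl siX). Qed.
Lemma ipZr k x z : ip z (k *: x) = k * ip z x.
Proof. exact: (siZr siX). Qed.
Lemma ipZl k x z : ip (k *: x) z = k * ip x z.
Proof. exact: (siZl siX). Qed.
Lemma ip0r x : ip x 0 = 0. Proof. exact: (si0r siX). Qed.
Lemma ip0l x : ip 0 x = 0. Proof. by rewrite ipC ip0r. Qed.
Lemma ipNl x y : ip (- x) y = - ip x y. Proof. exact: (siNl siX). Qed.

Lemma sqdist_ip x y : sqdist ip x y = `|x - y| ^+ 2.
Proof. by rewrite /sqdist ip_norm. Qed.

Lemma ip_le x y : `|ip x y| <= `|x| * `|y|.
Proof.
have := si_normr_le siX I I (x := x) (y := y).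
by rewrite !(ip_norm hX) !sqrtr_sqr !normr_id.
Qed.

Lemma ip_inj x y : (forall z, ip x z = ip y z) -> x = y.
Proof.
move=> xy; apply/eqP; rewrite -subr_eq0 -normr_eq0 -sqrf_eq0 -ip_norm//.
by rewrite ipBl xy subrr.
Qed.

Lemma cauchy_norm_sqdist (x_ : nat -> X) : cauchy_for (sqdist ip) x_ ->
  cauchy_for (fun x y => `|x - y|) x_.
Proof.
move=> cx e e0; have [|n0 H] := cx (e ^+ 2); first by rewrite exprn_gt0.
exists n0 => m n mn nn; have := H m n mn nn.
by rewrite sqdist_ip ltr_pXn2r ?nnegrE ?(ltW e0)//.
Qed.

Lemma cvg_sqr0 (a_ : nat -> R) : a_ n @[n --> \oo] --> 0 ->
  (a_ n) ^+ 2 @[n --> \oo] --> 0.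
Proof.
move=> h; have -> : (fun n => a_ n ^+ 2) = a_ \* a_.
  by apply/funext => n; rewrite expr2.
by rewrite -[X in _ --> X](mulr0 0); exact: cvgM.
Qed.

(** If [f x] is nonzero, the almost projections of [x] to the kernel converge to some [y] in the
    kernel, and z = x - y is orthogonal to it. As v - (f v / f z) z lies in the kernel, [f] is a
    multiple of the product with z. *)
Lemma riesz (f : X -> R) M : (forall k x y, f (k *: x + y) = k * f x + f y) ->
  (forall x, `|f x| <= M * `|x|) -> exists z, forall x, f x = ip z x.
Proof.
move=> lf fM.
have fZ k x : f (k *: x) = k * f x.
  have f0 : f 0 = 0.
    by apply/eqP; rewrite -normr_le0 (le_trans (fM 0))// normr0 mulr0.
  by rewrite -[k *: x]addr0 lf f0 addr0.
have fB x y : f (x - y) = f x - f y by rewrite addrC -scaleN1r lf mulN1r addrC.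
have [f0|] := pselect (forall x, f x = 0).
  by exists 0 => x; rewrite ip0l f0.
move=> /existsNP[x /eqP fx0].
have [|||y_ [fy cy oy]] :=
    @si_almost_projection _ _ setT ip siX [set y | f y = 0] x I.
- by [].
- by rewrite /= -(scale0r x) fZ mul0r.
- by move=> k y z /= fy fz; rewrite lf fy fz mulr0 addr0.
have [y yy] := hilbert_complete hX (cauchy_norm_sqdist cy).
have fz : f (x - y) = f x.
  suff : f y = 0 by move=> fy0; rewrite fB fy0 subr0.
  apply/eqP; rewrite -normr_eq0; apply/eqP.
  have : `|f y| @[n --> \oo] --> (0 : R).
    apply: (@squeeze_cvgr _ _ _ _ (cst 0) (fun n => M * `|y_ n - y|)).
    - apply: nearW => n; rewrite normr_ge0/= (le_trans _ (fM _))//.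
      by rewrite fB fy sub0r normrN.
    - exact: cvg_cst.
    - by rewrite -[X in _ --> X](mulr0 M); exact: cvgMr.
  by move/cvg_lim => <- //; rewrite lim_cst.
have oz w : f w = 0 -> ip (x - y) w = 0.
  move=> fw; have := oy _ fw; move/cvg_lim => <- //.
  apply/esym/cvg_lim => //; apply: (si_cvgl siX) => //.
  under eq_fun do rewrite sqdist_ip opprB addrC addrA subrK distrC.
  exact: cvg_sqr0.
set z := x - y in fz oz.
have z0 : ip z z != 0.
  apply: contra_neq fx0; rewrite ip_norm// -fz => /eqP.
  by rewrite sqrf_eq0 normr_eq0 => /eqP ->; rewrite -(scale0r x) fZ mul0r.
exists ((f z / ip z z) *: z) => v.
have /oz : f (v - (f v / f z) *: z) = 0 by rewrite fB fZ divfK ?subrr// fz.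
rewrite ipBr ipZr ipZl => /subr0_eq ->; field.
by rewrite fz fx0 ?z0.
Qed.

End real_hilbert.

(** * Square-integrable functions with values in a Hilbert space *)

Section L2_functions.
Context {R : realType} {X : normedModType R} (ip : X -> X -> R).
Hypothesis hX : real_hilbert ip.
Variables (d_ : nat -> X) (T : R).
Hypothesis d_dense : forall x e, 0 < e -> exists k, `|x - d_ k| < e.

Local Notation RT := (measurableTypeR R).
Local Notation mu := (@lebesgue_measure R).
Local Notation IT := (`[0%R, T]%classic : set RT).
Local Notation mfun f := (measurable_fun [set: RT] (f : RT -> R)).

Let siX : semi_inner setT ip := hX.

Definition integrable_on (f : R -> R) := mu.-integrable IT (EFin \o f).

Lemma mI : measurable IT. Proof. exact: measurable_itv. Qed.

Lemma integrable_onD f g : integrable_on f -> integrable_on g ->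
  integrable_on (fun t => f t + g t).
Proof. by move=> fi gi; exact: (integrableD mI fi gi). Qed.

Lemma integrable_onB f g : integrable_on f -> integrable_on g ->
  integrable_on (fun t => f t - g t).
Proof. by move=> fi gi; exact: (integrableB mI fi gi). Qed.

Lemma integrable_onZ k f : integrable_on f -> integrable_on (fun t => k * f t).
Proof. by move=> fi; exact: (integrableZl mI k fi). Qed.

Lemma integrable_on_le f g : mfun f -> (forall t, t \in IT -> `|f t| <= g t) ->
  integrable_on g -> integrable_on f.
Proof.
move=> mf fg; apply: le_integrable; [exact: mI| |].
  by apply/measurable_EFinP; exact: measurable_funTS.
move=> t tI; rewrite lee_fin (le_trans (fg _ _)) ?inE//; exact: ler_norm.
Qed.

Lemma integrable_on_bounded f M : mfun f -> (forall t, t \in IT -> `|f t| <= M) ->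
  integrable_on f.
Proof.
move=> mf fM; apply: measurable_bounded_integrable.
- exact: mI.
- exact/compact_finite_measure/segment_compact.
- exact: measurable_funTS.
- exists M; split; first exact: num_real.
  by move=> N MN t tI /=; apply: le_trans (ltW MN); apply: fM; rewrite inE.
Qed.

(** For separable [X] this is strong measurability, by Pettis' theorem; stated with scalar functions
    it needs no sigma-algebra on [X]. *)
Definition weakly_measurable (f : R -> X) :=
  forall v, mfun (fun t => ip (f t) v).

Lemma weakly_measurable_lin k f g : weakly_measurable f ->
  weakly_measurable g -> weakly_measurable (fun t => k *: f t + g t).
Proof.
move=> mf mg v; under eq_fun do rewrite (ipDl hX) (ipZl hX).
apply: measurable_funD => //; exact: measurable_funM.
Qed.

Lemma weakly_measurable_scale (phi : R -> R) f : mfun phi ->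
  weakly_measurable f -> weakly_measurable (fun t => phi t *: f t).
Proof.
move=> mphi mf v; under eq_fun do rewrite (ipZl hX).
exact: measurable_funM.
Qed.

Lemma weakly_measurable_cst x : weakly_measurable (fun=> x).
Proof. by move=> v; exact: measurable_cst. Qed.

Lemma weakly_measurable_cvg (f_ : nat -> R -> X) f :
  (forall n, weakly_measurable (f_ n)) ->
  (forall t, `|f_ n t - f t| @[n --> \oo] --> 0) -> weakly_measurable f.
Proof.
move=> mf_ f_f v; apply: (measurable_fun_cvg (fun n => mf_ n v)) => t _.
apply: (si_cvgl siX) => //; under eq_fun do rewrite (sqdist_ip hX).
exact: cvg_sqr0.
Qed.

(* The squared norm is the supremum of [2 <x, d> - |d|^2] over a dense set. *)
Lemma norm_measurable f : weakly_measurable f -> mfun (fun t => `|f t|).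
Proof.
move=> mf.
have -> : (fun t => `|f t|) = fun t => Num.sqrt (`|f t| ^+ 2).
  by apply/funext => t; rewrite sqrtr_sqr normr_id.
apply: (measurableT_comp (f := @Num.sqrt R)).
  exact: (continuous_measurable_fun (@sqrt_continuous R)).
move=> _; apply: (measurability _ (RGenOInfty.measurableE R)) => //.
move=> /= _ [_ [a ->] <-]; rewrite setTI preimage_itvoy.
have -> : [set t | a < `|f t| ^+ 2] =
    \bigcup_k [set t : RT | a < 2 * ip (f t) (d_ k) - `|d_ k| ^+ 2].
  have H x y : 2 * ip x y - `|y| ^+ 2 = `|x| ^+ 2 - `|x - y| ^+ 2.
    rewrite -(sqdist_ip hX x y) (sqdistE siX)// !(ip_norm hX); ring.
  apply/seteqP; split => [t /= ft|t [k _] /=]; last first.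
    by rewrite H => /lt_le_trans; apply; rewrite gerBl sqr_ge0.
  have e0 : 0 < Num.sqrt (`|f t| ^+ 2 - a) by rewrite sqrtr_gt0 subr_gt0.
  have [k fk] := d_dense (f t) e0; exists k => //=; rewrite H ltrBrDr addrC -ltrBrDr.
  rewrite -[ltRHS]sqr_sqrtr ?ltr_pXn2r ?nnegrE//.
  by rewrite subr_ge0 ltW.
apply: bigcup_measurable => k _.
have m : mfun (fun t => 2 * ip (f t) (d_ k) - `|d_ k| ^+ 2).
  by apply: measurable_funB => //; exact: measurable_funM.
have := m measurableT `]a, +oo[%classic (measurable_itv _).
by rewrite setTI preimage_itvoy.
Qed.

Lemma norm_sqr_measurable f : weakly_measurable f -> mfun (fun t => `|f t| ^+ 2).
Proof. by move=> mf; apply: measurable_funX; exact: norm_measurable. Qed.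

(** Polarisation reduces the product to norms, whose measurability is known. *)
Lemma ip_measurable f g : weakly_measurable f -> weakly_measurable g ->
  mfun (fun t => ip (f t) (g t)).
Proof.
move=> mf mg.
have -> : (fun t => ip (f t) (g t)) = fun t => 2^-1 *
    (`|1 *: f t + g t| ^+ 2 - (`|f t| ^+ 2 + `|g t| ^+ 2)).
  apply/funext => t; rewrite scale1r -!(ip_norm hX) (si_sqrD siX)//; lra.
apply: measurable_funM => //; apply: measurable_funB.
  by apply: norm_sqr_measurable; exact: weakly_measurable_lin.
by apply: measurable_funD; exact: norm_sqr_measurable.
Qed.

Definition L2 : set (R -> X) :=
  [set f | weakly_measurable f /\ integrable_on (fun t => `|f t| ^+ 2)].

Definition L2ip (f g : R -> X) : R := \int[mu]_(t in IT) ip (f t) (g t).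

Lemma L2_le f g : L2 f -> weakly_measurable g ->
  (exists M, forall t, t \in IT -> `|g t| <= M * `|f t|) -> L2 g.
Proof.
move=> [mf fi] mg [M gMf]; split => //.
apply: integrable_on_le (integrable_onZ (M ^+ 2) fi).
  exact: norm_sqr_measurable.
move=> t tI; rewrite ger0_norm ?sqr_ge0// -exprMn.
have := gMf t tI; rewrite -(ler_pXn2r (n := 2)) ?nnegrE//.
exact: le_trans (gMf t tI).
Qed.

Lemma L2_lin k f g : L2 f -> L2 g -> L2 (fun t => k *: f t + g t).
Proof.
move=> [mf fi] [mg gi]; have mkfg := weakly_measurable_lin k mf mg.
split => //; apply: integrable_on_le
    (integrable_onD (integrable_onZ (2 * k ^+ 2) fi) (integrable_onZ 2 gi)).
  exact: norm_sqr_measurable.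
move=> t tI; rewrite ger0_norm ?sqr_ge0// -!(ip_norm hX).
have := si_sqrD_le siX (x := k *: f t) (y := g t) I I.
by rewrite (si_sqrZ siX)// mulrA.
Qed.

Lemma L2_integrable f g : L2 f -> L2 g -> integrable_on (fun t => ip (f t) (g t)).
Proof.
move=> [mf fi] [mg gi]; apply: integrable_on_le (integrable_onD fi gi).
  exact: ip_measurable.
move=> t _; rewrite (le_trans (ip_le hX _ _))//.
have := sqr_ge0 (`|f t| - `|g t|); rewrite sqrrB.
have := mulr_ge0 (normr_ge0 (f t)) (normr_ge0 (g t)); lra.
Qed.

Lemma L2_semi_inner : semi_inner L2 L2ip.
Proof.
split.
- split; first exact: (weakly_measurable_cst 0).
  apply: (@integrable_on_bounded _ 0) => [|t _].
    exact: (norm_sqr_measurable (weakly_measurable_cst 0)).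
  by rewrite -[(0 : R -> X) t]/(0 : X) normr0 expr0n normr0.
- by move=> k f g; exact: L2_lin.
- move=> k f g h Lf Lg Lh; rewrite /L2ip -RintegralZl ?mI//; last exact: L2_integrable.
  rewrite -RintegralD ?mI//; last exact: L2_integrable.
    by apply: eq_Rintegral => t _; rewrite [LHS](ipDr hX) (ipZr hX).
  by apply: integrable_onZ; exact: L2_integrable.
- by move=> f g _ _; apply: eq_Rintegral => t _; rewrite (ipC hX).
- by move=> f _; apply: Rintegral_ge0 => t _; rewrite (ip_norm hX) sqr_ge0.
Qed.

Lemma L2ip_sqr f : L2ip f f = \int[mu]_(t in IT) `|f t| ^+ 2.
Proof. by apply: eq_Rintegral => t _; rewrite (ip_norm hX). Qed.

Lemma sqdist_L2 f g : sqdist L2ip f g = \int[mu]_(t in IT) `|f t - g t| ^+ 2.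
Proof. exact: L2ip_sqr. Qed.

End L2_functions.

Lemma cvg_pow_half (R : realType) (k : R) : k * 2^-1 ^+ n @[n --> \oo] --> 0.
Proof.
rewrite -[X in _ --> X](mulr0 k); apply: cvgMr; apply: cvg_expr.
by rewrite ger0_norm ?invr_ge0// invf_lt1// ltr1n.
Qed.

(** The rate is explicit so that, applied pointwise in t, it can be squared and integrated. *)
Lemma geometric_cvg (R : realType) (X : normedModType R) (ip : X -> X -> R)
    (x_ : nat -> X) (s : R) : real_hilbert ip ->
  (forall k, `|x_ k.+1 - x_ k| <= s * 2^-1 ^+ k) ->
  exists x, forall n, `|x_ n - x| <= 2 * s * 2^-1 ^+ n.
Proof.
move=> hX xs.
have s0 : 0 <= s by have := le_trans (normr_ge0 _) (xs 0%N); rewrite expr0 mulr1.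
have H n p : `|x_ (n + p)%N - x_ n| <= 2 * s * (2^-1 ^+ n - 2^-1 ^+ (n + p)).
  elim: p => [|p IH]; first by rewrite addn0 !subrr normr0 mulr0.
  rewrite addnS; have -> : x_ (n + p).+1 - x_ n =
      (x_ (n + p).+1 - x_ (n + p)%N) + (x_ (n + p)%N - x_ n) by rewrite addrA subrK.
  apply: (le_trans (ler_normD _ _)); apply: (le_trans (lerD (xs _) IH)).
  by rewrite exprS; lra.
have {}H m n : (n <= m)%N -> `|x_ m - x_ n| <= 2 * s * 2^-1 ^+ n.
  move=> nm; rewrite -(subnKC nm) (le_trans (H n _))// ler_wpM2l ?mulr_ge0//.
  by rewrite gerBl exprn_ge0.
have [|x xx] := hilbert_complete hX (x_ := x_).
  move=> e e0; have e2 : 0 < e / 2 by rewrite divr_gt0.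
  move/cvgrPdist_lt : (cvg_pow_half (2 * s)) => /(_ _ e2)[n0 _ Hn0].
  exists n0 => m n mn nn.
  have {Hn0} := Hn0 n0 (leqnn _); rewrite /= sub0r normrN ger0_norm; last first.
    by rewrite !mulr_ge0// exprn_ge0.
  have := H _ _ mn; have := H _ _ nn; rewrite (distrC (x_ n)).
  have := ler_distD (x_ n0) (x_ m) (x_ n); lra.
exists x => n; apply/ler_addgt0Pr => e e0.
move/cvgrPdist_lt : xx => /(_ _ e0)[n1 _ Hn1].
have := Hn1 (maxn n n1) (leq_maxr _ _); rewrite /= sub0r normrN normr_id.
have := H _ _ (leq_maxl n n1); rewrite distrC.
have := ler_distD (x_ (maxn n n1)) (x_ n) x; lra.
Qed.

(** * Completeness of the space of square-integrable functions *)

Section L2_complete.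
Context {R : realType} {X : normedModType R} (ip : X -> X -> R).
Hypothesis hX : real_hilbert ip.
Variables (d_ : nat -> X) (T : R).
Hypothesis d_dense : forall x e, 0 < e -> exists k, `|x - d_ k| < e.

Local Notation RT := (measurableTypeR R).
Local Notation mu := (@lebesgue_measure R).
Local Notation IT := (`[0%R, T]%classic : set RT).
Local Notation mfun f := (measurable_fun [set: RT] (f : RT -> R)).
Local Notation L2 := (L2 ip T).
Local Notation L2ip := (L2ip ip T).
Let siX : semi_inner setT ip := hX.
Let siL : semi_inner L2 L2ip := L2_semi_inner hX T d_dense.

Lemma sqdist_L2_int f g : L2 f -> L2 g ->
  (\int[mu]_(t in IT) (`|f t - g t| ^+ 2)%:E = (sqdist L2ip f g)%:E)%E.
Proof.
move=> Lf Lg; rewrite (sqdist_L2 hX) /Rintegral fineK//.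
by apply: integrable_fin_num; [exact: mI | exact: (siB_mem siL Lf Lg).2].
Qed.

(* The weights [4 ^ k] turn summability of the squared distances into
   pointwise geometric convergence off the null set where [g] is infinite. *)
Lemma L2_complete_fast (f_ : nat -> R -> X) : (forall n, L2 (f_ n)) ->
  (forall k, sqdist L2ip (f_ k.+1) (f_ k) <= 8^-1 ^+ k) ->
  exists f, [/\ L2 f, sqdist L2ip (f_ n) f @[n --> \oo] --> 0 &
    {ae mu, forall t, t \in IT -> `|f_ n t - f t| @[n --> \oo] --> 0}].
Proof.
move=> Lf_ f_fast.
pose S k t : \bar R := (4 ^+ k * `|f_ k.+1 t - f_ k t| ^+ 2)%:E.
have Lfk k := siB_mem siL (Lf_ k.+1) (Lf_ k).
have S0 k t : (0 <= S k t)%E by rewrite lee_fin mulr_ge0 ?exprn_ge0// sqr_ge0.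
have mS k : measurable_fun [set: RT] (S k).
  apply/measurable_EFinP; apply: measurable_funM => //.
  exact: (norm_sqr_measurable hX d_dense (Lfk k).1).
pose g t : \bar R := (\sum_(k <oo) S k t)%E.
have mg : measurable_fun [set: RT] g.
  exact: (@ge0_emeasurable_sum _ RT R setT S xpredT).
have g0 t : (0 <= g t)%E by exact: nneseries_ge0.
have Sg k t : (S k t <= g t)%E.
  have := @nneseries_lim_ge R (S ^~ t) xpredT 0 k.+1 (fun n _ _ => S0 n t).
  apply: le_trans; rewrite big_nat_recr//= leeDr// sume_ge0//.
have intg : (\int[mu]_(t in IT) g t <= 2%:E)%E.
  rewrite integral_nneseries//; last by move=> n; exact: measurable_funTS.
  apply: lime_le; first by apply: is_cvg_nneseries => n _ _; exact: integral_ge0.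
  apply: nearW => n; apply: (@le_trans _ _ (\sum_(0 <= k < n) (2^-1 ^+ k)%:E)%E).
    apply: lee_sum => k _; rewrite /S.
    under eq_integral do rewrite EFinM.
    rewrite ge0_integralZl//; last first.
      apply/measurable_EFinP; apply: measurable_funTS.
      exact: (norm_sqr_measurable hX d_dense (Lfk k).1).
    rewrite sqdist_L2_int// -EFinM lee_fin.
    have -> : (2^-1 : R) ^+ k = 4 ^+ k * 8^-1 ^+ k.
      by rewrite -exprMn; congr (_ ^+ _); field.
    by rewrite ler_wpM2l// exprn_ge0.
  rewrite sumEFin lee_fin.
  suff : \sum_(0 <= k < n) (2^-1 : R) ^+ k = 2 - 2 * 2^-1 ^+ n.
    by move=> ->; rewrite gerBl mulr_ge0// exprn_ge0.
  elim: n => [|n IH]; first by rewrite big_nil expr0; lra.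
  by rewrite big_nat_recr//= IH exprS; field.
have gi : mu.-integrable IT g.
  apply/integrableP; split; first exact: measurable_funTS.
  under eq_integral do rewrite gee0_abs//.
  exact: le_lt_trans intg (ltry _).
pose E := [set t | (g t < +oo)%E].
have mE : measurable (E : set RT).
  by rewrite -[E]setTI; exact: emeasurable_fun_infty_o.
(* The value 0 off [E] makes the limit the pointwise limit of the indicator of [E] times [f_ n],
   hence measurable. *)
have pt t : exists x, if t \in E then
    forall n, `|f_ n t - x| <= 2 * Num.sqrt (fine (g t)) * 2^-1 ^+ n
    else x = 0.
  have [|_] := boolP (t \in E); last by exists 0.
  rewrite inE /E/= => gt; apply: (geometric_cvg hX) => k.
  have gfin : g t \is a fin_num by rewrite ge0_fin_numE.
  rewrite -[leLHS]normr_id -sqrtr_sqr.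
  have -> : (2^-1 : R) ^+ k = Num.sqrt ((4 ^+ k)^-1).
    rewrite -[LHS]ger0_norm ?exprn_ge0// -sqrtr_sqr -exprM mulnC exprM.
    by rewrite -exprVn; congr (Num.sqrt (_ ^+ _)); field.
  rewrite -sqrtrM ?fine_ge0// ler_wsqrtr// ler_pdivlMr ?exprn_gt0// mulrC.
  by rewrite -lee_fin fineK//; exact: Sg.
pose f t := projT1 (cid (pt t)).
have fE t : t \in E -> forall n,
    `|f_ n t - f t| <= 2 * Num.sqrt (fine (g t)) * 2^-1 ^+ n.
  by move=> tE; rewrite /f; case: cid => /= x; rewrite tE.
have fNE t : t \notin E -> f t = 0.
  by move=> tE; rewrite /f; case: cid => /= x; rewrite (negbTE tE).
have f_f t : t \in E -> `|f_ n t - f t| @[n --> \oo] --> 0.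
  move=> tE; apply: (@squeeze_cvgr _ _ _ _ (cst 0)
    (fun n => 2 * Num.sqrt (fine (g t)) * 2^-1 ^+ n)).
  - by apply: nearW => n; rewrite normr_ge0/= fE.
  - exact: cvg_cst.
  - exact: cvg_pow_half.
have mf : weakly_measurable ip f.
  apply: (@weakly_measurable_cvg _ _ _ hX (fun n t => \1_E t *: f_ n t)).
    move=> n; apply: (weakly_measurable_scale hX); last by case: (Lf_ n).
    exact: measurable_indic.
  move=> t; rewrite indicE; have [tE|tE] := boolP (t \in E).
    by under eq_cvg do rewrite scale1r; exact: f_f.
  under eq_cvg do rewrite scale0r fNE// subrr normr0.
  exact: cvg_cst.
(* Off [E] the right-hand side is infinite, so the bound holds at every t and can be integrated. *)
have bound n t : ((`|f_ n t - f t| ^+ 2)%:E <= (4 * 4^-1 ^+ n)%:E * g t)%E.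
  have [tE|] := boolP (t \in E).
    have gfin : g t \is a fin_num by move: tE; rewrite inE ge0_fin_numE.
    rewrite -(fineK gfin) -EFinM lee_fin.
    have -> : 4 * 4^-1 ^+ n * fine (g t) =
        (2 * Num.sqrt (fine (g t)) * 2^-1 ^+ n) ^+ 2.
      rewrite !exprMn sqr_sqrtr ?fine_ge0// -exprM mulnC exprM.
      rewrite (_ : (2^-1 : R) ^+ 2 = 4^-1); last by field.
      by rewrite (_ : (2 : R) ^+ 2 = 4); [ring|ring].
    by rewrite ler_pXn2r ?nnegrE// ?fE// !mulr_ge0// ?sqrtr_ge0// exprn_ge0.
  rewrite notin_setE /E/= => /negP; rewrite -leNgt leye_eq => /eqP ->.
  by rewrite gt0_muley ?leey// lte_fin mulr_gt0// exprn_gt0.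
have mfn n : weakly_measurable ip (f_ n \- f).
  have -> : f_ n \- f = fun t => (-1) *: f t + f_ n t.
    by apply/funext => t; rewrite scaleN1r addrC.
  by apply: (weakly_measurable_lin hX) => //; case: (Lf_ n).
have int_bound n :
    (\int[mu]_(t in IT) (`|f_ n t - f t| ^+ 2)%:E <= (8 * 4^-1 ^+ n)%:E)%E.
  apply: (@le_trans _ _ (\int[mu]_(t in IT) ((4 * 4^-1 ^+ n)%:E * g t))%E).
    apply: ge0_le_integral => //.
    - apply/measurable_EFinP; apply: measurable_funTS.
      exact: (norm_sqr_measurable hX d_dense (mfn n)).
    - by apply: measurable_funTS; exact: measurable_funeM.
  rewrite ge0_integralZl//; last exact: measurable_funTS.
  have -> : 8 * 4^-1 ^+ n = 4 * 4^-1 ^+ n * 2 :> R by ring.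
  by rewrite [leRHS]EFinM lee_wpmul2l// lee_fin mulr_ge0// exprn_ge0.
have Lfn n : L2 (f_ n \- f).
  split=> //; apply/integrableP; split.
    apply/measurable_EFinP; apply: measurable_funTS.
    exact: (norm_sqr_measurable hX d_dense (mfn n)).
  under eq_integral do rewrite /= ger0_norm ?sqr_ge0//.
  exact: le_lt_trans (int_bound n) (ltry _).
have Lf : L2 f.
  have -> : f = f_ 0%N - (f_ 0%N \- f).
    by apply/funext => t; rewrite !fctE opprB addrC subrK.
  exact: (siB_mem siL (Lf_ 0%N) (Lfn 0%N)).
exists f; split => //.
- apply: (@squeeze_cvgr _ _ _ _ (cst 0) (fun n => 8 * 2^-1 ^+ n)).
  + apply: nearW => n; rewrite (sqdist_ge0 siL)//= -lee_fin -sqdist_L2_int//.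
    apply: (le_trans (int_bound n)); rewrite lee_fin ler_wpM2l// lerXn2r ?nnegrE//.
    by rewrite lef_pV2 ?posrE// ler_nat.
  + exact: cvg_cst.
  + exact: cvg_pow_half.
- have := integrable_ae (mI T) gi; apply: filterS => t gt tI; apply: f_f.
  by rewrite inE /E/= -ge0_fin_numE//; apply: gt; rewrite -in_setE.
Qed.

(** Almost everywhere convergence holds only along a subsequence. The subsequence is part of the
    conclusion because the continuous representative of the solution is identified along it. *)
Lemma L2_complete (f_ : nat -> R -> X) : (forall n, L2 (f_ n)) ->
  cauchy_for (sqdist L2ip) f_ ->
  exists f (phi : nat -> nat), [/\ L2 f, sqdist L2ip (f_ n) f @[n --> \oo] --> 0,
    (forall n, (n <= phi n)%N) &
    {ae mu, forall t, t \in IT -> `|f_ (phi n) t - f t| @[n --> \oo] --> 0}].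
Proof.
move=> Lf_ cf.
have p8 k : 0 < (8^-1 : R) ^+ k by rewrite exprn_gt0.
pose N k := projT1 (cid (cf _ (p8 k))).
have HN k m n : (N k <= m)%N -> (N k <= n)%N ->
    sqdist L2ip (f_ m) (f_ n) < 8^-1 ^+ k.
  by rewrite /N; case: cid => n0 /= H; exact: H.
pose phi := fix phi k := if k is k'.+1 then maxn (N k) (phi k').+1 else N 0%N.
have Nphi k : (N k <= phi k)%N by case: k => //= k; exact: leq_maxl.
have phiS k : (phi k < phi k.+1)%N by exact: leq_maxr.
have phi_ge n : (n <= phi n)%N by elim: n => // n IH; exact: leq_ltn_trans (phiS n).
have [|f [Lf ff aef]] := @L2_complete_fast (f_ \o phi) (fun n => Lf_ _).
  by move=> k; apply/ltW/HN; [exact: leq_trans (Nphi k) (ltnW (phiS k))|].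
exists f, phi; split => //.
apply/cvgrPdist_lt => e e0; have e4 : 0 < e / 4 by rewrite divr_gt0.
move/cvgrPdist_lt : ff => /(_ _ e4)[n1 _ Hn1].
have [n2 Hn2] := cf _ e4; exists n2 => // n /= n2n.
rewrite sub0r normrN ger0_norm; last exact: (sqdist_ge0 siL).
have := Hn1 (maxn n1 n2) (leq_maxl _ _); rewrite /= sub0r normrN ger0_norm; last first.
  exact: (sqdist_ge0 siL).
have := Hn2 n (phi (maxn n1 n2)) n2n
  (leq_trans (leq_maxr n1 n2) (phi_ge _)).
have := sqdist_triangle siL (Lf_ n) (Lf_ (phi (maxn n1 n2))) Lf; lra.
Qed.

End L2_complete.

(** * Finite sums of scalar functions times vectors *)

Section primitives.
Context {R : realType}.
Local Notation mu := (@lebesgue_measure R).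
Implicit Types f F : R -> R.

Lemma continuous_integrable_itv f a b : continuous f ->
  mu.-integrable `[a, b] (EFin \o f).
Proof.
move=> cf; apply: continuous_compact_integrable; first exact: segment_compact.
exact: continuous_subspaceT.
Qed.

(** The derivative is wanted on the whole line, while the fundamental theorem concerns integrals
    from a fixed left endpoint. Near [x] the primitive differs by a constant from the integral from
    -M, with M = |x| + 1. *)
Lemma continuous_primitive f : continuous f ->
  exists F, forall t, is_derive t (1 : R) F (f t).
Proof.
move=> cf; pose int a b := \int[mu]_(t in `[a, b]) f t.
pose F x := if 0 <= x then \int[mu]_(t in `]0, x]) f t
  else - \int[mu]_(t in `]x, 0]) f t.
have FE M x : 0 <= M -> - M <= x -> int (- M) x - int (- M) 0 = F x.
  move=> M0 Mx; rewrite /F /int; have [x0|x0] := leP 0 x.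
    rewrite (@Rintegral_itvB _ _ _ _ 0)// ?bnd_simp//.
      exact: continuous_integrable_itv.
    by rewrite oppr_le0.
  rewrite -opprB (@Rintegral_itvB _ _ _ _ x)// ?bnd_simp//.
    exact: continuous_integrable_itv.
  exact: ltW.
exists F => x; pose M := `|x| + 1.
have M0 : 0 <= M by rewrite addr_ge0.
have Mx : - M < x by rewrite /M ltrNl (le_lt_trans (ler_norm _))// normrN ltrDl.
apply: (@near_eq_is_derive _ _ _ (fun y => int (- M) y - int (- M) 0)).
  by near=> y; apply: FE => //; apply: ltW; near: y; exact: lt_nbhsr.
have := @continuous_FTC1_closed R f (- M) x (x + 1) (ltr_pwDr ltr01 (lexx x))
  (continuous_integrable_itv _ _ cf) Mx (cf x).
move=> [dF fE]; rewrite -[f x]subr0.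
have dint : is_derive x (1 : R) (int (- M)) (f x).
  by apply: DeriveDef => //; rewrite -fE derive1E.
have dcst := is_derive_cst (int (- M) 0) x (1 : R).
exact: (is_deriveB dint dcst).
Unshelve. all: by end_near. Qed.

Lemma FTC2 f F a b : continuous f -> (forall t, is_derive t (1 : R) F (f t)) ->
  a <= b -> \int[mu]_(t in `[a, b]) f t = F b - F a.
Proof.
move=> cf dF; rewrite le_eqVlt => /predU1P[->|ab].
  by rewrite set_itv1 Rintegral_set1 subrr.
have cF : continuous F.
  move=> t; apply: differentiable_continuous; apply/derivable1_diffP.
  by case: (dF t).
rewrite /Rintegral (@continuous_FTC2 _ _ F)//.
- exact: continuous_subspaceT.
- split; first by move=> t _; case: (dF t).
  + exact: cvg_at_right_filter (cF a).
  + exact: cvg_at_left_filter (cF b).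
- by move=> t _; rewrite derive1E; case: (dF t).
Qed.

Lemma is_derive_continuous f F : (forall t, is_derive t (1 : R) F (f t)) ->
  continuous F.
Proof.
move=> dF t; apply: differentiable_continuous; apply/derivable1_diffP.
by case: (dF t).
Qed.

End primitives.

Section elementary.
Context {R : realType} {X : lmodType R}.
Implicit Types (u y : R -> X) (rho F : R -> R).

(** Inductive, so that linear maps and bilinear forms are handled by induction on the sum; the
    coefficients are continuous on the whole line, so that no one-sided conditions arise at 0 and
    T. *)
Inductive elementary : (R -> X) -> Prop :=
| elementary0 : elementary (fun=> 0)
| elementaryS rho v y : continuous rho -> elementary y ->
    elementary (fun t => rho t *: v + y t).

(* [C1_pair u y]: u is an elementary primitive of the elementary y. *)
Inductive C1_pair : (R -> X) -> (R -> X) -> Prop :=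
| C1_pair0 : C1_pair (fun=> 0) (fun=> 0)
| C1_pairS F rho v u y : continuous rho ->
    (forall t, is_derive t (1 : R) F (rho t)) -> C1_pair u y ->
    C1_pair (fun t => F t *: v + u t) (fun t => rho t *: v + y t).

Lemma elementary_lin k y z : elementary y -> elementary z ->
  elementary (fun t => k *: y t + z t).
Proof.
move=> ey ez; elim: ey => [|rho v {}y crho _ IH].
  rewrite (_ : (fun t => _) = z)//.
  by apply/funext => t; rewrite scaler0 add0r.
rewrite (_ : (fun t => _) = fun t => (k * rho t) *: v + (k *: y t + z t)).
  by apply: elementaryS => // t; apply: cvgMr; exact: crho.
by apply/funext => t; rewrite scalerDr scalerA addrA.
Qed.

Lemma elementary_cst v : elementary (fun=> v).
Proof.
rewrite (_ : (fun=> v) = fun t : R => (cst 1 t : R) *: v + (fun=> 0) t).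
  by apply: elementaryS (elementary0) => t; exact: cvg_cst.
by apply/funext => t; rewrite scale1r addr0.
Qed.

Lemma elementary_scale rho y : continuous rho -> elementary y ->
  elementary (fun t => rho t *: y t).
Proof.
move=> crho; elim=> [|f v {}y cf _ IH].
  by under eq_fun do rewrite scaler0; exact: elementary0.
rewrite (_ : (fun t => _) = fun t => (rho t * f t) *: v + rho t *: y t).
  by apply: elementaryS => // t; apply: cvgM; [exact: crho|exact: cf].
by apply/funext => t; rewrite scalerDr scalerA.
Qed.

Lemma C1_pair_elementary u y : C1_pair u y -> elementary u /\ elementary y.
Proof.
elim=> [|F rho v {}u {}y crho dF _ [eu ey]]; first by split; exact: elementary0.
split; apply: elementaryS => //; exact: is_derive_continuous dF.
Qed.

Lemma C1_pair_lin k u y u' y' : C1_pair u y -> C1_pair u' y' ->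
  C1_pair (fun t => k *: u t + u' t) (fun t => k *: y t + y' t).
Proof.
move=> uy uy'; elim: uy => [|F rho v {}u {}y crho dF _ IH].
  rewrite (_ : (fun t => _) = u'); last first.
    by apply/funext => t; rewrite scaler0 add0r.
  rewrite (_ : (fun t => _) = y')//.
  by apply/funext => t; rewrite scaler0 add0r.
rewrite (_ : (fun t => _) = fun t => (k * F t) *: v + (k *: u t + u' t)); last first.
  by apply/funext => t; rewrite scalerDr scalerA addrA.
rewrite (_ : (fun t => k *: (rho t *: v + y t) + y' t) =
    fun t => (k * rho t) *: v + (k *: y t + y' t)); last first.
  by apply/funext => t; rewrite scalerDr scalerA addrA.
by apply: C1_pairS => // t; apply: cvgMr; exact: crho.
Qed.

Lemma C1_pair_cst v : C1_pair (fun=> v) (fun=> 0).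
Proof.
rewrite (_ : (fun=> v) = fun t : R => (cst 1 t : R) *: v + (fun=> 0) t); last first.
  by apply/funext => t; rewrite scale1r addr0.
rewrite (_ : (fun=> 0) = fun t : R => (cst 0 t : R) *: v + (fun=> 0) t); last first.
  by apply/funext => t; rewrite scale0r addr0.
by apply: C1_pairS C1_pair0 => t; exact: cvg_cst.
Qed.

Lemma elementary_primitive y : elementary y -> exists2 u, C1_pair u y & u 0 = 0.
Proof.
elim=> [|rho v {}y crho _ [u uy u0]]; first by exists (fun=> 0) => //; exact: C1_pair0.
have [F dF] := continuous_primitive crho.
exists (fun t => (F t - F 0) *: v + u t); last by rewrite subrr scale0r add0r.
apply: C1_pairS => // t; rewrite -[rho t]subr0.
exact: (is_deriveB (dF t) (is_derive_cst (F 0) t (1 : R))).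
Qed.

Definition bilinear_form (B : X -> X -> R) :=
  (forall k (x y z : X), B (k *: x + y) z = k * B x z + B y z) /\
  (forall k (x y z : X), B z (k *: x + y) = k * B z x + B z y).

Lemma bilinear_form0l B x : bilinear_form B -> B 0 x = 0.
Proof.
move=> [Bl _]; have := Bl 1 0 0 x; rewrite scale1r addr0 mul1r => /eqP.
by rewrite -subr_eq0 opprD addNKr oppr_eq0 => /eqP.
Qed.

Lemma bilinear_form0r B x : bilinear_form B -> B x 0 = 0.
Proof.
move=> [_ Br]; have := Br 1 0 0 x; rewrite scale1r addr0 mul1r => /eqP.
by rewrite -subr_eq0 opprD addNKr oppr_eq0 => /eqP.
Qed.

Lemma bilinear_formZl B k x z : bilinear_form B -> B (k *: x) z = k * B x z.
Proof.
move=> bB; have [Bl _] := bB.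
by rewrite -[k *: x]addr0 Bl bilinear_form0l ?addr0.
Qed.

Lemma elementary_continuous B y z : bilinear_form B ->
  elementary y -> elementary z -> continuous (fun t => B (y t) (z t)).
Proof.
move=> bB ey ez; have [Bl Br] := bB.
have H v : continuous (fun t => B v (z t)).
  elim: ez => [|rho w {}z crho _ IH].
    by under eq_fun do rewrite bilinear_form0r//; move=> t; exact: cvg_cst.
  under eq_fun do rewrite Br.
  move=> t; apply: cvgD; [|exact: IH].
  by apply: cvgMl; exact: crho.
elim: ey => [|rho v {}y crho _ IH].
  by under eq_fun do rewrite bilinear_form0l//; move=> t; exact: cvg_cst.
under eq_fun do rewrite Bl.
move=> t; apply: cvgD; [|exact: IH].
by apply: cvgM; [exact: crho|exact: H].
Qed.

(** Both functions are finite sums with scalar coefficients, so bilinearity alone reduces this to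
    the scalar product rule. It serves for the inner product of [X] and for the pivot form. *)
Lemma C1_pair_derive B u y z zeta : bilinear_form B ->
  C1_pair u y -> C1_pair z zeta -> forall t,
  is_derive t (1 : R) (fun t => B (u t) (z t)) (B (y t) (z t) + B (u t) (zeta t)).
Proof.
move=> bB uy zz; have [Bl Br] := bB.
have H v t : is_derive t (1 : R) (fun t => B v (z t)) (B v (zeta t)).
  elim: zz => [|F rho w {}z {}zeta crho dF _ IH].
    under eq_fun do rewrite bilinear_form0r//.
    by rewrite bilinear_form0r//; exact: is_derive_cst.
  under eq_fun do rewrite Br mulrC.
  rewrite Br mulrC; apply: is_deriveD; exact: is_deriveZ.
elim: uy => [t|F rho v {}u {}y crho dF _ IH t].
  under eq_fun do rewrite bilinear_form0l//.
  by rewrite !bilinear_form0l// addr0; exact: is_derive_cst.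
under eq_fun do rewrite Bl.
rewrite !Bl addrACA; apply: is_deriveD.
rewrite addrC; apply: (is_derive_eq (is_deriveM (dF t) (H v t))).
by rewrite /GRing.scale/= [B v _ * _]mulrC.
Qed.

End elementary.

Section elementary_integrals.
Context {R : realType} {X : lmodType R}.
Local Notation mu := (@lebesgue_measure R).

Lemma C1_pair_by_parts (B : X -> X -> R) u y z zeta (a b : R) :
  bilinear_form B -> C1_pair u y -> C1_pair z zeta -> a <= b ->
  \int[mu]_(t in `[a, b]) B (y t) (z t) +
    \int[mu]_(t in `[a, b]) B (u t) (zeta t) =
  B (u b) (z b) - B (u a) (z a).
Proof.
move=> bB uy zz ab.
have [[eu ey] [ez ezeta]] := (C1_pair_elementary uy, C1_pair_elementary zz).
have c1 := elementary_continuous bB ey ez.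
have c2 := elementary_continuous bB eu ezeta.
rewrite -RintegralD//; try exact: continuous_integrable_itv.
apply: (@FTC2 _ _ (fun t => B (u t) (z t))) => //; last exact: C1_pair_derive.
by move=> t; apply: cvgD; [exact: c1|exact: c2].
Qed.

Lemma C1_pair_energy (B : X -> X -> R) u y (a b : R) : bilinear_form B ->
  (forall x y, B x y = B y x) -> C1_pair u y -> a <= b ->
  2 * \int[mu]_(t in `[a, b]) B (y t) (u t) = B (u b) (u b) - B (u a) (u a).
Proof.
move=> bB BC uy ab; rewrite -(C1_pair_by_parts bB uy uy ab).
under [X in _ + X]eq_Rintegral do rewrite BC.
by ring.
Qed.

End elementary_integrals.

(** * Density in the space of square-integrable functions *)

Section L2_density.
Context {R : realType} {X : normedModType R} (ip : X -> X -> R).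
Hypothesis hX : real_hilbert ip.
Variables (d_ : nat -> X) (T : R).
Hypothesis d_dense : forall x e, 0 < e -> exists k, `|x - d_ k| < e.

Local Notation RT := (measurableTypeR R).
Local Notation mu := (@lebesgue_measure R).
Local Notation IT := (`[0%R, T]%classic : set RT).
Local Notation mfun f := (measurable_fun [set: RT] (f : RT -> R)).
Local Notation L2 := (L2 ip T).
Local Notation L2ip := (L2ip ip T).
Let siX : semi_inner setT ip := hX.
Let siL : semi_inner L2 L2ip := L2_semi_inner hX T d_dense.

Lemma ip_bilinear : bilinear_form ip.
Proof.
by split=> k x y z; [rewrite (ipDl hX) (ipZl hX)|rewrite (ipDr hX) (ipZr hX)].
Qed.

Lemma elementary_L2 y : elementary y -> L2 y.
Proof.
move=> ey; split=> [v|].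
  apply: continuous_measurable_fun.
  exact: (elementary_continuous ip_bilinear ey (elementary_cst v)).
have -> : (fun t => `|y t| ^+ 2) = fun t => ip (y t) (y t).
  by apply/funext => t; rewrite (ip_norm hX).
exact: continuous_integrable_itv (elementary_continuous ip_bilinear ey ey).
Qed.

(** By completeness the almost projections of [f] to [Y] have a limit [g], and f - g is orthogonal
    to [Y]; hence its square vanishes and the projections converge to [f] itself. *)
Lemma orthogonal_dense (Y : set (R -> X)) : Y `<=` L2 -> Y 0 ->
  (forall k y z, Y y -> Y z -> Y (k *: y + z)) ->
  (forall r, L2 r -> (forall y, Y y -> L2ip r y = 0) -> L2ip r r = 0) ->
  forall f, L2 f -> exists2 y_ : nat -> R -> X, (forall n, Y (y_ n)) &
    sqdist L2ip (y_ n) f @[n --> \oo] --> 0.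
Proof.
move=> YL Y0 YP Yorth f Lf.
have [y_ [Yy cy oy]] := si_almost_projection siL Lf YL Y0 YP.
have Ly n := YL _ (Yy n).
have [g [phi [Lg yg _ _]]] := L2_complete hX d_dense Ly cy.
have Lfg := siB_mem siL Lf Lg.
have Lfy n := siB_mem siL Lf (Ly n).
have fg0 : sqdist L2ip g f = 0.
  rewrite (sqdistC siL)//; apply: Yorth => // z Yz.
  have /cvg_lim <- // := oy z Yz; apply/esym/cvg_lim => //.
  apply: (si_cvgl siL) => //; first exact: YL.
  have -> : (fun n => sqdist L2ip (f - y_ n) (f - g)) =
      fun n => sqdist L2ip (y_ n) g.
    apply/funext => n; rewrite (sqdistC siL (Ly n))//.
    by rewrite /sqdist opprB addrC addrA subrK.
  exact: yg.
exists y_ => //.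
apply: (@squeeze_cvgr _ _ _ _ (cst 0) (fun n => 2 * sqdist L2ip (y_ n) g)).
- apply: nearW => n; rewrite (sqdist_ge0 siL)//=.
  by have := sqdist_triangle siL (Ly n) Lg Lf; rewrite fg0 mulr0 addr0.
- exact: cvg_cst.
- by rewrite -[X in _ --> X](mulr0 2); exact: cvgMr.
Qed.

Lemma L2_ae0 (r : R -> X) : L2 r ->
  {ae mu, forall t, t \in IT -> r t = 0} -> L2ip r r = 0.
Proof.
move=> Lr r0; rewrite (L2ip_sqr hX) /Rintegral.
rewrite (@ae_eq_integral _ _ _ mu IT (cst 0%E))//.
- by rewrite integral_cst ?mI// mul0e.
- by apply: (measurable_int mu); case: Lr.
- apply: filterS r0 => t r0 tI /=; rewrite r0 ?normr0 ?expr0n// inE.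
  exact: tI.
Qed.

Lemma Rintegral0_ae0 (f : R -> R) : (forall t, 0 <= f t) -> integrable_on T f ->
  \int[mu]_(t in IT) f t = 0 -> {ae mu, forall t, t \in IT -> f t = 0}.
Proof.
move=> f0 fi if0.
have /ae_eq_integral_abs : (\int[mu]_(t in IT) `|(f t)%:E| = 0)%E.
  transitivity (\int[mu]_(t in IT) (f t)%:E)%E.
    by apply: eq_integral => t _ /=; rewrite ger0_norm.
  rewrite -[LHS]fineK; first by rewrite -/(Rintegral _ _ _) if0.
  exact: (integrable_fin_num (mI T) fi).
move=> /(_ (mI T) (measurable_int mu fi)); apply: filterS => t ft0 tI.
by have [] := ft0 (set_mem tI).
Qed.

(** The function k = h / (1 + |h|) is bounded by 1, and k h is nonnegative and vanishes only where
    [h] does. It is approximated by continuous functions, against which [h] integrates to 0, so the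
    integral of k h is 0. *)
Lemma ae0_integral_mul (h : R -> R) : mfun h ->
  integrable_on T (fun t => h t ^+ 2) ->
  (forall rho : R -> R, continuous rho -> \int[mu]_(t in IT) (rho t * h t) = 0) ->
  {ae mu, forall t, t \in IT -> h t = 0}.
Proof.
move=> mh ih orth.
pose k t := h t / (1 + `|h t|).
have den t : 0 < 1 + `|h t| by rewrite ltr_pwDl.
have k1 t : `|k t| <= 1.
  rewrite normrM normfV (ger0_norm (ltW (den t))) ler_pdivrMr// mul1r.
  by rewrite lerDr.
have mk : mfun k.
  have ck : continuous (fun x : R => x / (1 + `|x|)).
    move=> x; apply: cvgM; first exact: cvg_id.
    apply: cvgV; first by rewrite gt_eqF// ltr_pwDl.
    by apply: cvgD; [exact: cvg_cst|exact: norm_continuous].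
  exact: (measurableT_comp (continuous_measurable_fun ck) mh).
have ik : integrable_on T k by exact: (integrable_on_bounded (M := 1)).
have [g_ [cg ig gk]] := approximation_continuous_integrable
  (mI T) (compact_finite_measure (@segment_compact R 0 T)) ik.
(* Clipping to [-1, 1] does not move [g_ n] away from [k], and bounds the error by 2. Its square is
   then at most twice the L^1 error, which is what approximation by continuous functions
   controls. *)
pose c_ n t := Num.max (- 1) (Num.min 1 (g_ n t)).
have cc n : continuous (c_ n).
  move=> t; apply: (@continuous_max R R (cst (- 1)) (cst 1 \min g_ n)).
    exact: cvg_cst.
  by apply: continuous_min; [exact: cvg_cst|exact: cg].
have ck n t : (k t - c_ n t) ^+ 2 <= 2 * `|k t - g_ n t|.
  have := k1 t; rewrite ler_norml => /andP[k1l k1r].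
  have H : `|k t - c_ n t| <= `|k t - g_ n t|.
    rewrite /c_ /Num.max /Num.min.
    case: ifPn => [A|/negP]; case: ifPn => [B|/negP]; rewrite ?ltr_norml;
      rewrite ler_norml; have := ler_norm (k t - g_ n t);
      have := ler_norm (g_ n t - k t); rewrite distrC; move: k1l k1r; lra.
  have H2 : `|k t - c_ n t| <= 2.
    rewrite (le_trans (ler_normB _ _))// -[leRHS]/(1 + 1) lerD//.
    rewrite ler_norml /c_ le_max lexx/= ge_max ge_min lexx/= andbT; lra.
  by rewrite -real_normK ?num_real// expr2 ler_pM.
have hk_ge0 t : 0 <= h t * k t.
  by rewrite /k mulrA -expr2 divr_ge0 ?sqr_ge0// ltW.
have bound (a : R) : `|a| <= 1 + a ^+ 2.
  have := sqr_ge0 (`|a| - 1); rewrite sqrrB real_normK ?num_real//.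
  have := normr_ge0 a; lra.
have ibd (f : R -> R) : mfun f -> (forall t, `|f t| <= 1) ->
    integrable_on T (fun t => f t * h t).
  move=> mf f1; apply: (integrable_on_le _ _ (integrable_onD
    (integrable_on_bounded (M := 1) (measurable_cst (1 : R)) _) ih)).
  - exact: measurable_funM.
  - move=> t _; rewrite normrM (le_trans _ (bound _))// ler_piMl//.
  - by move=> t _; rewrite normr1.
have mc n : mfun (c_ n) by exact: continuous_measurable_fun.
have c1 n t : `|c_ n t| <= 1.
  by rewrite ler_norml /c_ le_max lexx/= ge_max ge_min lexx/= andbT; lra.
have ikg n : integrable_on T (fun t => `|k t - g_ n t|).
  by apply: integrable_norm; exact: (integrableB (mI T) ik (ig n)).
pose J := \int[mu]_(t in IT) (k t * h t).
pose H2 := \int[mu]_(t in IT) (h t ^+ 2).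
(* Young's inequality for (k - c_n) h with weight [eta]: first [eta] is chosen to make the term in
   [H2] small, then [n]. *)
have J_le eta n : 0 < eta ->
    J <= eta * H2 + eta^-1 * \int[mu]_(t in IT) `|k t - g_ n t|.
  move=> eta0; have -> : J = \int[mu]_(t in IT) (k t * h t - c_ n t * h t).
    rewrite RintegralB//; [|exact: ibd|exact: ibd].
    by rewrite (orth (c_ n))// subr0.
  rewrite /H2 -!RintegralZl//; [|exact: ikg].
  rewrite -RintegralD//; [|exact: integrable_onZ|exact: integrable_onZ].
  apply: le_Rintegral.
  - exact: mI.
  - by apply: integrable_onB; exact: ibd.
  - by apply: integrable_onD; exact: integrable_onZ.
  - move=> t _; rewrite -mulrBl.
    have := ck n t; set a := k t - c_ n t; set b := `|_ - _| => ab.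
    rewrite -(ler_pM2l eta0) mulrDr mulVKf ?gt_eqF//.
    have := sqr_ge0 (eta * h t - a); rewrite sqrrB exprMn.
    have := sqr_ge0 (eta * h t); rewrite exprMn; lra.
have J0 : J = 0.
  apply/eqP; rewrite eq_le; apply/andP; split; last first.
    by apply: Rintegral_ge0 => t _; rewrite mulrC.
  have H20 : 0 <= H2 by apply: Rintegral_ge0 => t _; exact: sqr_ge0.
  apply/ler_addgt0Pr => e e0; rewrite add0r.
  pose eta := e / (2 * (H2 + 1)).
  have eta0 : 0 < eta by rewrite divr_gt0// mulr_gt0// ltr_pwDr.
  have /cvgrPdist_lt gk0 : fine \o (fun n => \int[mu]_(t in IT)
    `|(k t - g_ n t)%:E|)%E @ \oo --> (0 : R) by exact: fine_cvg gk.
  have [|n _ /(_ n (leqnn n))] := gk0 (eta * (e / 2)).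
    by rewrite mulr_gt0// divr_gt0.
  rewrite /= sub0r normrN => gn.
  apply: (le_trans (J_le eta n eta0)).
  have H1 : eta * H2 <= e / 2.
    have H21 : 0 < H2 + 1 by rewrite ltr_pwDr.
    rewrite /eta mulrAC ler_pdivrMr ?mulr_gt0//.
    by have -> : e / 2 * (2 * (H2 + 1)) = e * H2 + e; [field|rewrite lerDl ltW].
  have : eta^-1 * \int[mu]_(t in IT) `|k t - g_ n t| <= e / 2.
    rewrite mulrC ler_pdivrMr// [leRHS]mulrC (le_trans _ (ltW gn))//.
    exact: ler_norm.
  lra.
have : {ae mu, forall t, t \in IT -> k t * h t = 0}.
  by apply: Rintegral0_ae0 => // [t|]; [rewrite mulrC|exact: ibd].
apply: filterS => t hk0 tI; have /eqP := hk0 tI.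
rewrite mulf_eq0 => /orP[|/eqP//].
by rewrite mulf_eq0 invr_eq0 (gt_eqF (den t)) orbF => /eqP.
Qed.

(** An [r] orthogonal to all rho v has [ip (r t) (d_ k) = 0] for almost every t, simultaneously for
    all k since these are countably many; density of [d_] then gives r t = 0. *)
Lemma elementary_dense f : L2 f -> exists2 y_ : nat -> R -> X,
  (forall n, elementary (y_ n)) & sqdist L2ip (y_ n) f @[n --> \oo] --> 0.
Proof.
apply: orthogonal_dense; first exact: elementary_L2.
- exact: elementary0.
- by move=> k y z; exact: elementary_lin.
move=> r Lr orth; apply: L2_ae0 => //.
have r0 k : {ae mu, forall t, t \in IT -> ip (r t) (d_ k) = 0}.
  apply: ae0_integral_mul.
  - exact: Lr.1.
  - have := Lr.2 => ir.
    apply: (integrable_on_le _ _ (integrable_onZ (`|d_ k| ^+ 2) ir)).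
      by apply: measurable_funX; exact: Lr.1.
    move=> t _; rewrite ger0_norm ?sqr_ge0// -exprMn mulrC.
    rewrite -[leLHS]real_normK ?num_real// lerXn2r ?nnegrE ?mulr_ge0//.
    exact: ip_le.
  - move=> rho crho.
    rewrite -[RHS](orth (fun t => rho t *: d_ k)).
      by apply: eq_Rintegral => t _; rewrite (ipZr hX).
    by apply: elementary_scale => //; exact: elementary_cst.
apply: filterS (ae_foralln r0) => t rt tI.
apply/eqP; rewrite -normr_eq0 eq_le normr_ge0 andbT.
apply/ler_addgt0Pr => e e0; rewrite add0r.
have [->|n0] := eqVneq `|r t| 0; first exact: ltW.
have [k rk] := d_dense (r t) e0.
have : `|r t| ^+ 2 <= `|r t| * `|r t - d_ k|.
  rewrite -(ip_norm hX) (le_trans _ (ip_le hX _ _))//.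
  by rewrite (ipBr hX) rt// subr0 ler_norm.
by rewrite expr2 ler_pM2l ?lt_def ?n0 ?normr_ge0// => /le_trans; apply; exact: ltW.
Qed.

End L2_density.

Section operators.
Context {R : realType} {X : normedModType R} (ip : X -> X -> R).
Hypothesis hX : real_hilbert ip.

Lemma riesz_operator (B : X -> X -> R) M : bilinear_form B ->
  (forall x y, `|B x y| <= M * `|x| * `|y|) ->
  exists A : X -> X, forall x y, ip (A x) y = B x y.
Proof.
move=> [_ Br] BM.
have H x : exists a, forall y, ip a y = B x y.
  have [|z Bz] := riesz hX (f := B x) (M := M * `|x|) _ (BM x).
    by move=> k y z; exact: Br.
  by exists z => y; rewrite Bz.
by have [A AB] := choice H; exists A.
Qed.

Lemma riesz_operator_linear (B : X -> X -> R) (A : X -> X) : bilinear_form B ->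
  (forall x y, ip (A x) y = B x y) ->
  forall k x y, A (k *: x + y) = k *: A x + A y.
Proof.
move=> [Bl _] AB k x y; apply: (ip_inj hX) => z.
by rewrite AB Bl (ipDl hX) (ipZl hX) !AB.
Qed.

Lemma riesz_operator_le (B : X -> X -> R) (A : X -> X) M :
  (forall x y, ip (A x) y = B x y) ->
  (forall x y, `|B x y| <= M * `|x| * `|y|) -> forall x, `|A x| <= M * `|x|.
Proof.
move=> AB BM x; have [->|Ax0] := eqVneq `|A x| 0.
  have := le_trans (normr_ge0 _) (BM x x); have [->|x0] := eqVneq `|x| 0.
    by rewrite !mulr0.
  by rewrite pmulr_lge0// lt_def x0 normr_ge0.
have Ax_gt0 : 0 < `|A x| by rewrite lt_def Ax0 normr_ge0.
rewrite -(ler_pM2r Ax_gt0) -expr2 -(ip_norm hX) AB.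
exact: le_trans (ler_norm _) (BM _ _).
Qed.

Lemma elementary_map (A : X -> X) y :
  (forall k x z, A (k *: x + z) = k *: A x + A z) ->
  elementary y -> elementary (fun t : R => A (y t)).
Proof.
move=> lA; have A0 : A 0 = 0.
  have := lA 1 0 0; rewrite !scale1r addr0 => /eqP.
  by rewrite -subr_eq0 opprD addNKr oppr_eq0 => /eqP.
elim=> [|rho v {}y crho _ IH]; first by rewrite A0; exact: elementary0.
by under eq_fun do rewrite lA; exact: elementaryS.
Qed.

End operators.

(** * The abstract evolution equation *)

Section approximate_solutions.
Context {R : realType} {X : normedModType R} (ip : X -> X -> R).
Hypothesis hX : real_hilbert ip.
Variables (d_ : nat -> X) (T : R).
Hypothesis d_dense : forall x e, 0 < e -> exists k, `|x - d_ k| < e.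
Hypothesis T_ge0 : 0 <= T.

Local Notation RT := (measurableTypeR R).
Local Notation mu := (@lebesgue_measure R).
Local Notation IT := (`[0%R, T]%classic : set RT).
Local Notation mfun f := (measurable_fun [set: RT] (f : RT -> R)).
Local Notation L2 := (L2 ip T).
Local Notation L2ip := (L2ip ip T).
Let siX : semi_inner setT ip := hX.
Let siL : semi_inner L2 L2ip := L2_semi_inner hX T d_dense.
Let ipB : bilinear_form ip := ip_bilinear hX.
Let eL2 y : elementary y -> L2 y. Proof. exact: elementary_L2. Qed.

Lemma le_Rintegral_itv (f : R -> R) (a b : R) : continuous f ->
  (forall t, 0 <= f t) -> 0 <= a -> a <= b ->
  \int[mu]_(t in `[0, a]) f t <= \int[mu]_(t in `[0, b]) f t.
Proof.
move=> cf f0 a0 ab; apply: fine_le.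
- exact: integrable_fin_num (continuous_integrable_itv 0 a cf).
- exact: integrable_fin_num (continuous_integrable_itv 0 b cf).
- apply: ge0_subset_integral => //.
  + apply/measurable_EFinP; apply: measurable_funTS.
    exact: continuous_measurable_fun.
  + by move=> t _; rewrite lee_fin.
  + by apply: subset_itvl; rewrite bnd_simp.
Qed.

(** From |u(t)|^2 = 2 int_0^t (y, u), Young's inequality with weight 2 T bounds |u(t)|^2 by 2 T
    |y|^2 + |u|^2 / (2 T) in L^2 norms. Integrating over [0, T] leaves half of |u|^2 on the right,
    which is absorbed. *)
Lemma L2_le_primitive u y : C1_pair u y -> u 0 = 0 ->
  L2ip u u <= 4 * T ^+ 2 * L2ip y y.
Proof.
move=> uy u0; have [eu ey] := C1_pair_elementary uy.
have [T0|T0] := eqVneq T 0.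
  rewrite T0 expr0n mulr0 mul0r (L2ip_sqr hX) set_itv1.
  by rewrite /Rintegral integral_set1.
have T_gt0 : 0 < T by rewrite lt_def T0.
have [Lu Ly] := (eL2 eu, eL2 ey).
have cu := elementary_continuous ipB eu eu.
have cy := elementary_continuous ipB ey ey.
have cyu := elementary_continuous ipB ey eu.
have pt t : t \in IT -> ip (u t) (u t) <=
    2 * T * L2ip y y + (2 * T)^-1 * L2ip u u.
  rewrite inE/= in_itv/= => /andP[t0 tT].
  have := C1_pair_energy ipB (ipC hX) uy t0; rewrite u0 (ip0l hX) subr0 => <-.
  rewrite -[leLHS]RintegralZl//; last exact: continuous_integrable_itv.
  have cb : continuous (fun s => 2 * T * ip (y s) (y s) + (2 * T)^-1 * ip (u s) (u s)).
    by move=> s; apply: cvgD; apply: cvgMr; [exact: cy|exact: cu].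
  apply: (@le_trans _ _ (\int[mu]_(s in `[0, t])
      (2 * T * ip (y s) (y s) + (2 * T)^-1 * ip (u s) (u s)))).
    apply: le_Rintegral => //; try exact: continuous_integrable_itv.
      by apply: continuous_integrable_itv => s; apply: cvgMr; exact: cyu.
    move=> s _; have T2 : 0 < 2 * T by rewrite mulr_gt0.
    rewrite -(ler_pM2l T2) mulrDr mulVKf ?gt_eqF//.
    have := si_ge0 siX (x := 2 * T *: y s - u s) Logic.I.
    by rewrite -/(sqdist ip _ _) (sqdistE siX)// (si_sqrZ siX)// (siZl siX)//; lra.
  apply: (@le_trans _ _ (\int[mu]_(s in `[0, T])
      (2 * T * ip (y s) (y s) + (2 * T)^-1 * ip (u s) (u s)))).
    apply: le_Rintegral_itv => // s; rewrite addr_ge0// mulr_ge0 ?(si_ge0 siX)//.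
      by rewrite mulr_ge0.
    by rewrite invr_ge0 mulr_ge0.
  have [iy iu] := (L2_integrable hX d_dense Ly Ly, L2_integrable hX d_dense Lu Lu).
  rewrite RintegralD//; [|exact: integrable_onZ|exact: integrable_onZ].
  by rewrite !RintegralZl.
have : L2ip u u <= T * (2 * T * L2ip y y + (2 * T)^-1 * L2ip u u).
  set C := _ + _ in pt *.
  apply: (@le_trans _ _ (\int[mu]_(t in IT) C)).
    apply: le_Rintegral => //; first exact: (L2_integrable hX d_dense Lu Lu).
      exact: (@integrable_on_bounded _ _ _ `|C|).
    by move=> t tI; apply: pt; rewrite inE.
  rewrite Rintegral_cst ?mI// mulrC.
  have -> // : fine (mu IT) = T.
  by rewrite lebesgue_measure_itv/= lte_fin T_gt0/= subr0.
have -> : T * (2 * T * L2ip y y + (2 * T)^-1 * L2ip u u) =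
  2 * T ^+ 2 * L2ip y y + L2ip u u / 2 by field.
lra.
Qed.

(** * The pivot form, its Riesz operator, and the range of u |-> k u + G u' *)

Variables (g : X -> X -> R) (G : X -> X).
Hypothesis sig : semi_inner setT g.
Hypothesis g_le : forall x, g x x <= `|x| ^+ 2.
Hypothesis g_eq0 : forall x, g x x = 0 -> x = 0.
Hypothesis GE : forall x y, ip (G x) y = g x y.

Let gB : bilinear_form g.
Proof.
by split=> k x y z; [rewrite (siDl sig) ?(siZl sig)|rewrite (si_linear sig)].
Qed.

Let G_lin k x y : G (k *: x + y) = k *: G x + G y.
Proof. exact: (riesz_operator_linear hX gB GE). Qed.

Lemma form_norm_le x y : `|g x y| <= 1 * `|x| * `|y|.
Proof.
rewrite (le_trans (si_normr_le sig _ _))// mul1r.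
by rewrite ler_pM ?sqrtr_ge0// -[leRHS]normr_id -sqrtr_sqr ler_wsqrtr.
Qed.

Let G_le x : `|G x| <= `|x|.
Proof. by have := riesz_operator_le hX GE form_norm_le x; rewrite mul1r. Qed.

(** Weak measurability passes through [G] because [G] is symmetric for [ip]. *)
Lemma L2_G f : L2 f -> L2 (fun t => G (f t)).
Proof.
move=> Lf; apply: (L2_le hX d_dense Lf); last by exists 1 => t _; rewrite mul1r.
move=> v; have -> : (fun t => ip (G (f t)) v) = fun t => ip (f t) (G v).
  by apply/funext => t; rewrite GE (siC sig)// -GE (ipC hX).
exact: Lf.1.
Qed.

Lemma G_cvg (f_ : nat -> R -> X) f : (forall n, L2 (f_ n)) -> L2 f ->
  sqdist L2ip (f_ n) f @[n --> \oo] --> 0 ->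
  sqdist L2ip (fun t => G (f_ n t)) (fun t => G (f t)) @[n --> \oo] --> 0.
Proof.
move=> Lf_ Lf f_f.
apply: (@squeeze_cvgr _ _ _ _ (cst 0) (fun n => sqdist L2ip (f_ n) f)) => //.
  apply: nearW => n; rewrite (sqdist_ge0 siL)/=; try exact: L2_G.
  rewrite !(sqdist_L2 hX); apply: le_Rintegral => //.
  - exact: (siB_mem siL (L2_G (Lf_ n)) (L2_G Lf)).2.
  - exact: (siB_mem siL (Lf_ n) Lf).2.
  - move=> t _; rewrite lerXn2r ?nnegrE//.
    have -> : G (f_ n t) - G (f t) = G (f_ n t - f t).
      by rewrite addrC -scaleN1r -G_lin scaleN1r addrC.
    exact: G_le.
exact: cvg_cst.
Qed.

Let gC x y : g x y = g y x. Proof. exact: (siC sig). Qed.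

(** Monotonicity of the time derivative: for zero initial value the integral is half of g (u T) (u
    T). *)
Lemma L2ip_G_ge0 u y : C1_pair u y -> u 0 = 0 -> 0 <= L2ip (fun t => G (y t)) u.
Proof.
move=> uy u0; have := C1_pair_energy gB gC uy T_ge0.
rewrite u0 (bilinear_form0l _ gB) subr0 => gu.
have -> : L2ip (fun t => G (y t)) u = \int[mu]_(t in IT) g (y t) (u t).
  by apply: eq_Rintegral => t _; rewrite GE.
by rewrite -(pmulr_rge0 _ (ltr0n R 2)) gu (si_ge0 sig).
Qed.

Lemma elementary_GD k u y : elementary u -> elementary y ->
  elementary (fun t => k *: u t + G (y t)).
Proof. by move=> eu ey; apply: elementary_lin => //; exact: elementary_map. Qed.

(** The cross term is nonnegative by monotonicity. This is the lower bound for G u' + k u that the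
    perturbation from k to [A] is measured against. *)
Lemma L2ip_shift_ge k u y : 0 <= k -> C1_pair u y -> u 0 = 0 ->
  k ^+ 2 * L2ip u u <= L2ip (fun t => k *: u t + G (y t))
    (fun t => k *: u t + G (y t)).
Proof.
move=> k0 uy u0; have [eu ey] := C1_pair_elementary uy.
have Lu := eL2 eu; have LGy := eL2 (elementary_map G_lin ey).
rewrite -[X in _ <= L2ip X X]/((k \*: u) + (fun t => G (y t))).
rewrite (si_sqrD siL)//; last exact: (siZ_mem siL).
rewrite (si_sqrZ siL)// (siZl siL)// (siC siL)//.
rewrite -addrA lerDl addr_ge0 ?(si_ge0 siL)//.
by rewrite !mulr_ge0// L2ip_G_ge0.
Qed.

(* An [r] orthogonal to the range is tested against the primitive of
   [s_n t = \int_t^T r_n], where [r_n] is elementary and tends to [r]: this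
   forces [s_n] to tend to 0, hence [r] is orthogonal to all primitives. *)
Lemma shift_dense k f : 0 < k -> L2 f -> exists u_ y_ : nat -> R -> X,
  [/\ forall n, C1_pair (u_ n) (y_ n), forall n, u_ n 0 = 0 &
    sqdist L2ip (fun t => k *: u_ n t + G (y_ n t)) f @[n --> \oo] --> 0].
Proof.
move=> k0 Lf.
pose Y := [set f | exists u y, [/\ C1_pair u y, u 0 = 0 &
  f = fun t => k *: u t + G (y t)]].
suff [f_ Yf_ f_f] : exists2 f_ : nat -> R -> X, (forall n, Y (f_ n)) &
    sqdist L2ip (f_ n) f @[n --> \oo] --> 0.
  have [u_ /choice[y_ H]] := choice Yf_.
  exists u_, y_; split.
  - by move=> n; case: (H n).
  - by move=> n; case: (H n).
  - have -> // : (fun n => sqdist L2ip (fun t => k *: u_ n t + G (y_ n t)) f) =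
      fun n => sqdist L2ip (f_ n) f.
    by apply/funext => n; case: (H n) => _ _ <-.
apply: (orthogonal_dense hX d_dense) => //.
- move=> _ [u [y [uy _ ->]]]; have [eu ey] := C1_pair_elementary uy.
  exact/eL2/elementary_GD.
- exists (fun=> 0), (fun=> 0); split => //; first exact: C1_pair0.
  apply/funext => t; rewrite scaler0 add0r.
  by apply/esym/eqP; rewrite -normr_le0 (le_trans (G_le 0))// normr0.
- move=> a _ _ [u [y [uy u0 ->]]] [u' [y' [uy' u0' ->]]].
  exists (fun t => a *: u t + u' t), (fun t => a *: y t + y' t); split.
  + exact: C1_pair_lin.
  + by rewrite u0 u0' scaler0 addr0.
  + apply/funext => t; rewrite !fctE G_lin !scalerDr !scalerA (mulrC a).
    by rewrite addrACA.
move=> r Lr orth.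
have [r_ er_ r_r] := elementary_dense hX d_dense Lr.
(* If p is a primitive of [r_ n], then s = p(T) - p has derivative -r_n and vanishes at T; z is its
   primitive. The shape [(-1) *: r_ n t + 0] is the one produced by [C1_pair_lin]. *)
have H n : exists z s, [/\ C1_pair z s, z 0 = 0 &
    C1_pair s (fun t => (-1) *: r_ n t + 0) /\ s T = 0].
  have [p pr p0] := elementary_primitive (er_ n).
  have sr := C1_pair_lin (-1) pr (C1_pair_cst (p T)).
  have [z zs z0] := elementary_primitive (C1_pair_elementary sr).1.
  exists z, (fun t => (-1) *: p t + p T); split => //; split => //.
  by rewrite scaleN1r addNr.
have [z_ /choice[s_ {}H]] := choice H.
have es n : elementary (s_ n) by case: (H n) => /C1_pair_elementary[].
have ez n : elementary (z_ n) by case: (H n) => /C1_pair_elementary[].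
have Lr_ n := eL2 (er_ n); have Ls n := eL2 (es n); have Lz n := eL2 (ez n).
(* Integration by parts; the boundary terms vanish because s(T) = 0 and u(0) = 0. *)
have parts n u y : C1_pair u y -> u 0 = 0 -> L2ip (r_ n) u = L2ip (s_ n) y.
  move=> uy u0; have [_ _ [sr sT]] := H n.
  have := C1_pair_by_parts ipB sr uy T_ge0.
  rewrite u0 sT (ip0l hX) (ip0r hX) subrr => /eqP; rewrite addrC addr_eq0 => /eqP.
  have [eu ey] := C1_pair_elementary uy.
  rewrite -/(L2ip (s_ n) y) => ->.
  rewrite -[LHS]opprK -[X in - X = _]mulN1r -RintegralZl//; last first.
    exact: (L2_integrable hX d_dense (Lr_ n) (eL2 eu)).
  congr (- _); apply: eq_Rintegral => t _.
  by rewrite addr0 (ipZl hX).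
(* As r_n = -s_n' and s_n(T) = 0, this is half of g (s_n 0) (s_n 0). *)
have rGs n : 0 <= L2ip (r_ n) (fun t => G (s_ n t)).
  have [_ _ [sr sT]] := H n.
  have := C1_pair_energy gB gC sr T_ge0.
  rewrite sT (bilinear_form0l _ gB) sub0r => gs.
  have -> : L2ip (r_ n) (fun t => G (s_ n t)) =
      - \int[mu]_(t in IT) g ((-1) *: r_ n t + 0) (s_ n t).
    rewrite -[LHS]opprK -[X in - X = _]mulN1r -RintegralZl//; last first.
      exact: (L2_integrable hX d_dense (Lr_ n) (L2_G (Ls n))).
    congr (- _); apply: eq_Rintegral => t _.
    by rewrite addr0 (siZl sig)// (ipC hX) GE gC.
  by rewrite -(pmulr_rge0 _ (ltr0n R 2)) mulrN gs opprK (si_ge0 sig).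
(* Chosen so that |k z + G s|^2 <= C |s|^2 in L^2: the first summand comes from [L2_le_primitive]
   for z, the second from [G_le]. *)
pose C := 2 * (k ^+ 2 * (4 * T ^+ 2)) + 2.
have C0 : 0 < C by have := mulr_ge0 (sqr_ge0 k) (sqr_ge0 T); rewrite /C; lra.
have s_le n : k ^+ 2 * L2ip (s_ n) (s_ n) <= C * sqdist L2ip (r_ n) r.
  have [zs z0 [sr sT]] := H n.
  pose w t := k *: z_ n t + G (s_ n t).
  have ew : elementary w by exact: elementary_GD.
  have LGs := eL2 (elementary_map G_lin (es n)).
  have wE : w = (k \*: z_ n) + (fun t => G (s_ n t)) by [].
  have Lkz := siZ_mem siL k (Lz n).
  have S0 := si_ge0 siL (Ls n).
  have ww : L2ip w w <= C * L2ip (s_ n) (s_ n).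
    rewrite wE (le_trans (si_sqrD_le siL Lkz LGs))// (si_sqrZ siL)//.
    rewrite /C [leRHS]mulrDl lerD//.
      set q := L2ip (s_ n) (s_ n).
      have -> : 2 * (k ^+ 2 * (4 * T ^+ 2)) * q = 2 * (k ^+ 2 * (4 * T ^+ 2 * q)).
        by ring.
      rewrite ler_wpM2l// ler_wpM2l ?sqr_ge0//.
      exact: (L2_le_primitive zs z0).
    rewrite ler_wpM2l// !(L2ip_sqr hX) le_Rintegral//.
    - exact: LGs.2.
    - exact: (Ls n).2.
    - by move=> t _; rewrite lerXn2r ?nnegrE.
  (* [w] is in the range, so [r] may be subtracted freely; what remains is k (r_n, z) + (r_n, G s),
     whose first term is k |s|^2 by parts and whose second is nonnegative. *)
  have rw : k * L2ip (s_ n) (s_ n) <= L2ip (r_ n - r) w.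
    rewrite (siBl siL)//; last exact: eL2.
    rewrite (orth w) ?subr0; last by exists (z_ n), (s_ n).
    by rewrite wE (siDr siL)// (siZr siL)// (parts n _ _ zs z0) lerDl.
  have Lrr := siB_mem siL (Lr_ n) Lr.
  have := si_cauchy_schwarz siL Lrr (eL2 ew).
  have : (k * L2ip (s_ n) (s_ n)) ^+ 2 <= L2ip (r_ n - r) w ^+ 2.
    by rewrite ler_pXn2r// nnegrE ?(le_trans _ rw) ?mulr_ge0 ?(ltW k0).
  move=> H1 H2; have {H1 H2} := le_trans H1 H2.
  rewrite -/(sqdist L2ip (r_ n) r) => H1.
  have D0 : 0 <= sqdist L2ip (r_ n) r by exact: (sqdist_ge0 siL).
  have {H1} := le_trans H1 (ler_wpM2l D0 ww).
  rewrite exprMn.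
  have [->|Sn0] := eqVneq (L2ip (s_ n) (s_ n)) 0.
    by rewrite !mulr0 => _; rewrite mulr_ge0// ltW.
  rewrite expr2 mulrA mulrA ler_pM2r ?lt_def ?Sn0//.
  by rewrite (mulrC C).
have s_cvg : L2ip (s_ n) (s_ n) @[n --> \oo] --> 0.
  apply: (@squeeze_cvgr _ _ _ _ (cst 0)
    (fun n => (k ^+ 2)^-1 * C * sqdist L2ip (r_ n) r)).
  - apply: nearW => n; rewrite (si_ge0 siL)//= -mulrA mulrC.
    by rewrite ler_pdivlMr ?exprn_gt0// mulrC.
  - exact: cvg_cst.
  - by rewrite -[X in _ --> X](mulr0 ((k ^+ 2)^-1 * C)); exact: cvgMr.
have ru u y : C1_pair u y -> u 0 = 0 -> L2ip r u = 0.
  move=> uy u0; have [eu ey] := C1_pair_elementary uy.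
  have /cvg_lim <- // := si_cvgl siL Lr_ Lr (eL2 eu) r_r.
  apply/cvg_lim => //; under eq_fun do rewrite (parts _ _ _ uy u0).
  have q0y : L2ip 0 y = 0.
    by rewrite (siC siL (si0 siL) (eL2 ey)) (si0r siL (eL2 ey)).
  rewrite -q0y; apply: (si_cvgl siL Ls (si0 siL) (eL2 ey)).
  by under eq_fun do rewrite /sqdist subr0.
(* Every elementary [y] is the derivative of some [u] with u(0) = 0, to which [r] is orthogonal by
   [ru]; only the [G] part of the range element remains. *)
have rG y : elementary y -> L2ip r (fun t => G (y t)) = 0.
  move=> ey; have [u uy u0] := elementary_primitive ey.
  have Lu := eL2 (C1_pair_elementary uy).1.
  have LGy := eL2 (elementary_map G_lin ey).
  have : L2ip r (fun t => k *: u t + G (y t)) = 0 by apply: orth; exists u, y.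
  rewrite -[X in L2ip _ X = 0]/((k \*: u) + (fun t => G (y t))).
  rewrite (siDr siL)//; last exact: (siZ_mem siL).
  by rewrite (siZr siL)// (ru _ _ uy u0) mulr0 add0r.
have Grr : L2ip (fun t => G (r t)) r = 0.
  have LGr_ n := L2_G (Lr_ n).
  have /cvg_lim <- // := si_cvgl siL LGr_ (L2_G Lr) Lr (G_cvg Lr_ Lr r_r).
  apply/cvg_lim => //.
  have -> : (fun n => L2ip (fun t => G (r_ n t)) r) = fun=> 0.
    by apply/funext => n; rewrite (siC siL)// rG.
  exact: cvg_cst.
apply: (L2_ae0 hX) => //.
have : {ae mu, forall t, t \in IT -> ip (G (r t)) (r t) = 0}.
  apply: Rintegral0_ae0 => //.
  - by move=> t; rewrite GE (si_ge0 sig).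
  - exact: (L2_integrable hX d_dense (L2_G Lr) Lr).
by apply: filterS => t Gr0 tI; apply: g_eq0; rewrite -GE Gr0.
Qed.

(** * The range of u |-> G u' + A u for a coercive time-dependent form *)

Variables (F : R -> X -> X -> R) (C c : R) (A : R -> X -> X).
Hypothesis F_bilinear : forall t, bilinear_form (F t).
Hypothesis F_le : forall t x y, `|F t x y| <= C * `|x| * `|y|.
Hypothesis F_coercive : forall t x, c * `|x| ^+ 2 <= F t x x.
Hypothesis F_measurable : forall x y, mfun (fun t => F t x y).
Hypothesis C_gt0 : 0 < C.
Hypothesis c_gt0 : 0 < c.
Hypothesis c_le_C : c <= C.
Hypothesis AE : forall t x y, ip (A t x) y = F t x y.

(** [A t] depends on t, so measurability goes through the transposed operator: [Av t] represents x
    |-> F t x v and is weakly measurable by the measurability of the form, and products of weakly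
    measurable functions are measurable. *)
Lemma L2_A f : L2 f -> L2 (fun t => A t (f t)).
Proof.
move=> Lf; apply: (L2_le hX d_dense Lf); last first.
  by exists C => t _; exact: (riesz_operator_le hX (AE t) (F_le t)).
move=> v.
have /choice[Av AvE] : forall t, exists a, forall x, ip a x = F t x v.
  move=> t; have [||a aE] := riesz hX (f := F t ^~ v) (M := C * `|v|).
  - by move=> k x y; rewrite (F_bilinear t).1.
  - by move=> x; rewrite mulrAC; exact: F_le.
  - by exists a => x; rewrite aE.
have -> : (fun t => ip (A t (f t)) v) = fun t => ip (f t) (Av t).
  by apply/funext => t; rewrite AE -AvE (ipC hX).
apply: (ip_measurable hX d_dense); first exact: Lf.1.
by move=> x; under eq_fun do rewrite AvE; exact: F_measurable.
Qed.

Let A_lin t k x y : A t (k *: x + y) = k *: A t x + A t y.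
Proof. exact: (riesz_operator_linear hX (F_bilinear t) (AE t)). Qed.

(* With [k = C ^ 2 / c] the operator [k - A] has norm less than [k], so a
   function orthogonal to the range of [u |-> G u' + A u] is short of being
   approximated by [G u' + k u], contradicting [shift_dense]. *)
Lemma evolution_dense f : L2 f -> exists u_ y_ : nat -> R -> X,
  [/\ forall n, C1_pair (u_ n) (y_ n), forall n, u_ n 0 = 0 &
    sqdist L2ip (fun t => A t (u_ n t) + G (y_ n t)) f @[n --> \oo] --> 0].
Proof.
move=> Lf.
pose Y := [set f | exists u y, [/\ C1_pair u y, u 0 = 0 &
  f = fun t => A t (u t) + G (y t)]].
have LAG u y : C1_pair u y -> L2 (fun t => A t (u t) + G (y t)).
  move=> /C1_pair_elementary[eu ey].
  exact: (siD_mem siL (L2_A (eL2 eu)) (eL2 (elementary_map G_lin ey))).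
suff [f_ Yf_ f_f] : exists2 f_ : nat -> R -> X, (forall n, Y (f_ n)) &
    sqdist L2ip (f_ n) f @[n --> \oo] --> 0.
  have [u_ /choice[y_ H]] := choice Yf_.
  exists u_, y_; split.
  - by move=> n; case: (H n).
  - by move=> n; case: (H n).
  - have -> // : (fun n => sqdist L2ip (fun t => A t (u_ n t) + G (y_ n t)) f) =
      fun n => sqdist L2ip (f_ n) f.
    by apply/funext => n; case: (H n) => _ _ <-.
have A0 t : A t 0 = 0.
  apply/eqP; rewrite -normr_le0.
  by rewrite (le_trans (riesz_operator_le hX (AE t) (F_le t) 0))// normr0 mulr0.
apply: (orthogonal_dense hX d_dense) => //.
- by move=> _ [u [y [uy _ ->]]]; exact: LAG.
- exists (fun=> 0), (fun=> 0); split => //; first exact: C1_pair0.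
  apply/funext => t; rewrite A0 add0r.
  by apply/esym/eqP; rewrite -normr_le0 (le_trans (G_le 0))// normr0.
- move=> a _ _ [u [y [uy u0 ->]]] [u' [y' [uy' u0' ->]]].
  exists (fun t => a *: u t + u' t), (fun t => a *: y t + y' t); split.
  + exact: C1_pair_lin.
  + by rewrite u0 u0' scaler0 addr0.
  + apply/funext => t; rewrite !fctE G_lin A_lin !scalerDr.
    by rewrite addrACA.
move=> r Lr orth; pose k := C ^+ 2 / c.
have k0 : 0 < k by rewrite divr_gt0// exprn_gt0.
have [u_ [y_ [uy u0 w_r]]] := shift_dense k0 Lr.
pose w_ n t := k *: u_ n t + G (y_ n t).
have ew n : elementary (w_ n).
  by have [] := C1_pair_elementary (uy n); exact: elementary_GD.
(* Since [r] is orthogonal to A u + G y, its product with w = k u + G y equals that with k u - A u,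
   where |k u - A u|^2 <= (k^2 - C^2) |u|^2 <= th |w|^2. As w tends to [r] and th < 1, this forces r
   = 0. *)
pose th := (k ^+ 2 - C ^+ 2) / k ^+ 2.
have bound n : L2ip (w_ n) r ^+ 2 <= L2ip r r * (th * L2ip (w_ n) (w_ n)).
  have [eu ey] := C1_pair_elementary (uy n).
  have Lu := eL2 eu; have LGy := eL2 (elementary_map G_lin ey).
  pose e := (k \*: u_ n) - (fun t => A t (u_ n t)).
  have Lku := siZ_mem siL k Lu; have LAu := L2_A Lu.
  have Le : L2 e by exact: (siB_mem siL).
  have -> : L2ip (w_ n) r = L2ip r e.
    have AG0 : L2ip r ((fun t => A t (u_ n t)) + (fun t => G (y_ n t))) = 0.
      by apply: orth; exists (u_ n), (y_ n).
    have Lw := eL2 (ew n); rewrite (siC siL Lw Lr).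
    have -> : w_ n = e + ((fun t => A t (u_ n t)) + (fun t => G (y_ n t))).
      by rewrite addrA subrK.
    by rewrite (siDr siL) ?AG0 ?addr0//; exact: (siD_mem siL).
  apply: (le_trans (si_cauchy_schwarz siL Lr Le)).
  rewrite ler_wpM2l ?(si_ge0 siL)//.
  apply: (@le_trans _ _ ((k ^+ 2 - C ^+ 2) * L2ip (u_ n) (u_ n))).
    rewrite !(L2ip_sqr hX) -RintegralZl//; last exact: Lu.2.
    apply: le_Rintegral => //; first exact: Le.2.
      exact: (integrable_onZ (k ^+ 2 - C ^+ 2) Lu.2).
    move=> t _; rewrite -(ip_norm hX) /e !fctE -/(sqdist ip _ _).
    rewrite (sqdistE siX)// (si_sqrZ siX)// (siZl siX)// (ipC hX) AE !(ip_norm hX).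
    have Fc := F_coercive t (u_ n t).
    have : `|A t (u_ n t)| ^+ 2 <= C ^+ 2 * `|u_ n t| ^+ 2.
      rewrite -exprMn lerXn2r ?nnegrE ?mulr_ge0// ?(ltW C_gt0)//.
      exact: (riesz_operator_le hX (AE t) (F_le t)).
    have : k * (c * `|u_ n t| ^+ 2) <= k * F t (u_ n t) (u_ n t).
      by rewrite ler_wpM2l// ltW.
    have -> : k * (c * `|u_ n t| ^+ 2) = C ^+ 2 * `|u_ n t| ^+ 2.
      by rewrite mulrA divfK// gt_eqF.
    lra.
  (* [c <= C] gives C <= k, so the factor k^2 - C^2 is nonnegative. *)
  rewrite /th -mulrA ler_wpM2l//.
    rewrite subr_ge0 lerXn2r ?nnegrE ?(ltW C_gt0) ?(ltW k0)//.
    by rewrite /k expr2 -mulrA ler_peMr ?(ltW C_gt0)// ler_pdivlMr// mul1r.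
  rewrite mulrC ler_pdivlMr ?exprn_gt0// mulrC.
  exact: (L2ip_shift_ge (ltW k0)).
have cw : L2ip (w_ n) r @[n --> \oo] --> L2ip r r.
  by apply: (si_cvgl siL) => // n; exact: eL2.
have cww : L2ip (w_ n) (w_ n) @[n --> \oo] --> L2ip r r.
  by apply: (si_cvg siL) => // n; exact: eL2.
have cw2 : L2ip (w_ n) r ^+ 2 @[n --> \oo] --> L2ip r r ^+ 2.
  have -> : (fun n => L2ip (w_ n) r ^+ 2) = fun n => L2ip (w_ n) r * L2ip (w_ n) r.
    by apply/funext => n; rewrite expr2.
  by rewrite expr2; exact: cvgM.
have cth : L2ip r r * (th * L2ip (w_ n) (w_ n)) @[n --> \oo] -->
    L2ip r r * (th * L2ip r r) by do 2 apply: cvgMr.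
have : L2ip r r ^+ 2 <= L2ip r r * (th * L2ip r r).
  by apply: (ler_cvg_to cw2 cth); exact: nearW.
have : th * k ^+ 2 = k ^+ 2 - C ^+ 2 by rewrite divfK// gt_eqF// exprn_gt0.
have C2 : 0 < C ^+ 2 by rewrite exprn_gt0.
have k2 : 0 < k ^+ 2 by rewrite exprn_gt0.
move=> thk; rewrite expr2 mulrCA.
have [->//|q0] := eqVneq (L2ip r r) 0.
have q_gt0 : 0 < L2ip r r by rewrite lt_def q0 (si_ge0 siL).
rewrite -{1}[L2ip r r * L2ip r r]mul1r ler_pM2r ?mulr_gt0// => th1.
have : 1 * k ^+ 2 <= th * k ^+ 2 by rewrite ler_pM2r.
rewrite thk; lra.
Qed.

End approximate_solutions.

Section C1_pair_scale.
Context {R : realType} {X : lmodType R}.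

(** Serves both for the exponential weight and for test functions times fixed vectors. *)
Lemma C1_pair_scale (phi psi : R -> R) (u y : R -> X) : continuous psi ->
  (forall t, is_derive t (1 : R) phi (psi t)) -> C1_pair u y ->
  C1_pair (fun t => phi t *: u t) (fun t => psi t *: u t + phi t *: y t).
Proof.
move=> cpsi dphi; have cphi := is_derive_continuous dphi.
elim=> [|F rho v {}u {}y crho dF uy IH].
  rewrite (_ : (fun t => _) = fun=> 0); last first.
    by apply/funext => t; rewrite scaler0.
  rewrite (_ : (fun t => psi t *: 0 + _) = fun=> 0); first exact: C1_pair0.
  by apply/funext => t; rewrite !scaler0 addr0.
rewrite (_ : (fun t => _) = fun t => (phi t * F t) *: v + phi t *: u t); last first.
  by apply/funext => t; rewrite scalerDr scalerA.
rewrite (_ : (fun t => psi t *: (_ + _) + _) =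
    fun t => (phi t * rho t + F t * psi t) *: v + (psi t *: u t + phi t *: y t)).
  have cF := is_derive_continuous dF; apply: C1_pairS => // t.
  by apply: cvgD; apply: cvgM; [exact: cphi|exact: crho|exact: cF|exact: cpsi].
apply/funext => t; rewrite !scalerDr scalerDl !scalerA (mulrC (F t)).
by rewrite [LHS]addrACA [X in X + _ = _]addrC.
Qed.

End C1_pair_scale.

(** * Solutions for coercive forms and for forms satisfying a Garding inequality *)

Section evolution_solution.
Context {R : realType} {X : normedModType R} (ip : X -> X -> R).
Hypothesis hX : real_hilbert ip.
Variables (d_ : nat -> X) (T : R).
Hypothesis d_dense : forall x e, 0 < e -> exists k, `|x - d_ k| < e.
Hypothesis T_ge0 : 0 <= T.

Local Notation RT := (measurableTypeR R).
Local Notation mu := (@lebesgue_measure R).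
Local Notation IT := (`[0%R, T]%classic : set RT).
Local Notation mfun f := (measurable_fun [set: RT] (f : RT -> R)).
Local Notation L2 := (L2 ip T).
Local Notation L2ip := (L2ip ip T).
Let siX : semi_inner setT ip := hX.
Let siL : semi_inner L2 L2ip := L2_semi_inner hX T d_dense.
Let ipB : bilinear_form ip := ip_bilinear hX.
Let eL2 y : elementary y -> L2 y. Proof. exact: elementary_L2. Qed.

Variables (g : X -> X -> R) (G : X -> X).
Hypothesis sig : semi_inner setT g.
Hypothesis g_le : forall x, g x x <= `|x| ^+ 2.
Hypothesis g_eq0 : forall x, g x x = 0 -> x = 0.
Hypothesis GE : forall x y, ip (G x) y = g x y.

Let gB : bilinear_form g.
Proof.
by split=> k x y z; [rewrite (siDl sig) ?(siZl sig)|rewrite (si_linear sig)].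
Qed.

Let gC x y : g x y = g y x. Proof. exact: (siC sig). Qed.

Let G_lin k x y : G (k *: x + y) = k *: G x + G y.
Proof. exact: (riesz_operator_linear hX gB GE). Qed.

Section coercive.
Variables (F : R -> X -> X -> R) (C c : R) (A : R -> X -> X).
Hypothesis F_bilinear : forall t, bilinear_form (F t).
Hypothesis F_le : forall t x y, `|F t x y| <= C * `|x| * `|y|.
Hypothesis F_coercive : forall t x, c * `|x| ^+ 2 <= F t x x.
Hypothesis F_measurable : forall x y, mfun (fun t => F t x y).
Hypothesis C_gt0 : 0 < C.
Hypothesis c_gt0 : 0 < c.
Hypothesis c_le_C : c <= C.
Hypothesis AE : forall t x y, ip (A t x) y = F t x y.

Let A_lin t k x y : A t (k *: x + y) = k *: A t x + A t y.
Proof. exact: (riesz_operator_linear hX (F_bilinear t) (AE t)). Qed.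

Let A_L2 f : L2 f -> L2 (fun t => A t (f t)).
Proof. by move=> Lf; apply: (L2_A hX d_dense F_bilinear F_le). Qed.

(** The energy identity gives g (u t) (u t) = 2 int_0^t ((w, u) - F(u, u)). Young's inequality 2 (w,
    u) <= |w|^2 / c + c |u|^2 uses up half of the coercivity 2 c |u|^2; the other half is kept on
    the left. *)
Lemma energy_estimate u y t : let w t := A t (u t) + G (y t) in
  C1_pair u y -> u 0 = 0 -> t \in IT ->
  g (u t) (u t) + c * \int[mu]_(s in `[0, t]) `|u s| ^+ 2 <= c^-1 * L2ip w w.
Proof.
move=> w uy u0 tI.
have /andP[t0 tT] : 0 <= t <= T by move: tI; rewrite inE/= in_itv.
have [eu ey] := C1_pair_elementary uy.
have Lw : L2 w.
  exact: (siD_mem siL (A_L2 (eL2 eu)) (eL2 (elementary_map G_lin ey))).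
have sub : `[0, t]%classic `<=` IT by apply: subset_itvl; rewrite bnd_simp.
have iw : mu.-integrable `[0, t] (EFin \o (fun s => `|w s| ^+ 2)).
  by apply: integrableS Lw.2.
have iu : mu.-integrable `[0, t] (EFin \o (fun s => `|u s| ^+ 2)).
  by apply: integrableS (eL2 eu).2.
have igyu := continuous_integrable_itv 0 t (elementary_continuous gB ey eu).
have : c^-1 * \int[mu]_(s in `[0, t]) `|w s| ^+ 2 <= c^-1 * L2ip w w.
  rewrite ler_wpM2l ?invr_ge0 ?(ltW c_gt0)// (L2ip_sqr hX); apply: fine_le.
  - exact: integrable_fin_num iw.
  - exact: integrable_fin_num Lw.2.
  - apply: ge0_subset_integral => //.
    by apply: measurable_int; exact: Lw.2.
move=> le_w; apply: le_trans le_w.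
have := C1_pair_energy gB gC uy t0.
rewrite u0 (bilinear_form0l _ gB) subr0 => <-.
rewrite -!RintegralZl// -RintegralD//; last 2 first.
- exact: (integrableZl _ 2 igyu).
- exact: (integrableZl _ c iu).
apply: le_Rintegral => //.
- apply: (integrableD _ (integrableZl _ 2 igyu) (integrableZl _ c iu)) => //.
- exact: (integrableZl _ _ iw).
- move=> s _; have : g (y s) (u s) = ip (w s) (u s) - F s (u s) (u s).
    by rewrite /w (ipDl hX) AE GE addrAC subrr add0r.
  have := F_coercive s (u s).
  have := si_ge0 siX (x := w s - c *: u s) Logic.I.
  rewrite -/(sqdist ip _ _) (sqdistE siX)// (si_sqrZ siX)// (siZr siX)//.
  rewrite !(ip_norm hX) => H1 H2 ->.
  rewrite -(ler_pM2l c_gt0) mulVKf ?gt_eqF//.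
  have := ler_wpM2l (ltW c_gt0) H2; lra.
Qed.

(** The energy estimate for u_m - u_n, taken at t = T, controls the L^2 distance, and taken at all t
    it controls the pivot distance uniformly. The approximants are returned because the weak
    derivative and the continuous representative are both read off from them. *)
Lemma coercive_evolution f : L2 f -> exists u (u_ y_ : nat -> R -> X) phi,
  [/\ forall n, C1_pair (u_ n) (y_ n), forall n, u_ n 0 = 0,
      (forall n, (n <= phi n)%N),
      {ae mu, forall t, t \in IT -> `|u_ (phi n) t - u t| @[n --> \oo] --> 0}
    & [/\ L2 u, sqdist L2ip (u_ n) u @[n --> \oo] --> 0,
      sqdist L2ip (fun t => A t (u_ n t) + G (y_ n t)) f @[n --> \oo] --> 0
    & forall e, 0 < e -> exists n0, forall m n, (n0 <= m)%N -> (n0 <= n)%N ->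
        forall t, t \in IT -> sqdist g (u_ m t) (u_ n t) < e]].
Proof.
move=> Lf; have [u_ [y_ [uy u0 w_f]]] := evolution_dense hX d_dense T_ge0 sig g_le
  g_eq0 GE F_bilinear F_le F_coercive F_measurable C_gt0 c_gt0 c_le_C AE Lf.
pose w_ n t := A t (u_ n t) + G (y_ n t).
have Lu n : L2 (u_ n) by apply: eL2; case: (C1_pair_elementary (uy n)).
have Lw n : L2 (w_ n).
  have [eu ey] := C1_pair_elementary (uy n).
  exact: (siD_mem siL (A_L2 (eL2 eu)) (eL2 (elementary_map G_lin ey))).
have est m n t : t \in IT -> sqdist g (u_ m t) (u_ n t) +
    c * \int[mu]_(s in `[0, t]) `|u_ m s - u_ n s| ^+ 2 <=
    c^-1 * sqdist L2ip (w_ m) (w_ n).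
  move=> tI.
  have := energy_estimate (C1_pair_lin (-1) (uy n) (uy m)) _ tI.
  rewrite u0 u0 scaler0 addr0 => /(_ erefl).
  have uE s : -1 *: u_ n s + u_ m s = u_ m s - u_ n s by rewrite scaleN1r addrC.
  have wE : (fun t => A t (-1 *: u_ n t + u_ m t) + G (-1 *: y_ n t + y_ m t)) =
      w_ m - w_ n.
    apply/funext => s; rewrite A_lin G_lin addrACA -scalerDr scaleN1r addrC.
    by [].
  rewrite wE uE /sqdist; under eq_Rintegral do rewrite uE; exact.
have cw : cauchy_for (sqdist L2ip) w_ by exact: (cvg_sqdist_cauchy siL Lw Lf w_f).
have TI : T \in IT by rewrite inE/= in_itv/= lexx T_ge0.
have cu : cauchy_for (sqdist L2ip) u_.
  move=> e e0; have [|n0 H] := cw (c ^+ 2 * e); first by rewrite mulr_gt0 ?exprn_gt0.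
  exists n0 => m n mn nn; have {H} := H m n mn nn.
  have := est m n T TI; rewrite -(sqdist_L2 hX).
  have := sqdist_ge0 sig (x := u_ m T) (y := u_ n T) Logic.I Logic.I => g0 H1 H2.
  have {g0}H1 : c * sqdist L2ip (u_ m) (u_ n) <= c^-1 * sqdist L2ip (w_ m) (w_ n).
    by apply: le_trans H1; rewrite lerDr.
  rewrite -(ltr_pM2l (exprn_gt0 2 c_gt0)) (le_lt_trans _ H2)//.
  by rewrite expr2 -mulrA -ler_pdivlMl// mulrC (mulrC _ c^-1).
have [u [phi [Lu' u_u phi_ge aeu]]] := L2_complete hX d_dense Lu cu.
exists u, u_, y_, phi; split => //; split => // e e0.
have [|n0 H] := cw (c * e); first by rewrite mulr_gt0.
exists n0 => m n mn nn t tI; have {H} := H m n mn nn.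
have H1 := est m n t tI.
rewrite -ltr_pdivrMl//; apply: le_lt_trans; apply: le_trans H1.
rewrite lerDl mulr_ge0 ?(ltW c_gt0)//.
by apply: Rintegral_ge0 => s _; exact: sqr_ge0.
Qed.

End coercive.

Lemma L2_scale_le (phi : R -> R) M f : mfun phi ->
  (forall t, t \in IT -> `|phi t| <= M) -> L2 f ->
  L2 (fun t => phi t *: f t) /\
  L2ip (fun t => phi t *: f t) (fun t => phi t *: f t) <= M ^+ 2 * L2ip f f.
Proof.
move=> mphi phiM Lf.
have le t : t \in IT -> `|phi t *: f t| <= M * `|f t|.
  by move=> tI; rewrite normrZ ler_wpM2r// phiM.
have Lphi : L2 (fun t => phi t *: f t).
  apply: (L2_le hX d_dense Lf); last by exists M.
  by apply: (weakly_measurable_scale hX) => //; exact: Lf.1.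
split => //; rewrite !(L2ip_sqr hX) -RintegralZl//; last exact: Lf.2.
apply: le_Rintegral => //; first exact: Lphi.2.
  exact: (integrable_onZ _ Lf.2).
by move=> t tI; rewrite -exprMn lerXn2r ?nnegrE ?(le_trans _ (le t _)) ?inE.
Qed.

(** With u = u0 + e^(lam t) v, the equation becomes G v' + (A + lam G) v = e^(-lam t) (f - A u0)
    with v(0) = 0, and the shifted form is coercive. *)
Lemma evolution_exists (F : R -> X -> X -> R) (C c lam : R) (A : R -> X -> X) f u0 :
  (forall t, bilinear_form (F t)) ->
  (forall t x y, `|F t x y| <= C * `|x| * `|y|) ->
  (forall t x, c * `|x| ^+ 2 - lam * g x x <= F t x x) ->
  (forall x y, mfun (fun t => F t x y)) -> 0 <= C -> 0 < c ->
  (forall t x y, ip (A t x) y = F t x y) -> L2 f ->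
  exists u (u_ y_ : nat -> R -> X) phi,
  [/\ forall n, C1_pair (u_ n) (y_ n), forall n, u_ n 0 = u0,
      (forall n, (n <= phi n)%N),
      {ae mu, forall t, t \in IT -> `|u_ (phi n) t - u t| @[n --> \oo] --> 0}
    & [/\ L2 u, sqdist L2ip (u_ n) u @[n --> \oo] --> 0,
      sqdist L2ip (fun t => G (y_ n t)) (fun t => f t - A t (u t))
        @[n --> \oo] --> 0
    & forall e, 0 < e -> exists n0, forall m n, (n0 <= m)%N -> (n0 <= n)%N ->
        forall t, t \in IT -> sqdist g (u_ m t) (u_ n t) < e]].
Proof.
move=> F_bilinear F_le F_garding F_measurable C0 c0 AE Lf.
have A_L2 w : L2 w -> L2 (fun t => A t (w t)).
  by move=> Lw; apply: (L2_A hX d_dense F_bilinear F_le).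
have A_lin t k x y : A t (k *: x + y) = k *: A t x + A t y.
  exact: (riesz_operator_linear hX (F_bilinear t) (AE t)).
pose F' t x y := F t x y + lam * g x y.
pose A' t x := A t x + lam *: G x.
(* C + |lam| bounds the shifted form; the summand [c] makes the bound positive and at least the
   coercivity constant. *)
pose C' := C + `|lam| + c.
have F'_bilinear t : bilinear_form (F' t).
  by split=> k x y z; rewrite /F' (F_bilinear t).1 || rewrite /F' (F_bilinear t).2;
    rewrite gB.1 || rewrite gB.2; ring.
have F'_le t x y : `|F' t x y| <= C' * `|x| * `|y|.
  rewrite /F' /C' !mulrDl (le_trans (ler_normD _ _))//.
  rewrite -[leLHS]addr0 lerD ?mulr_ge0 ?(ltW c0)// lerD// normrM -mulrA.
  by rewrite ler_wpM2l// (le_trans (form_norm_le sig g_le _ _))// mul1r.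
have F'_coercive t x : c * `|x| ^+ 2 <= F' t x x.
  by rewrite /F' -lerBlDr.
have F'_measurable x y : mfun (fun t => F' t x y).
  by apply: measurable_funD.
have A'E t x y : ip (A' t x) y = F' t x y.
  by rewrite /A' (ipDl hX) (ipZl hX) AE GE.
have C'_gt0 : 0 < C' by rewrite ltr_wpDl// addr_ge0.
have c_le_C' : c <= C' by rewrite lerDr addr_ge0.
pose E (k : R) t := expR (k * t).
have cE k : continuous (E k).
  move=> t; apply: continuous_comp; first exact: mulrl_continuous.
  exact: continuous_expR.
have mE k : mfun (E k) by exact: continuous_measurable_fun.
have E_gt0 k t : 0 < E k t by exact: expR_gt0.
have E_le k t : t \in IT -> `|E k t| <= expR (`|k| * T).
  rewrite inE/= in_itv/= => /andP[t0 tT].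
  rewrite ger0_norm ?(ltW (E_gt0 k t))// /E ler_expR (le_trans (ler_wpM2r t0 (ler_norm k)))//.
  by rewrite ler_wpM2l.
pose f0 t := f t - A t u0.
have Lf0 : L2 f0.
  by apply: (siB_mem siL Lf); apply: A_L2; apply: eL2; exact: elementary_cst.
have Lf' := (L2_scale_le (mE (- lam)) (E_le (- lam)) Lf0).1.
have [v [v_ [z_ [phi [vz v0 phi_ge aev [Lv v_v res cau]]]]]] :=
  coercive_evolution F'_bilinear F'_le F'_coercive F'_measurable C'_gt0 c0 c_le_C'
    A'E Lf'.
pose M := expR (`|lam| * T).
pose u_ n t := 1 *: u0 + E lam t *: v_ n t.
pose y_ n t := 1 *: 0 + ((lam * E lam t) *: v_ n t + E lam t *: z_ n t).
pose u t := 1 *: u0 + E lam t *: v t.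
have uy n : C1_pair (u_ n) (y_ n).
  apply: C1_pair_lin; first exact: C1_pair_cst.
  apply: (@C1_pair_scale _ _ (E lam) (fun t => lam * E lam t)) => // t.
    by apply: cvgMr; exact: cE.
  rewrite mulrC; apply: is_derive1_comp.
  by rewrite -[X in is_derive _ _ _ X]mulr1; exact: is_deriveZ.
have eu n := (C1_pair_elementary (uy n)).1.
have ey n := (C1_pair_elementary (uy n)).2.
have Lv_ n : L2 (v_ n) by apply: eL2; case: (C1_pair_elementary (vz n)).
have Lu_ n := eL2 (eu n).
have LEv := (L2_scale_le (mE lam) (E_le lam) Lv).1.
have Lu : L2 u.
  apply: (siD_mem siL) LEv; apply: eL2; exact: elementary_cst.
have uB n t : u_ n t - u t = E lam t *: (v_ n t - v t).
  by rewrite /u_ /u opprD addrACA subrr add0r -scalerBr.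
have u_u : sqdist L2ip (u_ n) u @[n --> \oo] --> 0.
  apply: (@squeeze_cvgr _ _ _ _ (cst 0) (fun n => M ^+ 2 * sqdist L2ip (v_ n) v)).
  - apply: nearW => n; rewrite (sqdist_ge0 siL)//=.
    have -> : sqdist L2ip (u_ n) u =
        L2ip (fun t => E lam t *: (v_ n t - v t)) (fun t => E lam t *: (v_ n t - v t)).
      by rewrite /sqdist; congr L2ip; apply/funext => t; exact: uB.
    exact: (L2_scale_le (mE lam) (E_le lam) (siB_mem siL (Lv_ n) Lv)).2.
  - exact: cvg_cst.
  - by rewrite -[X in _ --> X](mulr0 (M ^+ 2)); exact: cvgMr.
exists u, u_, y_, phi; split => //.
- by move=> n; rewrite /u_ v0 scaler0 addr0 scale1r.
- apply: filterS aev => t vt tI.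
  have -> : (fun n => `|u_ (phi n) t - u t|) =
      fun n => `|E lam t| * `|v_ (phi n) t - v t|.
    by apply/funext => n; rewrite uB normrZ.
  by rewrite -[X in _ --> X](mulr0 `|E lam t|); apply: cvgMr; exact: vt.
split => //.
  pose w_ n t := A' t (v_ n t) + G (z_ n t).
  pose f' t := E (- lam) t *: f0 t.
  have LAu := A_L2 _ Lu.
  have LGy n := eL2 (elementary_map G_lin (ey n)).
  have Lw n : L2 (w_ n).
    have [ev ez] := C1_pair_elementary (vz n).
    apply: (siD_mem siL); last exact: (eL2 (elementary_map G_lin ez)).
    exact: (L2_A hX d_dense F'_bilinear F'_le F'_measurable A'E (eL2 ev)).
  (* The term lam G v in w_n cancels against the derivative of the weight in y_n, so the residual
     splits into the weighted residual of the coercive problem and an error in u_n. *)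
  have key n t : G (y_ n t) - (f t - A t (u t)) =
      E lam t *: (w_ n t - f' t) - (A t (u_ n t) - A t (u t)).
    have EE : E lam t * E (- lam) t = 1.
      by rewrite -expRD mulNr subrr expR0.
    apply: (ip_inj hX) => a; rewrite /w_ /f' /f0 /A' /y_ /u_.
    rewrite !(ipDl hX, ipNl hX, ipZl hX, AE, GE) scaler0 add0r.
    rewrite !gB.1 !(F_bilinear t).1 !(bilinear_formZl _ _ _ gB).
    rewrite !(bilinear_formZl _ _ _ (F_bilinear t)).
    by rewrite [_ * (_ - E (- lam) t * _)]mulrBr [E lam t * (_ * (_ - _))]mulrA EE; ring.
  apply: (@squeeze_cvgr _ _ _ _ (cst 0) (fun n =>
    2 * (M ^+ 2 * sqdist L2ip (w_ n) f') + 2 * (C ^+ 2 * sqdist L2ip (u_ n) u))).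
  - apply: nearW => n; have LfAu : L2 (fun t => f t - A t (u t)) by exact: (siB_mem siL).
    rewrite (sqdist_ge0 siL)//=.
    have Lwf := siB_mem siL (Lw n) Lf'.
    have LAuB := siB_mem siL (A_L2 _ (Lu_ n)) LAu.
    have [LE leE] := L2_scale_le (mE lam) (E_le lam) Lwf.
    have -> : sqdist L2ip (fun t => G (y_ n t)) (fun t => f t - A t (u t)) =
        sqdist L2ip (fun t => E lam t *: (w_ n t - f' t))
          ((fun t => A t (u_ n t)) - (fun t => A t (u t))).
      by rewrite /sqdist; congr L2ip; apply/funext => t; rewrite !fctE key.
    rewrite /sqdist (le_trans (si_sqrD_le siL LE (siN_mem siL LAuB)))//.
    rewrite (si_sqrN siL)// lerD// ler_wpM2l//.
    rewrite !(L2ip_sqr hX) -RintegralZl//; last exact: (siB_mem siL (Lu_ n) Lu).2.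
    apply: le_Rintegral => //; first exact: LAuB.2.
      exact: (integrable_onZ _ (siB_mem siL (Lu_ n) Lu).2).
    move=> t _; rewrite !fctE.
    have -> : A t (u_ n t) - A t (u t) = A t (u_ n t - u t).
      by rewrite addrC -scaleN1r -A_lin scaleN1r addrC.
    rewrite -exprMn lerXn2r ?nnegrE ?mulr_ge0//.
    exact: (riesz_operator_le hX (AE t) (F_le t)).
  - exact: cvg_cst.
  - have -> : (0 : R) = 2 * (M ^+ 2 * 0) + 2 * (C ^+ 2 * 0).
      by rewrite !mulr0 addr0.
    by apply: cvgD; do 2 apply: cvgMr.
move=> e e0; have [|n0 H] := cau (e / M ^+ 2).
  by rewrite divr_gt0// exprn_gt0// expR_gt0.
exists n0 => m n mn nn t tI; have := H m n mn nn t tI.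
have -> : sqdist g (u_ m t) (u_ n t) = E lam t ^+ 2 * sqdist g (v_ m t) (v_ n t).
  by rewrite /sqdist /u_ opprD addrACA subrr add0r -scalerBr (si_sqrZ sig).
rewrite ltr_pdivlMr ?exprn_gt0 ?expR_gt0// => /le_lt_trans; apply.
rewrite mulrC ler_wpM2l ?(sqdist_ge0 sig)//.
have := E_le lam t tI; rewrite ger0_norm ?(ltW (E_gt0 lam t))// => Et.
by rewrite lerXn2r ?nnegrE ?(ltW (E_gt0 lam t))// expR_ge0.
Qed.

End evolution_solution.

(** * Bochner integrals *)

Section nonmeasurable_integrals.
Context d (S : measurableType d) (R : realType) (mu : {measure set S -> \bar R}).
Import HBNNSimple.
Local Open Scope ereal_scope.

(* No measurability is needed, since the integral of a nonnegative function is
   a supremum over the simple functions below it. *)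
Lemma ae_le_ge0_integral (D : set S) (f g : S -> \bar R) :
  (forall x, D x -> 0 <= f x) -> (forall x, D x -> 0 <= g x) ->
  {ae mu, forall x, D x -> f x <= g x} ->
  \int[mu]_(x in D) f x <= \int[mu]_(x in D) g x.
Proof.
move=> f0 g0 [N [mN N0 fgN]]; rewrite !ge0_integralE//.
apply: ge_ereal_sup => _ [h hf <-].
pose h' := mul_nnsfun h (indic_nnsfun R (measurableC mN)).
have -> : sintegral mu h = sintegral mu h'.
  rewrite -!integralT_nnsfun; apply: ae_eq_integral => //.
  - exact/measurable_EFinP.
  - exact/measurable_EFinP.
  exists N; split => // x /= hh'; apply: contrapT => Nx; apply: hh' => _.
  by rewrite /h'/= mindicE mem_set ?mulr1.
apply: ereal_sup_ubound; exists h' => //= x.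
rewrite mindicE; have [xN|xN] := boolP (x \in ~` N); last first.
  by rewrite mulr0 erestrict_ge0.
rewrite mulr1 (le_trans (hf x))// /patch; case: ifPn => // xD.
have {}xN : ~ N x by apply: set_mem xN.
apply: contrapT => fg; apply: xN; apply: fgN => /= /(_ (set_mem xD)).
exact: fg.
Qed.

End nonmeasurable_integrals.

Section simple_functions.
Context {R : realType} {X : normedModType R} (T : R).
Local Notation RT := (measurableTypeR R).
Local Notation mu := (@lebesgue_measure R).
Local Notation IT := (`[0%R, T]%classic : set RT).
Local Notation mfun f := (measurable_fun [set: RT] (f : RT -> R)).

Lemma simple_measurable (s : R -> X) (f : X -> R) : simple s ->
  mfun (fun t => f (s t)).
Proof.
move=> [fs ms] _ B mB; rewrite setTI.
have -> : (fun t => f (s t)) @^-1` B =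
    \bigcup_(x in range s `&` f @^-1` B) s @^-1` [set x].
  apply/seteqP; split => [t Bt|t [x [_ Bx] /= stx]]; last by rewrite /= stx.
  by exists (s t) => //; split => //; exists t.
apply: fin_bigcup_measurable => //.
by apply: sub_finite_set fs; exact: subIsetl.
Qed.

Lemma simple_comp (Y : normedModType R) (J : X -> Y) (s : R -> X) : injective J ->
  simple s -> simple (J \o s).
Proof.
move=> injJ [fs ms]; split.
  have -> : range (J \o s) = J @` range s.
    by rewrite image_comp.
  exact: finite_image.
move=> y; have [[x _ <-]|ny] := pselect (range J y).
  rewrite (_ : _ @^-1` _ = s @^-1` [set x])//.
  by apply/seteqP; split => t /=; [exact: injJ|move=> ->].
rewrite (_ : _ @^-1` _ = set0)//; apply/seteqP; split => // t /= st.
by apply: ny; exists (s t).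
Qed.

(** Applied to evaluation at a vector, it turns simple integrals in the dual into scalar
    integrals. *)
Lemma simple_integral_linear (s : R -> X) (f : X -> R) : simple s ->
  (forall k x y, f (k *: x + y) = k * f x + f y) ->
  f (simple_integral T s) = \int[mu]_(t in IT) f (s t).
Proof.
move=> [fs ms] lf.
have f0 : f 0 = 0.
  have := lf 1 0 0; rewrite scale1r addr0 mul1r => /eqP.
  by rewrite -subr_eq0 opprD addNKr oppr_eq0 => /eqP.
pose A x := s @^-1` [set x].
have muA x : (mu (IT `&` A x) < +oo)%E.
  apply: le_lt_trans (compact_finite_measure (@segment_compact R 0 T)).
  apply: le_measure; rewrite ?inE; [|exact: mI|exact: subIsetl].
  exact: measurableI (mI T) (ms x).
have i1 x : integrable_on T (\1_(A x)).
  apply: (integrable_on_bounded (M := 1)); first by apply: measurable_indic; exact: ms.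
  by move=> t _; rewrite indicE; case: (_ \in _); rewrite ?normr1 ?normr0.
have iA x := integrable_onZ (f x) (i1 x).
have fsE t : f (s t) = \sum_(x <- fset_set (range s)) f x * \1_(A x) t.
  rewrite (big_rem (s t))/=; last by rewrite in_fset_set// inE; exists t.
  rewrite indicE mem_set// mulr1 big_seq big1 ?addr0// => x.
  rewrite mem_rem_uniq ?fset_uniq// inE => /andP[xst _].
  rewrite indicE memNset ?mulr0// => /= stx.
  by rewrite stx eqxx in xst.
rewrite /simple_integral fsbig_finite//=.
transitivity (\sum_(x <- fset_set (range s)) f x * fine (mu (IT `&` A x))).
  elim: (fset_set (range s) : seq X) => [|x r IH]; first by rewrite !big_nil.
  by rewrite !big_cons lf IH mulrC.
rewrite /Rintegral; under eq_integral do rewrite fsE -sumEFin.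
rewrite integral_sum//.
have fin x : (\int[mu]_(t in IT) (f x * \1_(A x) t)%:E)%E \is a fin_num.
  exact: integrable_fin_num (iA x).
rewrite -(@sum_fine _ _ _ xpredT) => [|x _]; last exact: fin.
apply: eq_bigr => x _; rewrite -/(Rintegral _ _ _) RintegralZl//; last exact: i1.
congr (_ * fine _); rewrite integral_indic; [by rewrite setIC|exact: mI|exact: ms].
Qed.

End simple_functions.

(** * The Riesz isometry onto the dual *)

Section riesz_dual.
Context {R : realType} {X : normedModType R} (ip : X -> X -> R).
Hypothesis hX : real_hilbert ip.

Lemma dual_linear (f : dual X) k x y : f (k *: x + y) = k * f x + f y.
Proof. by have /asboolP[lf _] := dual_funP f; rewrite lf. Qed.

Lemma dual_norm_bound (f : dual X) x : `|f x| <= `|f| * `|x|.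
Proof. exact: dual_normP. Qed.

Lemma ip_bounded_functional x : (ip x : X -> R^o) \in @bounded_functionals R X.
Proof.
apply: asboolT; split; first by move=> k u v; rewrite (ipDr hX) (ipZr hX).
by exists `|x| => y; exact: ip_le.
Qed.

Definition riesz_dual x : dual X := Dual (ip_bounded_functional x).

Lemma riesz_dualB x y : riesz_dual x - riesz_dual y = riesz_dual (x - y).
Proof. by apply/val_inj/funext => v; rewrite /= (ipBl hX). Qed.

Lemma riesz_dualZ k x : k *: riesz_dual x = riesz_dual (k *: x).
Proof. by apply/val_inj/funext => v; rewrite /= (ipZl hX). Qed.

Lemma riesz_dual_norm x : `|riesz_dual x| = `|x|.
Proof.
apply/eqP; rewrite eq_le; apply/andP; split.
  by apply: dual_norm_le => // y; exact: ip_le.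
have [->|x0] := eqVneq x 0; first by rewrite normr0.
have := dual_norm_bound (riesz_dual x) x.
by rewrite /= (ip_norm hX) ger0_norm ?sqr_ge0// expr2 ler_pM2r// normr_gt0.
Qed.

Lemma riesz_dual_inj : injective riesz_dual.
Proof.
move=> x y xy; apply/eqP; rewrite -subr_eq0 -normr_eq0 -riesz_dual_norm.
by rewrite -riesz_dualB xy subrr normr0.
Qed.

Lemma riesz_dual_surj (f : dual X) : exists x, f = riesz_dual x.
Proof.
have [x fx] := riesz hX (dual_linear f) (dual_norm_bound f).
by exists x; apply/val_inj/funext => y; exact: fx.
Qed.

End riesz_dual.

Section bochner_hilbert.
Context {R : realType} {X : normedModType R} (ip : X -> X -> R).
Hypothesis hX : real_hilbert ip.
Variables (d_ : nat -> X) (T : R).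
Hypothesis d_dense : forall x e, 0 < e -> exists k, `|x - d_ k| < e.

Local Notation RT := (measurableTypeR R).
Local Notation mu := (@lebesgue_measure R).
Local Notation IT := (`[0%R, T]%classic : set RT).
Local Notation mfun f := (measurable_fun [set: RT] (f : RT -> R)).
Local Notation L2 := (L2 ip T).
Local Notation L2ip := (L2ip ip T).
Let siX : semi_inner setT ip := hX.
Local Notation riesz_dual := (riesz_dual hX).

Lemma simple_weakly_measurable s : simple s -> weakly_measurable ip s.
Proof. by move=> ss v; exact: (simple_measurable (ip ^~ v)). Qed.

Lemma weakly_measurableB f g : weakly_measurable ip f -> weakly_measurable ip g ->
  weakly_measurable ip (fun t => f t - g t).
Proof.
move=> mf mg; have -> : (fun t => f t - g t) = fun t => (-1) *: g t + f t.
  by apply/funext => t; rewrite scaleN1r addrC.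
exact: (weakly_measurable_lin hX).
Qed.

(* [s_ n t] is a nearest point to [f t] among 0 and the first n points of the
   dense sequence. *)
Lemma simple_approximation f : weakly_measurable ip f -> exists s_ : nat -> R -> X,
  [/\ forall n, simple (s_ n),
      forall t, `|f t - s_ n t| @[n --> \oo] --> 0
    & forall n t, `|f t - s_ n t| <= `|f t|].
Proof.
(* Starting from 0 keeps the error below |f t|, the dominating function for convergence in L^1. *)
move=> mf; pose s_ := fix s_ n t := if n is n'.+1 then
  if `|f t - d_ n'| < `|f t - s_ n' t| then d_ n' else s_ n' t else 0.
have s_le n t : `|f t - s_ n.+1 t| <= `|f t - s_ n t|.
  by rewrite /=; case: ifPn => // /ltW.
have s_le_d n t : `|f t - s_ n.+1 t| <= `|f t - d_ n|.
  by rewrite /=; case: ifPn => // /negP; rewrite ltNge => /negP; rewrite negbK.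
have s_mono t n m : (n <= m)%N -> `|f t - s_ m t| <= `|f t - s_ n t|.
  move=> /subnKC <-; elim: (m - n)%N => [|k IH]; first by rewrite addn0.
  by rewrite addnS (le_trans (s_le _ _)).
have ss n : simple (s_ n).
  elim: n => [|n [fs ms]].
    split; first by apply: sub_finite_set (finite_set1 0) => _ [t _ <-].
    move=> x; have [->|x0] := eqVneq x 0.
      by rewrite (_ : _ @^-1` _ = setT)//; apply/seteqP; split.
    rewrite (_ : _ @^-1` _ = set0)//; apply/seteqP; split => // t /= tx.
    by rewrite -tx eqxx in x0.
  pose P := [set t | `|f t - d_ n| < `|f t - s_ n t|].
  have mP : measurable (P : set RT).
    have mh : mfun (fun t => `|f t - s_ n t| - `|f t - d_ n|).
      apply: measurable_funB; apply: (norm_measurable hX d_dense);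
        by apply: weakly_measurableB => //; exact: simple_weakly_measurable.
    have := mh measurableT `]0, +oo[%classic (measurable_itv _).
    rewrite setTI preimage_itvoy; congr measurable.
    by apply/seteqP; split => t /=; rewrite /P/= subr_gt0.
  split.
    apply: (sub_finite_set _ (_ : finite_set (range (s_ n) `|` [set d_ n]))).
      move=> _ [t _ <-] /=; case: ifPn => _; first by right.
      by left; exists t.
    by rewrite finite_setU; split => //; exact: finite_set1.
  move=> x; rewrite (_ : _ @^-1` _ = (P `&` [set t | d_ n = x]) `|`
      (~` P `&` s_ n @^-1` [set x])).
    apply: measurableU; apply: measurableI => //.
    - have [dx|dx] := pselect (d_ n = x).
        by rewrite (_ : [set _ | _] = setT)//; apply/seteqP; split.
      by rewrite (_ : [set _ | _] = set0)//; apply/seteqP; split.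
    - exact: measurableC.
  apply/seteqP; split => t /=; rewrite /P/=.
    by case: ifPn => [Pt ->|/negP Pt ->]; [left|right].
  by case=> -[Pt <-]; [rewrite Pt|rewrite (negbTE (introN idP Pt))].
exists s_; split => //.
- move=> t; apply/cvgrPdist_lt => e e0; have [k fk] := d_dense (f t) e0.
  exists k.+1 => // n /= kn; rewrite sub0r normrN normr_id.
  by rewrite (le_lt_trans (s_mono _ _ _ kn))// (le_lt_trans (s_le_d _ _)).
- by move=> n t; rewrite (le_trans (s_mono t 0%N n _))//= subr0.
Qed.

Lemma L2_norm_integrable f : L2 f -> integrable_on T (fun t => `|f t|).
Proof.
move=> [mf fi]; have i1 : integrable_on T (fun=> 1).
  apply: (integrable_on_bounded (M := 1)); first exact: measurable_cst.
  by move=> t _; rewrite normr1.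
apply: (integrable_on_le _ _ (integrable_onD i1 fi)).
  exact: (norm_measurable hX d_dense).
move=> t _; rewrite normr_id; have := sqr_ge0 (`|f t| - 1); rewrite sqrrB.
have := normr_ge0 (f t); lra.
Qed.

Lemma simple_approximation_L1 f : L2 f -> exists s_ : nat -> R -> X,
  [/\ forall n, simple (s_ n),
      forall t, `|f t - s_ n t| @[n --> \oo] --> 0,
      (forall n, integrable_on T (fun t => `|f t - s_ n t|))
    & (\int[mu]_(t in IT) `|f t - s_ n t|%:E)%E @[n --> \oo] --> 0%E].
Proof.
move=> Lf; have [s_ [ss s_f s_le]] := simple_approximation Lf.1.
have ms n : weakly_measurable ip (s_ n) by exact: simple_weakly_measurable.
have mn n : mfun (fun t => `|f t - s_ n t|).
  by apply: (norm_measurable hX d_dense); apply: weakly_measurableB => //; exact: Lf.1.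
have fi := L2_norm_integrable Lf.
exists s_; split => //.
  move=> n; apply: (integrable_on_le (mn n) _ fi) => t _.
  by rewrite normr_id.
have [|||||_ _] := @dominated_convergence _ _ _ mu IT (mI T)
  (fun n t => `|f t - s_ n t|%:E) (cst 0%E) (fun t => `|f t|%:E).
- by move=> n; apply/measurable_EFinP; apply: measurable_funTS.
- exact: measurable_cst.
- by apply: aeW => t _; apply: cvg_EFin (s_f t); exact: nearW.
- exact: fi.
- by apply: aeW => t n _ /=; rewrite normr_id lee_fin.
by rewrite integral0.
Qed.

(** The integral is obtained weakly, by Riesz, from the scalar integrals; it is the candidate to
    which the simple integrals are then shown to converge. *)
Lemma pettis_integral f : L2 f ->
  exists x, forall v, ip x v = \int[mu]_(t in IT) ip (f t) v.
Proof.
move=> Lf; have Lc v : L2 (fun=> v).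
  by apply: elementary_L2 => //; exact: elementary_cst.
have iv v := L2_integrable hX d_dense Lf (Lc v).
have [||x xE] := riesz hX (f := fun v => \int[mu]_(t in IT) ip (f t) v)
    (M := \int[mu]_(t in IT) `|f t|).
- move=> k x y; rewrite -(RintegralZl k (mI T) (iv x)).
  rewrite -(RintegralD (mI T) (integrable_onZ k (iv x)) (iv y)).
  by apply: eq_Rintegral => t _; rewrite (ipDr hX) (ipZr hX).
- move=> x; have fi := L2_norm_integrable Lf.
  apply: (le_trans (le_normr_Rintegral (mI T) (iv x))).
  rewrite -(RintegralZr _ (mI T) fi).
  apply: le_Rintegral => //; first exact: (integrable_norm (iv x)).
    exact: (integrableZr (mI T) _ fi).
  by move=> t _; exact: ip_le.
- by exists x => v; rewrite xE.
Qed.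

(** Tested on a vector v, the error of the n-th simple integral is at most |v| times the L^1
    distance of f and s_n. Since [F] is prescribed only almost everywhere, its norms are compared by
    [ae_le_ge0_integral]. *)
Lemma bochner_integral_riesz f (F : R -> dual X) x : L2 f ->
  {ae mu, forall t, t \in IT -> F t = riesz_dual (f t)} ->
  (forall v, ip x v = \int[mu]_(t in IT) ip (f t) v) ->
  bochner_integral T F (riesz_dual x).
Proof.
move=> Lf Ff xE; have [s_ [ss s_f si s_L1]] := simple_approximation_L1 Lf.
exists (fun n => riesz_dual \o s_ n).
have sJ n : simple (riesz_dual \o s_ n) by apply: simple_comp => //; exact: riesz_dual_inj.
split.
- split => //; apply: filterS Ff => t FE tI; rewrite FE ?inE//.
  apply/cvgrPdist_lt => e e0.
  have /cvgrPdist_lt/(_ _ e0)[n0 _ H] := s_f t.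
  exists n0 => // n /H/=; rewrite sub0r normrN normr_id riesz_dualB.
  by rewrite riesz_dual_norm.
- apply: (@squeeze_cvge nat \oo _ R (cst 0%E) _ (fun n =>
    (\int[mu]_(t in IT) `|f t - s_ n t|%:E)%E) _ 0%E _ s_L1); last exact: cvg_cst.
  apply: nearW => n; rewrite integral_ge0//=.
  apply: ae_le_ge0_integral => //.
  apply: filterS Ff => t FE tI; rewrite FE ?inE// riesz_dualB.
  by rewrite riesz_dual_norm.
- apply/cvgrPdist_lt => e e0.
  have /fine_cvg/cvgrPdist_lt/(_ _ e0)[n0 _ H] := s_L1.
  exists n0 => // n /H/=; rewrite sub0r normrN; apply: le_lt_trans.
  apply: dual_norm_le => // v.
  have Lc : L2 (fun=> v) by apply: elementary_L2 => //; exact: elementary_cst.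
  have mfs : weakly_measurable ip (fun t => f t - s_ n t).
    by apply: weakly_measurableB; [exact: Lf.1|exact: simple_weakly_measurable].
  have ifs : integrable_on T (fun t => ip (f t - s_ n t) v).
    apply: (integrable_on_le (mfs v) _ (integrable_onZ `|v| (si n))) => t _.
    by rewrite mulrC; exact: ip_le.
  have iv := L2_integrable hX d_dense Lf Lc.
  have -> : (riesz_dual x - simple_integral T (riesz_dual \o s_ n)) v =
      \int[mu]_(t in IT) ip (f t - s_ n t) v.
    rewrite -[LHS]/(ip x v - simple_integral T (riesz_dual \o s_ n) v).
    rewrite (@simple_integral_linear _ _ T _ (fun a : dual X => a v))// xE.
    rewrite -RintegralB//; first by apply: eq_Rintegral => t _; rewrite (ipBl hX).
    have : integrable_on T (fun t => ip (f t) v - ip (f t - s_ n t) v).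
      exact: integrable_onB.
    by apply: eq_integrable => // t _ /=; rewrite (ipBl hX) opprB addrC subrK.
  apply: (le_trans (le_normr_Rintegral (mI T) ifs)).
  apply: (@le_trans _ _ (\int[mu]_(t in IT) (`|v| * `|f t - s_ n t|))).
    apply: le_Rintegral => //; first exact: (integrable_norm ifs).
      exact: (integrable_onZ _ (si n)).
    by move=> t _; rewrite mulrC; exact: ip_le.
  by rewrite (RintegralZl _ (mI T) (si n)) mulrC ler_wpM2r// ler_norm.
Qed.

Lemma bochner_L2_riesz f (F : R -> dual X) : L2 f ->
  {ae mu, forall t, t \in IT -> F t = riesz_dual (f t)} -> bochner_L2 T F.
Proof.
move=> Lf Ff; split.
  have [x xE] := pettis_integral Lf.
  by have [s [sF _ _]] := bochner_integral_riesz Lf Ff xE; exists s.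
apply: (@le_lt_trans _ _ (\int[mu]_(t in IT) (`|f t| ^+ 2)%:E)%E).
  apply: ae_le_ge0_integral => //.
  apply: filterS Ff => t FE tI; rewrite FE ?inE//.
  by rewrite riesz_dual_norm.
by apply: integrable_lty; [exact: mI|exact: Lf.2].
Qed.

Lemma bochner_L2_self f : L2 f -> bochner_L2 T f.
Proof.
move=> Lf; split; last by apply: integrable_lty; [exact: mI|exact: Lf.2].
have [s_ [ss s_f _]] := simple_approximation Lf.1.
exists s_; split => //; apply: aeW => t _; apply/cvgrPdist_lt => e e0.
have /cvgrPdist_lt/(_ _ e0)[n0 _ H] := s_f t.
by exists n0 => // n /H/=; rewrite sub0r normrN normr_id.
Qed.

Lemma bochner_L2_dual (b : R -> dual X) : bochner_L2 T b ->
  exists2 f, L2 f & {ae mu, forall t, t \in IT -> b t = riesz_dual (f t)}.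
Proof.
move=> [[s [ss [N [mN N0 bN]]]] bfin].
have [f0 bE] := choice (fun t => riesz_dual_surj hX (b t)).
pose E := IT `\` N.
have mE : measurable E by exact: measurableD.
(* On the exceptional null set [b] is arbitrary; cutting off there makes the Riesz representative a
   limit of simple functions everywhere, hence Borel measurable. *)
pose f t := \1_E t *: f0 t.
have fE t : E t -> f t = f0 t by move=> Et; rewrite /f indicE mem_set// scale1r.
have mf : weakly_measurable ip f.
  move=> v; apply: (@measurable_fun_cvg _ _ _ _ (fun n t => \1_E t * s n t v)).
    move=> n; apply: measurable_funM; first exact: measurable_indic.
    exact: (@simple_measurable _ _ _ (fun a : dual X => a v)).
  move=> t _; rewrite /f indicE; have [tE|tE] := boolP (t \in E); last first.
    rewrite scale0r (ip0l hX); under eq_fun do rewrite mul0r.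
    exact: cvg_cst.
  rewrite scale1r; under eq_fun do rewrite mul1r.
  have [tI nN] := set_mem tE.
  have sb : s n t @[n --> \oo] --> b t.
    apply: contrapT => nsb; apply: nN; apply: bN => /= sb; apply: nsb.
    exact: sb tI.
  have -> : ip (f0 t) v = b t v by rewrite bE.
  apply/cvgrPdist_lt => e e0.
  have e1 : 0 < e / (`|v| + 1) by rewrite divr_gt0// ltr_wpDl.
  move/cvgrPdist_lt : sb => /(_ _ e1)[n0 _ H]; exists n0 => // n /H/= Hn.
  apply: (@le_lt_trans _ _ (`|b t - s n t| * `|v|)).
    exact: (dual_norm_bound (b t - s n t) v).
  rewrite ltr_pdivlMr ?ltr_wpDl// in Hn; apply: le_lt_trans Hn.
  by rewrite ler_wpM2l// lerDl.
exists f; last first.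
  exists N; split => // t /= nE; apply: contrapT => Nt; apply: nE => tI.
  by rewrite fE//; split => //; exact: set_mem.
split => //; apply/integrableP; split.
  by apply/measurable_EFinP/measurable_funTS; exact: (norm_sqr_measurable hX d_dense).
apply: le_lt_trans bfin; apply: ae_le_ge0_integral => //.
apply: aeW => t tI /=; rewrite lee_fin ger0_norm ?sqr_ge0// lerXn2r ?nnegrE//.
rewrite bE riesz_dual_norm /f indicE.
by case: (t \in E); rewrite ?scale1r ?scale0r ?normr0.
Qed.

End bochner_hilbert.

(** * Evolution equations driven by time-dependent forms *)

Section realified_hilbert.
Context {R : realType} {V : hilbertType R}.
Local Notation XV := (realified V).

Definition re_inner (x y : XV) : R := complex.Re (inner (x : V) (y : V)).

Lemma realified_scaleE (r : R) (x : XV) : r *: x = r%:C%C *: (x : V).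
Proof. by []. Qed.

Lemma realified_normE (x : V) : `|x| = (`|(x : XV)|)%:C%C.
Proof. by rewrite -[X in X%:C%C]/(complex.Re `|x|) RRe_real// ger0_real. Qed.

Lemma realified_norm_lt (x : V) (e : R[i]) : 0 < e ->
  (`|x| < e) = (`|(x : XV)| < complex.Re e).
Proof.
move=> e0; have eE : e = (complex.Re e)%:C%C by rewrite RRe_real// gtr0_real.
by rewrite {1}eE realified_normE ltcR.
Qed.

Lemma re_inner_hilbert : real_hilbert re_inner.
Proof.
have lin (k : R) (x y z : XV) :
    re_inner z (k *: x + y) = k * re_inner z x + re_inner z y.
  rewrite /re_inner realified_scaleE inner_linear raddfD/=.
  by case: (inner _ _) => a b /=; rewrite mul0r subr0.
have sqr (x : XV) : re_inner x x = `|x| ^+ 2.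
  by rewrite /re_inner inner_norm realified_normE -rmorphXn.
split => //.
- split => //.
  + by move=> x y _ _; rewrite /re_inner inner_conj; case: (inner _ _).
  + by move=> x _; rewrite sqr sqr_ge0.
- move=> x_ cx.
  have /cauchy_cvgP : cauchy ((x_ : nat -> V) @ \oo).
    apply/cauchy_ballP => e e0.
    have Re0 : 0 < complex.Re e by move: e0; rewrite ltcE => /andP[].
    have [n0 H] := cx _ Re0.
    pose tail := (x_ : nat -> V) @` [set n | (n0 <= n)%N].
    exists (tail, tail); first by split; exists n0 => // n nn; exists n.
    move=> [_ _] /= [[m mn <-] [n nn <-]]; rewrite -ball_normE/= realified_norm_lt//.
    exact: H.
  move=> /cvg_ex[/= x xx]; exists x; apply/cvgrPdist_lt => e e0.
  have ec0 : 0 < e%:C%C :> R[i] by rewrite ltcR.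
  move/cvgrPdist_lt : xx => /(_ _ ec0); apply: filterS => n.
  rewrite realified_norm_lt//= sub0r normrN normr_id.
  by rewrite -[in X in _ -> X](opprB (x : XV)) normrN.
Qed.

End realified_hilbert.

Section evolution_of_forms.
Context {R : realType} {V K : hilbertType R} (j : V -> K).
Local Notation XV := (realified V).
Local Notation XK := (realified K).
Local Notation RT := (measurableTypeR R).
Local Notation mu := (@lebesgue_measure R).
Variable T : R.
Local Notation IT := (`[0%R, T]%classic : set RT).
Local Notation mfun f := (measurable_fun [set: RT] (f : RT -> R)).

Hypothesis j_linear : linear j.
Hypothesis j_le : forall x : XV, `|(j x : XK)| <= `|x|.
Hypothesis j_eq0 : forall x, j x = 0 -> x = 0.
Variable d_ : nat -> XV.
Hypothesis d_dense : forall x e, 0 < e -> exists k, `|x - d_ k| < e.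
Hypothesis T_gt0 : 0 < T.

Definition pivot_form (x y : XV) : R := re_inner (j x : XK) (j y : XK).

Let hV : real_hilbert (@re_inner R V) := re_inner_hilbert.
Let hK : real_hilbert (@re_inner R K) := re_inner_hilbert.
Local Notation L2 := (L2 (@re_inner R V) T).
Local Notation L2ip := (L2ip (@re_inner R V) T).
Let siL : semi_inner L2 L2ip := L2_semi_inner hV T d_dense.

Let jR (k : R) (x y : XV) : (j (k *: x + y) : XK) = k *: (j x : XK) + (j y : XK).
Proof. exact: j_linear. Qed.

Lemma pivot_form_sqr x : pivot_form x x = `|(j x : XK)| ^+ 2.
Proof. exact: (ip_norm hK). Qed.

Lemma pivot_form_semi_inner : semi_inner setT pivot_form.
Proof.
split => //.
- by move=> k x y z _ _ _; rewrite /pivot_form jR (ipDr hK) (ipZr hK).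
- by move=> x y _ _; exact: (ipC hK).
- by move=> x _; rewrite pivot_form_sqr sqr_ge0.
Qed.

Lemma pivot_form_le x : pivot_form x x <= `|x| ^+ 2.
Proof. by rewrite pivot_form_sqr lerXn2r ?nnegrE. Qed.

Lemma pivot_form_eq0 x : pivot_form x x = 0 -> x = 0.
Proof.
rewrite pivot_form_sqr => /eqP; rewrite sqrf_eq0 => /eqP nj.
by apply: j_eq0; apply: (@normr0_eq0 _ XK).
Qed.

Lemma sqdist_pivot_form x y :
  sqdist pivot_form x y = `|((j x : XK) - (j y : XK))| ^+ 2.
Proof.
rewrite /sqdist pivot_form_sqr; congr (`|_| ^+ 2).
by rewrite addrC -scaleN1r jR scaleN1r addrC.
Qed.

(** The function inside [gelfand] is that of a bounded functional, so [insubd] returns it and not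
    its default 0. *)
Lemma gelfandE (G : XV -> XV) x :
  (forall x y, re_inner (G x) y = pivot_form x y) ->
  gelfand j (j x) = riesz_dual hV (G x).
Proof.
move=> GE; apply/val_inj; rewrite /= /gelfand.
have -> : (fun v : XV => complex.Re (inner (j x) (j v)) : R^o) =
    val (riesz_dual hV (G x)).
  by apply/funext => v /=; rewrite GE.
by rewrite valKd.
Qed.

Lemma pivot_continuous (u : R -> XV) : elementary u ->
  forall t e, 0 < e -> \forall s \near t, `|((j (u s) : XK) - (j (u t) : XK))| < e.
Proof.
move=> eu t e e0.
have ev : elementary (fun s => u s - u t).
  have -> : (fun s => u s - u t) = fun s => 1 *: u s + - u t.
    by apply/funext => s; rewrite scale1r.
  by apply: elementary_lin => //; exact: elementary_cst.
have gB : bilinear_form pivot_form.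
  have sig := pivot_form_semi_inner.
  by split=> k x y z; [rewrite (siDl sig) ?(siZl sig)|rewrite (si_linear sig)].
have /(_ t) := elementary_continuous gB ev ev.
rewrite /continuous_at subrr (bilinear_form0l _ gB) => /cvgrPdist_lt.
move=> /(_ _ (exprn_gt0 2 e0)); apply: filterS => s.
rewrite sub0r normrN -/(sqdist pivot_form (u s) (u t)) sqdist_pivot_form.
by rewrite ger0_norm ?sqr_ge0// ltr_pXn2r ?nnegrE ?(ltW e0)//.
Qed.

(* The continuous representative is the uniform limit of the elementary
   approximations in the pivot space. *)
Lemma continuous_representative (u_ y_ : nat -> R -> XV) (u : R -> XV)
    (phi : nat -> nat) (u0 : XV) :
  (forall n, C1_pair (u_ n) (y_ n)) -> (forall n, u_ n 0 = u0) ->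
  (forall n, (n <= phi n)%N) ->
  {ae mu, forall t, t \in IT -> `|u_ (phi n) t - u t| @[n --> \oo] --> 0} ->
  (forall e, 0 < e -> exists n0, forall m n, (n0 <= m)%N -> (n0 <= n)%N ->
     forall t, t \in IT -> sqdist pivot_form (u_ m t) (u_ n t) < e) ->
  exists w : R -> K, [/\ {within `[0, T], continuous w},
    {ae mu, forall t, t \in `[0, T] -> w t = j (u t)} & w 0 = j u0].
Proof.
move=> uy uu0 phi_ge aeu cau.
have {}cau e : 0 < e -> exists n0, forall m n, (n0 <= m)%N -> (n0 <= n)%N ->
    forall t, t \in IT -> `|(j (u_ m t) : XK) - (j (u_ n t) : XK)| < e.
  move=> e0; have [n0 H] := cau _ (exprn_gt0 2 e0); exists n0 => m n mn nn t tI.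
  have := H m n mn nn t tI; rewrite sqdist_pivot_form.
  by rewrite ltr_pXn2r ?nnegrE ?(ltW e0)//.
have /choice[w wE] : forall t, exists w : XK, t \in IT ->
    `|(j (u_ n t) : XK) - w| @[n --> \oo] --> 0.
  move=> t; have [tI|tI] := boolP (t \in IT); last by exists 0.
  have [|x xE] := hilbert_complete hK (x_ := fun n => j (u_ n t)); last by exists x.
  move=> e e0; have [n0 H] := cau e e0.
  by exists n0 => m n mn nn; exact: H.
have unif e : 0 < e -> exists n0, forall n, (n0 <= n)%N -> forall t, t \in IT ->
    `|(j (u_ n t) : XK) - w t| <= e.
  move=> e0; have [n0 H] := cau e e0; exists n0 => n nn t tI.
  apply/ler_addgt0Pr => e' e'0.
  move/cvgrPdist_lt : (wE t tI) => /(_ _ e'0)[n1 _ Hn1].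
  have := Hn1 (maxn n0 n1) (leq_maxr _ _); rewrite /= sub0r normrN normr_id.
  have := H n (maxn n0 n1) nn (leq_maxl _ _) t tI.
  have := ler_distD (j (u_ (maxn n0 n1) t) : XK) (j (u_ n t) : XK) (w t); lra.
exists w; split.
- apply/subspace_continuousP => t tI; apply/cvgrPdist_lt => e e0.
  have Re0 : 0 < complex.Re e by move: e0; rewrite ltcE => /andP[].
  have e3 : 0 < complex.Re e / 3 by rewrite divr_gt0.
  have [n H] := unif _ e3.
  have eu := (C1_pair_elementary (uy n)).1.
  have := pivot_continuous eu t e3.
  rewrite near_withinE; apply: filterS => s st sI.
  rewrite realified_norm_lt//.
  have := H n (leqnn n) t; rewrite inE => /(_ tI).
  have := H n (leqnn n) s; rewrite inE => /(_ sI).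
  move: st; set a := (j (u_ n s) : XK); set b := (j (u_ n t) : XK) => st Ha Hb.
  have -> : (w t - w s : XK) = (w t - b) - (a - b) + (a - w s).
    by rewrite opprB !addrA !subrK.
  have := ler_normD ((w t - b) - (a - b)) (a - w s : XK).
  have := ler_normB (w t - b : XK) (a - b).
  rewrite (distrC (w t : XK)); lra.
(* Along [phi], the images of the approximants at t tend both to [w t], by uniform convergence, and
   to [j (u t)], by continuity of [j]. *)
- apply: filterS aeu => t ut tI.
  have tI' : t \in IT by rewrite inE.
  apply/eqP; rewrite -subr_eq0; apply/eqP/(@normr0_eq0 _ XK)/eqP.
  rewrite eq_le normr_ge0 andbT; apply/ler_addgt0Pr => e e0; rewrite add0r.
  have e2 : 0 < e / 2 by rewrite divr_gt0.
  have [n0 H] := unif _ e2.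
  move/cvgrPdist_lt : (ut tI') => /(_ _ e2)[n1 _ Hn1].
  have := Hn1 (maxn n0 n1) (leq_maxr _ _); rewrite /= sub0r normrN normr_id.
  have := H (phi (maxn n0 n1)) (leq_trans (leq_maxl _ _) (phi_ge _)) t tI'.
  set a := u_ _ t; rewrite distrC => Ha Hb.
  have jB : (j a : XK) - (j (u t) : XK) = (j (a - u t) : XK).
    by rewrite addrC -scaleN1r -jR scaleN1r addrC.
  have := j_le (a - u t); rewrite -jB => Hc.
  have := ler_distD (j a : XK) (w t) (j (u t) : XK); lra.
- have I0 : (0 : R) \in IT by rewrite inE/= in_itv/= lexx ltW.
  apply/eqP; rewrite eq_sym -subr_eq0; apply/eqP/(@normr0_eq0 _ XK).
  have := wE 0 I0; under eq_fun do rewrite uu0.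
  by move=> /(cvg_lim (@norm_hausdorff _ _)); rewrite lim_cst.
Qed.

Let gB : bilinear_form pivot_form.
Proof.
have sig := pivot_form_semi_inner.
by split=> k x y z; [rewrite (siDl sig) ?(siZl sig)|rewrite (si_linear sig)].
Qed.

Lemma test_function_C1 phi : test_function T phi ->
  [/\ continuous (derive1 phi), forall t, is_derive t (1 : R) phi (derive1 phi t),
    phi 0 = 0 & phi T = 0].
Proof.
move=> [dphi [a [b [a0 bT phi0]]]]; split.
- move=> t; apply: differentiable_continuous; apply/derivable1_diffP.
  exact: (dphi 1%N t).
- by move=> t; rewrite derive1E; apply: DeriveDef => //; exact: (dphi 0%N t).
- by apply: phi0; rewrite in_itv/= leNgt a0.
- by apply: phi0; rewrite in_itv/= (leNgt T) bT andbF.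
Qed.

(** Each approximant satisfies integration by parts against phi a for a fixed vector a, without
    boundary terms. Both sides pass to the limit, so the two weak integrals are opposite to each
    other when tested on any a. *)
Lemma weak_derivative_of_limit (G : XV -> XV) (u_ y_ : nat -> R -> XV)
    (u v : R -> XV) (u' : R -> dual XV) :
  (forall x y, re_inner (G x) y = pivot_form x y) ->
  (forall n, C1_pair (u_ n) (y_ n)) -> L2 u -> L2 v ->
  sqdist L2ip (u_ n) u @[n --> \oo] --> 0 ->
  sqdist L2ip (fun t => G (y_ n t)) v @[n --> \oo] --> 0 ->
  {ae mu, forall t, t \in IT -> u' t = riesz_dual hV (v t)} ->
  weak_derivative T j u u'.
Proof.
move=> GE uy Lu Lv u_u y_v u'v phi tphi.
have [cpsi dphi phi0 phiT] := test_function_C1 tphi; set psi := derive1 phi in cpsi dphi.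
have cphi := is_derive_continuous dphi.
have G_lin : forall k x y, G (k *: x + y) = k *: G x + G y.
  exact: (riesz_operator_linear hV gB GE).
have eL2 y : elementary y -> L2 y by exact: elementary_L2.
have Lu_ n := eL2 _ (C1_pair_elementary (uy n)).1.
have Ly_ n := eL2 _ (C1_pair_elementary (uy n)).2.
have L2_G' f : L2 f -> L2 (fun t => G (f t)).
  exact: (L2_G hV d_dense pivot_form_semi_inner pivot_form_le GE).
have Lscale (rho : R -> R) f : continuous rho -> L2 f -> L2 (fun t => rho t *: f t).
  move=> crho Lf; have [M HM] : exists M, forall t, t \in IT -> `|rho t| <= M.
    have /compact_bounded[M [_ HM]] : compact (rho @` `[0, T]).
      apply: continuous_compact; last exact: segment_compact.
      exact: continuous_subspaceT.
    exists (M + 1) => t tI; apply: (HM (M + 1)); first by rewrite ltrDl.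
    by exists t => //; exact: set_mem.
  exact: (L2_scale_le hV d_dense (continuous_measurable_fun crho) HM Lf).1.
have Lphiv := Lscale _ _ cphi Lv; have LpsiGu := Lscale _ _ cpsi (L2_G' _ Lu).
have [x xE] := pettis_integral hV d_dense Lphiv.
have [z zE] := pettis_integral hV d_dense LpsiGu.
have swap (rho : R -> R) (f : R -> XV) a : \int[mu]_(t in IT) re_inner (rho t *: f t) a =
    L2ip f (fun t => rho t *: a).
  by apply: eq_Rintegral => t _; rewrite (ipZl hV) (ipZr hV).
have erho (rho : R -> R) (a : XV) : continuous rho -> elementary (fun t => rho t *: a).
  by move=> crho; apply: elementary_scale => //; exact: elementary_cst.
have zx : z = - x.
  apply: (ip_inj hV) => a; rewrite (ipNl hV) zE xE !swap.
  have LGu_ n := L2_G' _ (Lu_ n).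
  have Gu_u : sqdist L2ip (fun t => G (u_ n t)) (fun t => G (u t)) @[n --> \oo] --> 0.
    exact: (G_cvg hV d_dense pivot_form_semi_inner pivot_form_le GE Lu_ Lu u_u).
  have Lpsia := eL2 _ (erho psi a cpsi); have Lphia := eL2 _ (erho phi a cphi).
  have lim1 := si_cvgl siL LGu_ (L2_G' _ Lu) Lpsia Gu_u.
  have lim2 := si_cvgl siL (fun n => L2_G' _ (Ly_ n)) Lv Lphia y_v.
  have parts n : L2ip (fun t => G (u_ n t)) (fun t => psi t *: a) =
      - L2ip (fun t => G (y_ n t)) (fun t => phi t *: a).
    have := C1_pair_by_parts gB (uy n)
      (C1_pair_scale cpsi dphi (C1_pair_cst a)) (ltW T_gt0).
    rewrite phi0 phiT !scale0r !(bilinear_form0r _ gB) subrr => /eqP.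
    rewrite addrC addr_eq0 => /eqP H.
    have -> : L2ip (fun t => G (u_ n t)) (fun t => psi t *: a) =
        \int[mu]_(t in IT) pivot_form (u_ n t) (psi t *: a + phi t *: 0).
      by apply: eq_Rintegral => t _; rewrite scaler0 addr0 GE.
    by rewrite H; congr (- _); apply: eq_Rintegral => t _; rewrite GE.
  have /cvg_lim <- // := lim1.
  apply/cvg_lim => //; under eq_fun do rewrite parts; exact: cvgN.
exists (riesz_dual hV x); split.
- apply: (@bochner_integral_riesz R XV _ hV d_ T d_dense _
    (fun t => phi t *: u' t) x Lphiv _ xE).
  by apply: filterS u'v => t u't tI; rewrite u't// riesz_dualZ.
- have zE' : riesz_dual hV z = - riesz_dual hV x.
    by rewrite zx -scaleN1r -riesz_dualZ scaleN1r.
  suff : bochner_integral T (fun t => psi t *: gelfand j (j (u t))) (riesz_dual hV z).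
    by rewrite zE'.
  apply: (@bochner_integral_riesz R XV _ hV d_ T d_dense _ _ z LpsiGu) => //.
  by apply: aeW => t tI; rewrite (gelfandE _ GE) riesz_dualZ.
Qed.

(** Two families of forms occur: the solution is constructed from the Borel family [Fm], but the
    equation must hold with the given [F] at every t. *)
Lemma form_evolution_solution (F Fm : R -> XV -> XV -> R) (C c lam : R)
    (b : R -> dual XV) (u0 : V) :
  (forall t, t \in IT -> bilinear_form (F t)) ->
  (forall t x y, t \in IT -> `|F t x y| <= C * `|x| * `|y|) ->
  (forall t, bilinear_form (Fm t)) ->
  (forall t x y, `|Fm t x y| <= C * `|x| * `|y|) ->
  (forall t x, c * `|x| ^+ 2 - lam * pivot_form x x <= Fm t x x) ->
  (forall x y, mfun (fun t => Fm t x y)) -> 0 <= C -> 0 < c ->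
  {ae mu, forall t, t \in IT -> F t = Fm t} ->
  bochner_L2 T b -> evolution_solution T j F b u0.
Proof.
move=> bF F_le bFm Fm_le Fm_garding Fm_meas C0 c0 FFm b_L2.
have [f Lf bf] := bochner_L2_dual hV d_dense b_L2.
have sig := pivot_form_semi_inner.
have [G GE] := riesz_operator hV gB (form_norm_le sig pivot_form_le).
have [Am AmE] := choice (fun t => riesz_operator hV (bFm t) (Fm_le t)).
have /choice[A AE] : forall t, exists A : XV -> XV, t \in IT ->
    forall x y, re_inner (A x) y = F t x y.
  move=> t; have [tI|tI] := boolP (t \in IT); last by exists id.
  by have [A AE] := riesz_operator hV (bF t tI) (fun x y => F_le t x y tI); exists A.
have [u [u_ [y_ [phi [uy uu0 phi_ge aeu [Lu u_u y_v cau]]]]]] :=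
  evolution_exists hV d_dense (ltW T_gt0) sig pivot_form_le pivot_form_eq0 GE u0
    bFm Fm_le Fm_garding Fm_meas C0 c0 AmE Lf.
have Lv : L2 (fun t => f t - Am t (u t)).
  by apply: (siB_mem siL Lf); apply: (L2_A hV d_dense bFm Fm_le Fm_meas AmE).
(* This makes the equation true at every t by definition; only almost everywhere does it agree with
   the limit of G y_n. *)
pose u' t := b t - riesz_dual hV (A t (u t)).
have u'v : {ae mu, forall t, t \in IT -> u' t = riesz_dual hV (f t - Am t (u t))}.
  apply: filterS2 bf FFm => t bt Ft tI; rewrite /u' bt// riesz_dualB.
  by congr (riesz_dual _ (_ - _)); apply: (ip_inj hV) => x; rewrite AE// AmE Ft.
exists u, u'; split.
- exact: (@bochner_L2_self R XV _ hV d_ T d_dense _ Lu).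
- exact: (@bochner_L2_riesz R XV _ hV d_ T d_dense _ u' Lv u'v).
- exact: (weak_derivative_of_limit GE uy Lu Lv u_u y_v u'v).
- move=> t tI v; rewrite -AE ?inE//.
  by rewrite -[u' t v]/(b t v - re_inner (A t (u t)) v) subrK.
- exact: (continuous_representative uy uu0 phi_ge aeu cau).
Qed.

End evolution_of_forms.

(** * Extension of bounded bilinear forms from a dense subspace *)

Section bilinear_extension.
Context {R : realType} {X : normedModType R}.
Implicit Types (W : set X) (B : X -> X -> R).

Lemma real_cauchy_cvg (x_ : nat -> R) : cauchy_for (fun x y => `|x - y|) x_ ->
  exists x : R, x_ n @[n --> \oo] --> x.
Proof.
move=> cx; suff /cvg_ex : cvgn x_ by [].
apply/cauchy_cvgP.
  apply/cauchy_ballP => e e0; have [n0 H] := cx _ e0.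
  pose tail := x_ @` [set n | (n0 <= n)%N].
  exists (tail, tail); first by split; exists n0 => // n nn; exists n.
  by move=> [_ _] /= [[m mn <-] [n nn <-]]; exact: H.
Qed.

Definition dense_subspace W := [/\ W 0,
  forall (k : R) x y, W x -> W y -> W (k *: x + y) &
  forall x e, 0 < e -> exists2 y, W y & `|x - y| < e].

Definition bilinear_on W B :=
  (forall k x y z, W x -> W y -> W z -> B (k *: x + y) z = k * B x z + B y z) /\
  (forall k x y z, W x -> W y -> W z -> B z (k *: x + y) = k * B z x + B z y).

Lemma dense_subspace_seq W x : dense_subspace W ->
  exists2 x_ : nat -> X, (forall n, W (x_ n)) & `|x_ n - x| @[n --> \oo] --> 0.
Proof.
move=> [_ _ dW].
have /choice[x_ H] : forall n : nat, exists y, W y /\ `|x - y| < n.+1%:R^-1.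
  by move=> n; have [|y] := dW x n.+1%:R^-1; [rewrite invr_gt0|exists y].
exists x_; first by move=> n; case: (H n).
apply: (@squeeze_cvgr _ _ _ _ (cst 0) (fun n => n.+1%:R^-1)).
- by apply: nearW => n; rewrite normr_ge0/= distrC ltW//; case: (H n).
- exact: cvg_cst.
- exact: cvg_harmonic.
Qed.

Lemma bilinear_dist_le W B C x x' y y' : bilinear_on W B ->
  (forall x y, W x -> W y -> `|B x y| <= C * `|x| * `|y|) ->
  W x -> W x' -> W y -> W y' -> W (x - x') -> W (y - y') ->
  `|B x y - B x' y'| <= C * `|x - x'| * `|y| + C * `|x'| * `|y - y'|.
Proof.
move=> [Bl Br] BC Wx Wx' Wy Wy' Wxx Wyy.
have -> : B x y - B x' y' = B (x - x') y + B x' (y - y').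
  have := Bl 1 (x - x') x' y Wxx Wx' Wy; have := Br 1 (y - y') y' x' Wyy Wy' Wx'.
  by rewrite !scale1r !subrK !mul1r => -> ->; ring.
by rewrite (le_trans (ler_normD _ _))// lerD// BC.
Qed.

Lemma dense_subspaceB W x y : dense_subspace W -> W x -> W y -> W (x - y).
Proof. by move=> [_ WP _] Wx Wy; rewrite addrC -scaleN1r; exact: WP. Qed.

Lemma bilinear_dist_cvg0 W B C x y (x_ x'_ y_ y'_ : nat -> X) :
  dense_subspace W -> bilinear_on W B -> 0 <= C ->
  (forall x y, W x -> W y -> `|B x y| <= C * `|x| * `|y|) ->
  (forall n, W (x_ n)) -> (forall n, W (x'_ n)) ->
  (forall n, W (y_ n)) -> (forall n, W (y'_ n)) ->
  `|x_ n - x| @[n --> \oo] --> 0 -> `|x'_ n - x| @[n --> \oo] --> 0 ->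
  `|y_ n - y| @[n --> \oo] --> 0 -> `|y'_ n - y| @[n --> \oo] --> 0 ->
  `|B (x_ n) (y_ n) - B (x'_ n) (y'_ n)| @[n --> \oo] --> 0.
Proof.
move=> dW bB C0 BC Wx Wx' Wy Wy' xx x'x yy y'y.
apply: (@squeeze_cvgr _ _ _ _ (cst 0) (fun n =>
  C * (`|x_ n - x| + `|x'_ n - x|) * (`|y_ n - y| + `|y|) +
  C * (`|x'_ n - x| + `|x|) * (`|y_ n - y| + `|y'_ n - y|))).
- apply: nearW => n; rewrite normr_ge0/=.
  have := bilinear_dist_le bB BC (Wx n) (Wx' n) (Wy n) (Wy' n)
    (dense_subspaceB dW (Wx n) (Wx' n)) (dense_subspaceB dW (Wy n) (Wy' n)).
  move=> /le_trans; apply.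
  have tri (a b c : X) : `|a - b| <= `|a - c| + `|b - c|.
    by rewrite (distrC b c) ler_distD.
  have tri0 (a c : X) : `|a| <= `|a - c| + `|c|.
    by have := ler_normD (a - c) c; rewrite subrK.
  by rewrite lerD// ler_pM ?mulr_ge0 ?tri0 ?tri// ?ler_wpM2l ?tri0 ?tri.
- exact: cvg_cst.
- have -> : (0 : R) = C * (0 + 0) * (0 + `|y|) + C * (0 + `|x|) * (0 + 0).
    by rewrite !add0r !mulr0 mul0r addr0.
  by apply: cvgD; apply: cvgM; do ?[apply: cvgMr]; apply: cvgD => //; exact: cvg_cst.
Qed.

(** One limit serves all approximating sequences; linearity of the extension then follows by
    approximating a combination by the combined sequences. *)
Lemma bilinear_extension_limit W B C x y : dense_subspace W -> bilinear_on W B ->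
  0 <= C -> (forall x y, W x -> W y -> `|B x y| <= C * `|x| * `|y|) ->
  exists l : R, forall x_ y_ : nat -> X, (forall n, W (x_ n)) -> (forall n, W (y_ n)) ->
    `|x_ n - x| @[n --> \oo] --> 0 -> `|y_ n - y| @[n --> \oo] --> 0 ->
    B (x_ n) (y_ n) @[n --> \oo] --> l.
Proof.
move=> dW bB C0 BC.
have [x_ Wx xx] := dense_subspace_seq x dW.
have [y_ Wy yy] := dense_subspace_seq y dW.
have [|l Bl] := real_cauchy_cvg (x_ := fun n => B (x_ n) (y_ n)).
  (* For indices where both errors are below d <= 1, the difference of values is at most d (M -
     1). *)
  move=> e e0; pose M := 2 * C * (`|x| + `|y| + 2) + 1.
  have M0 : 0 < M by rewrite ltr_wpDl// !mulr_ge0// !addr_ge0.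
  pose d := Num.min 1 (e / M).
  have d0 : 0 < d by rewrite lt_min ltr01 divr_gt0.
  have d1 : d <= 1 by rewrite ge_min lexx.
  have de : d * M <= e by rewrite -ler_pdivlMr// ge_min lexx orbT.
  move/cvgrPdist_lt : xx => /(_ _ d0)[n1 _ H1].
  move/cvgrPdist_lt : yy => /(_ _ d0)[n2 _ H2].
  exists (maxn n1 n2) => m n; rewrite !geq_max => /andP[m1 m2] /andP[n1' n2'].
  have := H1 m m1; have := H1 n n1'; have := H2 m m2; have := H2 n n2'.
  rewrite /= !sub0r !normrN !normr_id => yn ym xn xm.
  have := bilinear_dist_le bB BC (Wx m) (Wx n) (Wy m) (Wy n)
    (dense_subspaceB dW (Wx m) (Wx n)) (dense_subspaceB dW (Wy m) (Wy n)).
  move=> /le_lt_trans; apply.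
  have xmn : `|x_ m - x_ n| <= 2 * d.
    by have := ler_distD x (x_ m) (x_ n); rewrite (distrC x); lra.
  have ymn : `|y_ m - y_ n| <= 2 * d.
    by have := ler_distD y (y_ m) (y_ n); rewrite (distrC y); lra.
  have ym' : `|y_ m| <= 1 + `|y|.
    by have := ler_normD (y_ m - y) y; rewrite subrK; lra.
  have xn' : `|x_ n| <= 1 + `|x|.
    by have := ler_normD (x_ n - x) x; rewrite subrK; lra.
  apply: (@le_lt_trans _ _ (C * (2 * d) * (1 + `|y|) + C * (1 + `|x|) * (2 * d))).
    by rewrite lerD// ler_pM ?mulr_ge0// ler_wpM2l.
  apply: lt_le_trans de.
  have -> : C * (2 * d) * (1 + `|y|) + C * (1 + `|x|) * (2 * d) = d * (M - 1).
    by rewrite /M; ring.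
  by rewrite ltr_pM2l// ltrBlDr ltrDl.
exists l => x'_ y'_ Wx' Wy' xx' yy'.
have := bilinear_dist_cvg0 dW bB C0 BC Wx' Wx Wy' Wy xx' xx yy' yy.
move=> /norm_cvg0P d0.
have -> : (fun n => B (x'_ n) (y'_ n)) =
    (fun n => B (x'_ n) (y'_ n) - B (x_ n) (y_ n)) \+ (fun n => B (x_ n) (y_ n)).
  by apply/funext => n /=; rewrite subrK.
by rewrite -[l]add0r; exact: cvgD.
Qed.

Lemma bilinear_extension W B C : dense_subspace W -> bilinear_on W B -> 0 <= C ->
  (forall x y, W x -> W y -> `|B x y| <= C * `|x| * `|y|) ->
  exists2 F, bilinear_form F & [/\ forall x y, `|F x y| <= C * `|x| * `|y| &
    forall x y, W x -> W y -> F x y = B x y].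
Proof.
move=> dW bB C0 BC.
have [F FE] := choice (fun p : X * X =>
  bilinear_extension_limit p.1 p.2 dW bB C0 BC).
have seq x := dense_subspace_seq x dW.
have [_ WP _] := dW.
have lin (k : R) (x_ y_ : nat -> X) x y :
    `|x_ n - x| @[n --> \oo] --> 0 -> `|y_ n - y| @[n --> \oo] --> 0 ->
    `|(k *: x_ n + y_ n) - (k *: x + y)| @[n --> \oo] --> 0.
  move=> xx yy; apply: (@squeeze_cvgr _ _ _ _ (cst 0)
    (fun n => `|k| * `|x_ n - x| + `|y_ n - y|)).
  - apply: nearW => n; rewrite normr_ge0/= -normrZ scalerBr.
    by rewrite opprD addrACA ler_normD.
  - exact: cvg_cst.
  - have -> : (0 : R) = `|k| * 0 + 0 by rewrite mulr0 addr0.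
    by apply: cvgD => //; apply: cvgMr.
exists (fun x y => F (x, y)); first split.
- move=> k x y z.
  have [[[x_ Wx xx] [y_ Wy yy]] [z_ Wz zz]] := (seq x, seq y, seq z).
  have h1 := FE (x, z) x_ z_ Wx Wz xx zz; have h2 := FE (y, z) y_ z_ Wy Wz yy zz.
  have := FE (k *: x + y, z) _ z_ (fun n => WP k _ _ (Wx n) (Wy n)) Wz (lin _ _ _ _ _ xx yy) zz.
  under eq_fun do rewrite bB.1//.
  move=> h3.
  apply: (cvg_unique (@norm_hausdorff _ _) h3).
  by apply: cvgD => //; exact: cvgMr.
- move=> k x y z.
  have [[[x_ Wx xx] [y_ Wy yy]] [z_ Wz zz]] := (seq x, seq y, seq z).
  have h1 := FE (z, x) z_ x_ Wz Wx zz xx; have h2 := FE (z, y) z_ y_ Wz Wy zz yy.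
  have := FE (z, k *: x + y) z_ _ Wz (fun n => WP k _ _ (Wx n) (Wy n)) zz (lin _ _ _ _ _ xx yy).
  under eq_fun do rewrite bB.2//.
  move=> h3.
  apply: (cvg_unique (@norm_hausdorff _ _) h3).
  by apply: cvgD => //; exact: cvgMr.
split => x y; last first.
  move=> Wx Wy; have c0 (z : X) : `|z - z| @[n --> \oo] --> (0 : R).
    by rewrite subrr normr0; exact: cvg_cst.
  have := FE (x, y) (fun=> x) (fun=> y) (fun=> Wx) (fun=> Wy) (c0 x) (c0 y).
  by move=> /cvg_lim <- //; rewrite lim_cst.
have [[x_ Wx xx] [y_ Wy yy]] := (seq x, seq y).
have nx (z_ : nat -> X) z : `|z_ n - z| @[n --> \oo] --> 0 ->
    `|z_ n| @[n --> \oo] --> `|z|.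
  move=> zz; apply/cvgrPdist_le => e e0.
  move/cvgrPdist_le : zz => /(_ _ e0); apply: filterS => n.
  rewrite sub0r normrN normr_id; apply: le_trans.
  by rewrite distrC (le_trans (ler_dist_dist _ _)).
have h := FE (x, y) x_ y_ Wx Wy xx yy.
have bound : C * `|x_ n| * `|y_ n| @[n --> \oo] --> C * `|x| * `|y|.
  by apply: cvgM; [apply: cvgMr|]; exact: nx.
by apply: (ler_cvg_to (cvg_norm h) bound); apply: nearW => n; exact: BC.
Qed.

End bilinear_extension.

(** * Borel modification of a Lebesgue measurable family of forms *)

Section borel_modification.
Context {R : realType}.
Local Notation RT := (measurableTypeR R).
Local Notation mu := (@lebesgue_measure R).

(** Each superlevel set at a rational level is Borel up to a null set. Countably many functions and
    levels give one common null set to discard, and real levels are unions over rational ones. *)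
Lemma completed_measurable_restrict (D : set R) (f_ : nat -> R -> R) :
  (forall n a, completed_algebra_gen mu (D `&` [set t | a < f_ n t])) ->
  exists N, [/\ measurable (N : set RT), mu N = 0 & forall n,
    measurable (D `\` N : set RT) ->
    measurable_fun (D `\` N : set RT) (f_ n)].
Proof.
move=> mf.
have /choice[A HA] : forall p : nat * rat, exists A : set RT, measurable A /\
    exists2 N, mu.-negligible N & A `|` N = D `&` [set t | ratr p.2 < f_ p.1 t].
  move=> p; have [A mA [N nN AN]] := mf p.1 (ratr p.2).
  by exists A; split => //; exists N.
have /choice[M HM] : forall p : nat * rat, exists M : set RT, [/\ measurable M,
    mu M = 0 & D `&` [set t | ratr p.2 < f_ p.1 t] `<=` A p `|` M].
  move=> p; have [mA [N [M [mM M0 NM]] AN]] := HA p.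
  exists M; split => //; rewrite -AN => t [At|Nt]; [by left|by right; exact: NM].
have AD p : A p `<=` D `&` [set t | ratr p.2 < f_ p.1 t].
  by have [_ [N _ <-]] := HA p; exact: subsetUl.
pose M' k := if choice.unpickle k is Some p then M p else set0.
have mM' k : measurable (M' k : set RT).
  by rewrite /M'; case: choice.unpickle => // p; case: (HM p).
exists (\bigcup_k M' k); split.
- exact: bigcupT_measurable.
- apply/negligibleP; first exact: bigcupT_measurable.
  apply: negligible_bigcup => k; apply/negligibleP => //.
  by rewrite /M'; case: choice.unpickle => [p|]; [case: (HM p)|exact: measure0].
move=> n mDN _; apply: (measurability _ (RGenOInfty.measurableE R)) => //.
move=> _ [_ [a ->] <-]; rewrite preimage_itvoy.
rewrite [X in measurable X](_ : _ = (D `\` \bigcup_k M' k) `&`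
    \bigcup_(q in [set q : rat | a < ratr q]) A (n, q)).
  apply: measurableI => //; rewrite bigcup_mkcond.
  apply: bigcupT_measurable_rat => q; case: ifPn => // _.
  by case: (HA (n, q)).
apply/seteqP; split => t /=.
  move=> [[Dt nM] aft]; split => //.
  have [q] := rat_in_itvoo aft; rewrite in_itv/= => /andP[aq qf].
  exists q => //; have [_ _ /(_ t)[]//] := HM (n, q).
  move=> Mt; exfalso; apply: nM; exists (choice.pickle (n, q)) => //.
  by rewrite /M' choice.pickleK.
move=> [[Dt nM] [q /= aq Aq]]; split => //.
by have [_ /=] := AD _ _ Aq; exact: lt_trans.
Qed.

(** [P] stands for the properties to be preserved, here boundedness and the Garding inequality: on
    the null set and off [0, T] the form is replaced by a fixed [F00] that also has them.
    Measurability is known on pairs from the dense sequence and passes to all vectors, one variable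
    at a time, by the bound [C]. *)
Lemma borel_modification (X : normedModType R) (d_ : nat -> X) (T C : R)
    (P : (X -> X -> R) -> Prop) (F : R -> X -> X -> R) (F00 : X -> X -> R) :
  (forall x e, 0 < e -> exists k, `|x - d_ k| < e) ->
  (forall B, P B -> bilinear_form B /\ forall x y, `|B x y| <= C * `|x| * `|y|) ->
  P F00 -> (forall t, t \in (`[0, T]%classic : set RT) -> P (F t)) ->
  (forall i k a, completed_algebra_gen mu
     (`[0, T] `&` [set t | a < F t (d_ i) (d_ k)])) ->
  exists Fm : R -> X -> X -> R, [/\ forall t, P (Fm t),
    forall x y, measurable_fun [set: RT] (fun t : RT => Fm t x y) &
    {ae mu, forall t, t \in (`[0, T]%classic : set RT) -> F t = Fm t}].
Proof.
move=> d_dense PB P00 PF mF; pose IT := `[0, T]%classic : set RT.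
pose f_ n t := if choice.unpickle n is Some p then F t (d_ p.1) (d_ p.2) else 0 : R.
have [n a|N [mN N0 mfN]] := @completed_measurable_restrict IT f_.
  rewrite /f_; case: choice.unpickle => [p|]; first exact: mF.
  exists (IT `&` [set t | a < 0]).
    apply: measurableI; first exact: measurable_itv.
    have [a0|a0] := boolP (a < 0).
      by rewrite (_ : [set _ | _] = setT)//; apply/seteqP; split.
    by rewrite (_ : [set _ | _] = set0)//; apply/seteqP; split.
  by exists set0; [exact: negligible_set0|rewrite setU0].
have mE : measurable (IT `\` N) by apply: measurableD => //; exact: measurable_itv.
pose Fm t := if t \in IT `\` N then F t else F00.
have PFm t : P (Fm t).
  rewrite /Fm; have [|_ //] := boolP (t \in IT `\` N).
  by rewrite inE => -[tI _]; apply: PF; rewrite inE.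
exists Fm; split => //; last first.
  exists N; split => // t /= H; apply: contrapT => Nt; apply: H => tI.
  by rewrite /Fm mem_set//; split => //; exact: set_mem.
have seq (x : X) : exists x_ : nat -> nat, `|d_ (x_ n) - x| @[n --> \oo] --> (0 : R).
  have /choice[x_ xx] : forall n : nat, exists k, `|x - d_ k| < n.+1%:R^-1.
    by move=> n; apply: d_dense; rewrite invr_gt0.
  exists x_; apply: (@squeeze_cvgr _ _ _ _ (cst 0) (fun n => n.+1%:R^-1)).
  - by apply: nearW => n; rewrite normr_ge0/= distrC ltW.
  - exact: cvg_cst.
  - exact: cvg_harmonic.
have mdd i k : measurable_fun [set: RT] (fun t : RT => Fm t (d_ i) (d_ k)).
  have -> : (fun t : RT => Fm t (d_ i) (d_ k)) =
      fun t => if t \in IT `\` N then F t (d_ i) (d_ k) else F00 (d_ i) (d_ k).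
    by apply/funext => t; rewrite /Fm; case: ifPn.
  apply: measurable_fun_if => //.
  - apply: (measurable_fun_bool true).
    rewrite setTI (_ : _ @^-1` _ = IT `\` N)//.
    by apply/seteqP; split => t /= H; [exact: set_mem|exact: mem_set].
  - rewrite setTI (_ : _ @^-1` _ = IT `\` N).
      have := mfN (choice.pickle (i, k)) mE.
      by apply: eq_measurable_fun => t _; rewrite /f_ choice.pickleK.
    by apply/seteqP; split => t /= H; [exact: set_mem|exact: mem_set].
have cvg0 (a_ : nat -> R) (a M : R) (e_ : nat -> R) : e_ n @[n --> \oo] --> 0 ->
    (forall n, `|a_ n - a| <= M * e_ n) -> a_ n @[n --> \oo] --> a.
  move=> e0 H; suff h : a_ n - a @[n --> \oo] --> (0 : R).
    have := cvgD h (cvg_cst a); rewrite add0r => h2.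
    have -> : a_ = (fun n => a_ n - a + a) by apply/funext => n; rewrite subrK.
    exact: h2.
  apply/norm_cvg0P; apply: (@squeeze_cvgr _ _ _ _ (cst 0) (fun n => M * e_ n)).
  - by apply: nearW => n; rewrite normr_ge0/= H.
  - exact: cvg_cst.
  - by rewrite -[X in _ --> X](mulr0 M); exact: cvgMr.
have mdy i y : measurable_fun [set: RT] (fun t : RT => Fm t (d_ i) y).
  have [y_ yy] := seq y.
  apply: (@measurable_fun_cvg _ _ _ _ (fun n t => Fm t (d_ i) (d_ (y_ n)))) => // t _.
  have [[_ Br] BC] := PB _ (PFm t).
  apply: (cvg0 _ _ (C * `|d_ i|) _ yy) => n.
  have := Br 1 (d_ (y_ n) - y) y (d_ i); rewrite scale1r subrK mul1r => ->.
  by rewrite addrK.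
move=> x y; have [x_ xx] := seq x.
apply: (@measurable_fun_cvg _ _ _ _ (fun n t => Fm t (d_ (x_ n)) y)) => // t _.
have [[Bl _] BC] := PB _ (PFm t).
apply: (cvg0 _ _ (C * `|y|) _ xx) => n.
have := Bl 1 (d_ (x_ n) - x) x y; rewrite scale1r subrK mul1r => ->.
by rewrite addrK mulrAC.
Qed.

End borel_modification.

(** * The Dirichlet space *)

Section square_integrable.
Context {R : realType} {N : wstarAlgType R} (tau : N -> \bar R).
Hypothesis tauP : normal_faithful_semifinite_trace tau.

Let sq (a : N) := star a ** a.

Let sq_pos a : positive (sq a). Proof. by exists a. Qed.

Let star0 : star (0 : N) = 0.
Proof.
have := star_linear 1 (0 : N) 0; rewrite scale1r addr0 rmorph1 scale1r.
by move=> /(congr1 (fun x => x - star 0)); rewrite subrr addrK => <-.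
Qed.

Let starD (a b : N) : star (a + b) = star a + star b.
Proof. by have := star_linear 1 a b; rewrite scale1r rmorph1 scale1r. Qed.

Let starZ k (a : N) : star (k *: a) = k^*%C *: star a.
Proof. by have := star_linear k a 0; rewrite addr0 star0 addr0. Qed.

Let cmul0l (a : N) : 0 ** a = 0.
Proof. by have := cmul_linearl a (-1) 0 0; rewrite scaler0 addr0 scaleN1r addNr. Qed.

Let cmul0r (a : N) : a ** 0 = 0.
Proof. by have := cmul_linearr a (-1) 0 0; rewrite scaler0 addr0 scaleN1r addNr. Qed.

Let cmulDl (a b c : N) : (a + b) ** c = a ** c + b ** c.
Proof. by have := cmul_linearl c 1 a b; rewrite !scale1r. Qed.

Let cmulDr (a b c : N) : c ** (a + b) = c ** a + c ** b.
Proof. by have := cmul_linearr c 1 a b; rewrite !scale1r. Qed.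

Let cmulZl k (a c : N) : (k *: a) ** c = k *: (a ** c).
Proof. by have := cmul_linearl c k a 0; rewrite cmul0l !addr0. Qed.

Let cmulZr k (a c : N) : c ** (k *: a) = k *: (c ** a).
Proof. by have := cmul_linearr c k a 0; rewrite cmul0r !addr0. Qed.

Let sqZ (k : R) a : sq (k%:C%C *: a) = (k ^+ 2)%:C%C *: sq a.
Proof.
rewrite /sq starZ cmulZl cmulZr scalerA; congr (_ *: _).
by rewrite conjc_real rmorphXn.
Qed.

Let sq_integrable0 : sq_integrable tau 0.
Proof.
rewrite /sq_integrable/= cmul0r.
have -> : (0 : N) = (0 : R)%:C%C *: sq 0 by rewrite scale0r.
by rewrite (traceZ tauP)// mul0e ltry.
Qed.

Let sq_integrableZ (k : R) a : sq_integrable tau a ->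
  sq_integrable tau (k%:C%C *: a).
Proof.
rewrite /sq_integrable/= -!/(sq _) sqZ (traceZ tauP) ?sqr_ge0// => fa.
have [->|k0] := eqVneq k 0; first by rewrite expr0n/= mul0e ltry.
by rewrite lte_mul_pinfty// ?lee_fin ?sqr_ge0.
Qed.

(** The factors 2 are put inside as sqrt 2 so that every term is a square, hence positive, and the
    additivity of the trace applies to both sides. *)
Let sq_parallelogram a b : sq (a + b) + sq (a - b) =
  sq ((Num.sqrt 2)%:C%C *: a) + sq ((Num.sqrt 2)%:C%C *: b).
Proof.
rewrite !sqZ sqr_sqrtr// rmorphD/= !scalerDl !scale1r.
rewrite /sq -[- b]scaleN1r !starD !starZ !cmulDl !cmulDr !cmulZl !cmulZr.
rewrite rmorphN1 !scaleN1r opprK.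
set x := star a ** a; set y := star b ** b; set z := star a ** b.
set w := star b ** a.
by rewrite addrACA (addrACA x z) (addrACA w y) !subrr addr0 add0r.
Qed.

Let sq_integrableD a b : sq_integrable tau a -> sq_integrable tau b ->
  sq_integrable tau (a + b).
Proof.
move=> fa fb; rewrite /sq_integrable/= -/(sq _).
apply: (@le_lt_trans _ _ (tau (sq (a + b)%R) + tau (sq (a - b)%R))%E).
  by rewrite leeDl// (trace_ge0 tauP).
rewrite -(traceD tauP)// sq_parallelogram (traceD tauP)//.
by rewrite lte_add_pinfty//; exact: sq_integrableZ.
Qed.

Context {K : hilbertType R} (iota : N -> K) (D : set K) (E : K -> K -> R[i]).
Context {A : set N}.
Hypothesis iotaP : is_L2 tau iota.
Hypothesis formP : closed_hermitian_form D E.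
Hypothesis AP : cstar_subalgebra A.
Local Notation B := (form_algebra tau iota D A).

Lemma form_algebra0 : B 0.
Proof.
split; [split|] => //=; first exact: subalg0 AP.
have := iota_linear iotaP (-1) sq_integrable0 sq_integrable0.
by rewrite scaler0 addr0 scaleN1r addNr => ->; exact: form_dom0 formP.
Qed.

Lemma form_algebraP (k : R) a b : B a -> B b -> B (k%:C%C *: a + b).
Proof.
move=> [[Aa na] Da] [[Ab nb] Db]; split; [split|] => /=.
- exact: subalgP.
- by apply: sq_integrableD => //; exact: sq_integrableZ.
- by rewrite (iota_linear iotaP)//; exact: (form_domP formP).
Qed.

Lemma form_algebra_iotaP (k : R) a b : B a -> B b ->
  iota (k%:C%C *: a + b) = k%:C%C *: iota a + iota b.
Proof. by move=> [[_ na] _] [[_ nb] _]; exact: (iota_linear iotaP). Qed.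

End square_integrable.

Lemma dense_realified {R : realType} {V : hilbertType R} (S : set V) :
  dense S -> forall (x : realified V) (e : R), 0 < e ->
  exists2 y : realified V, S y & `|x - y| < e.
Proof.
move=> dS x e e0; have ec0 : 0 < e%:C%C :> R[i] by rewrite ltcR.
have [|y [xy Sy]] := dS (ball (x : V) e%:C%C) _ (ball_open (x : V) e%:C%C).
  by exists x; exact: (ballxx (x : V) ec0).
by exists y => //; move: xy; rewrite -ball_normE/= realified_norm_lt.
Qed.

(** The countable set [S] need not meet the core [W]; approximating each of its points within 1 / (m
    + 1) by points of [W] gives a dense sequence in [W], where the form is an explicit function of h
    t. *)
Lemma separable_dense_sequence {R : realType} {X : normedModType R}
    (S W : set X) : countable S ->
  (forall x e, 0 < e -> exists2 y, S y & `|x - y| < e) ->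
  (forall x e, 0 < e -> exists2 y, W y & `|x - y| < e) ->
  exists2 d_ : nat -> X, (forall k, W (d_ k)) &
    forall x e, 0 < e -> exists k, `|x - d_ k| < e.
Proof.
move=> /countable_injP[f finj] dS dW.
have /choice[s sP] : forall n, exists x, forall y, S y -> f y = n -> x = y.
  move=> n; have [[y [Sy fy]]|nS] := pselect (exists y, S y /\ f y = n).
    by exists y => z Sz fz; apply: finj; rewrite ?inE// fz.
  by exists 0 => y Sy fy; exfalso; apply: nS; exists y.
have /choice[w wP] : forall p : nat * nat,
    exists y, W y /\ `|s p.1 - y| < p.2.+1%:R^-1.
  by move=> p; have [|y] := dW (s p.1) p.2.+1%:R^-1; [rewrite invr_gt0|exists y].
exists (fun k => w (odflt (0, 0)%N (choice.unpickle k))) => [k|x e e0].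
  by have [] := wP (odflt (0, 0)%N (choice.unpickle k)).
have e20 : 0 < e / 2 by rewrite divr_gt0.
have [y Sy xy] := dS x _ e20.
pose m := Num.truncn (e / 2)^-1.
exists (choice.pickle (f y, m)); rewrite choice.pickleK/=.
have [_ /=] := wP (f y, m); rewrite (sP _ y)// => yw.
rewrite (splitr e) -(subrKA y) (le_lt_trans (ler_normD _ _))// ltrD//.
rewrite (lt_trans yw)// invf_plt ?posrE// ?invr_gt0//.
by rewrite -natr1; apply: truncnS_gt.
Qed.

Section form_domain.
Context {R : realType} {V K : hilbertType R} {D : set K} {E : K -> K -> R[i]}.
Context {j : V -> K}.
Hypothesis formP : closed_hermitian_form D E.
Hypothesis domainP : form_domain D E j.
Local Notation XV := (realified V).
Local Notation XK := (realified K).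

Lemma form_domain_mem x : D (j x).
Proof. by rewrite -(form_domain_range domainP); exists x. Qed.

Lemma form_domain_sqr (x : XV) :
  `|x| ^+ 2 = `|(j x : XK)| ^+ 2 + complex.Re (E (j x) (j x)).
Proof.
rewrite -(ip_norm (@re_inner_hilbert R V)) -(ip_norm (@re_inner_hilbert R K)).
by rewrite /re_inner (form_domain_inner domainP) raddfD.
Qed.

Lemma form_domain_Re_ge0 x : 0 <= complex.Re (E (j x) (j x)).
Proof. by have := form_ge0 formP (form_domain_mem x); rewrite lecE => /andP[]. Qed.

Lemma form_norm_domain (x : XV) : form_norm E (j x) = `|x|.
Proof. by rewrite /form_norm addrC -form_domain_sqr sqrtr_sqr normr_id. Qed.

Lemma form_domain_le (x : XV) : `|(j x : XK)| <= `|x|.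
Proof.
by rewrite -(@ler_pXn2r _ 2)// ?nnegrE// form_domain_sqr lerDl form_domain_Re_ge0.
Qed.

Lemma form_domain_eq0 x : j x = 0 -> x = 0.
Proof.
move=> jx; have := form_linear formP (-1) (form_domain_mem x)
  (form_domain_mem x) (form_domain_mem x).
rewrite jx scaler0 addr0 mulN1r addNr => E0.
have := form_domain_sqr x; rewrite jx E0 (@normr0 _ XK) expr0n/= addr0.
by move/eqP; rewrite sqrf_eq0 => /eqP/(@normr0_eq0 _ XV).
Qed.

End form_domain.

Lemma bounded_bilinear_continuous {R : realType} {X : normedModType R}
    (B : X -> X -> R) (C : R) : bilinear_form B -> 0 <= C ->
  (forall x y, `|B x y| <= C * `|x| * `|y|) ->
  continuous (fun p : X * X => B p.1 p.2 : R^o).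
Proof.
move=> [Bl Br] C0 BC [x y]; apply/cvgrPdist_lt => e e0 /=.
pose S := C * (`|x| + `|y| + 1) + 1.
have S0 : 0 < S by rewrite ltr_wpDl// mulr_ge0// !addr_ge0.
pose d := Num.min 1 (e / S); have d0 : 0 < d by rewrite lt_min ltr01 divr_gt0.
exists (ball x d, ball y d); first by split; exact: nbhsx_ballx.
move=> [x' y'] [/= xx yy].
move: xx yy; rewrite -!ball_normE/= => xx yy.
have nx : `|x'| <= `|x| + 1.
  rewrite -(subKr x x') (le_trans (ler_normB _ _))// lerD2l ltW//.
  by rewrite (lt_le_trans xx)// ge_min lexx.
have bE : @bilinear_on R X setT B by split=> *; [exact: Bl|exact: Br].
have := @bilinear_dist_le _ _ setT B C x x' y y' bE (fun x y _ _ => BC x y)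
  I I I I I I.
move=> /le_lt_trans; apply; rewrite (@le_lt_trans _ _ (C * (`|x| + `|y| + 1) * d))//.
  have H : C * `|x - x'| * `|y| <= C * d * `|y|.
    by rewrite ler_wpM2r// ler_wpM2l// ltW.
  have H' : C * `|x'| * `|y - y'| <= C * (`|x| + 1) * d.
    by rewrite ler_pM// ?mulr_ge0 ?(ltW yy)// ler_wpM2l.
  by rewrite (le_trans (lerD H H'))// le_eqVlt; apply/orP; left; apply/eqP; ring.
rewrite (@lt_le_trans _ _ (S * d))//; first by rewrite ltr_pM2r// /S ltrDl.
by rewrite mulrC -ler_pdivlMr// ge_min lexx orbT.
Qed.

(** * Construction of the form from its values on the core *)

Section continuity_form.
Context {R : realType} {N : wstarAlgType R} {tau : N -> \bar R}.
Context {L2 : hilbertType R} {iota : N -> L2}.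
Context {D : set L2} {E : L2 -> L2 -> R[i]}.
Context {V : hilbertType R} {j : V -> L2} {A : set N}.
Context {H : hilbertType R} {tens : N -> N -> H} {lact ract : N -> H -> H}.
Context {grad : L2 -> H}.
Hypothesis tauP : normal_faithful_semifinite_trace tau.
Hypothesis iotaP : is_L2 tau iota.
Hypothesis formP : closed_hermitian_form D E.
Hypothesis domainP : form_domain D E j.
Hypothesis regularP : regular_subalgebra tau iota D j A.
Hypothesis bimoduleP : tangent_bimodule tau iota D E A tens lact ract.
Hypothesis gradP : gradient tau iota D E A tens lact ract grad.
Local Notation B := (form_algebra tau iota D A).
Local Notation XV := (realified V).
Local Notation XL := (realified L2).

Definition form_core : set XV := [set x | exists2 a, B a & iota a = j x].

Let AP : cstar_subalgebra A := regular_cstar regularP.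
Let B0 : B 0 := form_algebra0 tauP iotaP formP AP.
Let BP (k : R) a b (Ba : B a) (Bb : B b) : B (k%:C%C *: a + b) :=
  form_algebraP tauP iotaP formP AP k Ba Bb.
Let iotaD (k : R) a b (Ba : B a) (Bb : B b) :
    iota (k%:C%C *: a + b) = k%:C%C *: iota a + iota b :=
  form_algebra_iotaP iotaP k Ba Bb.
Let B_A a : B a -> A a. Proof. by move=> [[]]. Qed.
Let B_D a : B a -> D (iota a). Proof. by move=> []. Qed.

Lemma form_core_dense : dense_subspace form_core.
Proof.
split.
- exists 0; first exact: B0.
  have := iota_linear iotaP (-1).
  have [[_ n0] _] := B0.
  move=> /(_ _ _ n0 n0); rewrite scaler0 addr0 scaleN1r addNr => ->.
  have := form_domain_linear domainP (-1) 0 0.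
  by rewrite scaler0 addr0 scaleN1r addNr.
- move=> k x y [a Ba ax] [b Bb bx]; exists (k%:C%C *: a + b); first exact: BP.
  by rewrite iotaD// ax bx -(form_domain_linear domainP).
- move=> x e e0; have [y [a Ba ay] xy] := dense_realified (regular_core regularP) x e0.
  by exists y => //; exists a.
Qed.

Local Notation ip := (@re_inner R H).
Let hH : real_hilbert ip := re_inner_hilbert.

Let pairing (eta : H) a b := ip (ract a eta) (grad (iota b)).

Let pairing_linearl eta (k : R) a a' b : B a -> B a' ->
  pairing eta (k%:C%C *: a + a') b = k * pairing eta a b + pairing eta a' b.
Proof.
move=> Ba Ba'; rewrite /pairing (ract_linearl bimoduleP); [|exact: B_A..].
by rewrite -realified_scaleE (ipDl hH) (ipZl hH).
Qed.

Let pairing_linearr eta (k : R) a b b' : B b -> B b' ->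
  pairing eta a (k%:C%C *: b + b') = k * pairing eta a b + pairing eta a b'.
Proof.
move=> Bb Bb'; rewrite /pairing iotaD//.
rewrite (grad_linear gradP); [|exact: B_D..].
by rewrite -realified_scaleE (ipDr hH) (ipZr hH).
Qed.

Variables (eta : H) (c2 : R).
Hypothesis c2_ge0 : 0 <= c2.
Hypothesis eta_le : forall a b, B a -> B b ->
  `|pairing eta a b| <= c2 * form_norm E (iota a) * form_norm E (iota b).

Let pairing_le x y a b : B a -> B b -> iota a = j x -> iota b = j y ->
  `|pairing eta a b| <= c2 * `|(x : XV)| * `|(y : XV)|.
Proof.
by move=> Ba Bb ax bx; rewrite (le_trans (eta_le Ba Bb))// ax bx
  !(form_norm_domain domainP).
Qed.

(** The right action is indexed by elements of the algebra, not by their images in the form domain.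
    If a and a' have the same image, a - a' has form norm 0 and the bound makes its pairing
    vanish. *)
Let pairing_eq x y a b a' b' : B a -> B b -> B a' -> B b' ->
  iota a = j x -> iota a' = j x -> iota b = j y -> iota b' = j y ->
  pairing eta a b = pairing eta a' b'.
Proof.
move=> Ba Bb Ba' Bb' ax a'x bx b'x; rewrite /pairing bx -b'x -!/(pairing _ _ _).
have := pairing_linearl eta (-1) b' Ba' Ba.
suff -> : pairing eta ((-1)%:C%C *: a' + a) b' = 0.
  by move/eqP; rewrite mulN1r eq_sym addrC subr_eq0 => /eqP.
have := @pairing_le 0 y _ _ (BP (-1) Ba' Ba) Bb'.
rewrite normr0 mulr0 mul0r iotaD// ax a'x.
rewrite -(form_domain_linear domainP) rmorphN1 scaleN1r addNr.
by move=> /(_ erefl b'x); rewrite normr_le0 => /eqP.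
Qed.

Lemma continuity_form_exists :
  exists F : XV -> XV -> R, continuity_form iota j B ract grad eta F.
Proof.
have /choice[r rP] : forall x : XV, exists a, form_core x -> B a /\ iota a = j x.
  move=> x; have [[a Ba ax]|nx] := pselect (form_core x); last by exists 0.
  by exists a.
have dW := form_core_dense; have [_ WP _] := dW.
have jE (k : R) (x y : XV) : j (k *: x + y) = k%:C%C *: j x + j y.
  exact: (form_domain_linear domainP).
pose P x y := pairing eta (r x) (r y).
have bP : bilinear_on form_core P.
  split=> k x y z Wx Wy Wz; rewrite /P.
    have [[[[Bx xE] [By yE]] [Bz zE]] [Bk kE]] :=
      (rP _ Wx, rP _ Wy, rP _ Wz, rP _ (WP k _ _ Wx Wy)).
    rewrite -pairing_linearl//; apply: (@pairing_eq (k *: x + y) z) => //.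
    - exact: BP.
    - by rewrite iotaD// xE yE jE.
  have [[[[Bx xE] [By yE]] [Bz zE]] [Bk kE]] :=
    (rP _ Wx, rP _ Wy, rP _ Wz, rP _ (WP k _ _ Wx Wy)).
  rewrite -pairing_linearr//; apply: (@pairing_eq z (k *: x + y)) => //.
  - exact: BP.
  - by rewrite iotaD// xE yE jE.
have P_le x y : form_core x -> form_core y -> `|P x y| <= c2 * `|x| * `|y|.
  by move=> /rP[Bx xE] /rP[By yE]; exact: pairing_le.
have [F [Fl Fr] [F_le FE]] := bilinear_extension dW bP c2_ge0 P_le.
exists F; split.
- by move=> v k x y; exact: Fl.
- by move=> u k x y; exact: Fr.
- exact: (bounded_bilinear_continuous (conj Fl Fr) c2_ge0 F_le).
- move=> u v a b Ba Bb ua vb.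
  have Wu : form_core u by exists a.
  have Wv : form_core v by exists b.
  have [[Bu uE] [Bv vE]] := (rP _ Wu, rP _ Wv).
  by rewrite FE//; exact: (@pairing_eq u v).
Qed.

End continuity_form.

Lemma dense_subspace_ge0 {R : realType} {X : normedModType R} (W : set X)
    (f : X -> R) : dense_subspace W -> continuous (f : X -> R^o) ->
  (forall x, W x -> 0 <= f x) -> forall x, 0 <= f x.
Proof.
move=> [_ _ dW] fc fW x; rewrite leNgt; apply/negP => fx0.
have fx0' : 0 < - f x by rewrite oppr_gt0.
have /cvgrPdist_lt/(_ _ fx0')/nbhs_ballP[d /= d0 xd] := fc x.
have [y Wy xy] := dW x d d0.
have := xd y; rewrite -ball_normE/= => /(_ xy).
rewrite distrC => /(le_lt_trans (ler_norm _)).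
by rewrite gtrDr => /lt_geF; rewrite fW.
Qed.

(** * Bounds for the extended form and openness of its superlevel sets *)

Section continuity_form_properties.
Context {R : realType} {N : wstarAlgType R} {tau : N -> \bar R}.
Context {L2 : hilbertType R} {iota : N -> L2}.
Context {D : set L2} {E : L2 -> L2 -> R[i]}.
Context {V : hilbertType R} {j : V -> L2} {A : set N}.
Context {H : hilbertType R} {tens : N -> N -> H} {lact ract : N -> H -> H}.
Context {grad : L2 -> H}.
Hypothesis tauP : normal_faithful_semifinite_trace tau.
Hypothesis iotaP : is_L2 tau iota.
Hypothesis formP : closed_hermitian_form D E.
Hypothesis domainP : form_domain D E j.
Hypothesis regularP : regular_subalgebra tau iota D j A.
Hypothesis bimoduleP : tangent_bimodule tau iota D E A tens lact ract.
Local Notation B := (form_algebra tau iota D A).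
Local Notation XV := (realified V).
Local Notation XL := (realified L2).
Local Notation W := (@form_core _ _ tau _ iota D _ j A).

Let j_le := form_domain_le formP domainP.
Let dW : dense_subspace W := form_core_dense tauP iotaP formP domainP regularP.

Section fixed_vector.
Variables (eta : H) (F : XV -> XV -> R) (c0 c1 c2 : R).
Hypothesis FP : continuity_form iota j B ract grad eta F.
Hypothesis eta_le : forall a b, B a -> B b ->
  `|complex.Re (inner (ract a eta) (grad (iota b)))| <=
    c2 * form_norm E (iota a) * form_norm E (iota b).
Hypothesis eta_ge : forall a, B a ->
  complex.Re (inner (ract a eta) (grad (iota a))) >=
    c0 * complex.Re (E (iota a) (iota a)) - c1 * complex.Re `|iota a| ^+ 2.

Lemma continuity_form_bilinear : bilinear_form F.
Proof.
split=> k x y z; first exact: (cform_linearl FP).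
exact: (cform_linearr FP).
Qed.

(** Extended from the core one variable at a time: to all [x] with [y] in the core, then to all
    [y]. *)
Lemma continuity_form_le x y : `|F x y| <= c2 * `|x| * `|y|.
Proof.
have Fc := cform_continuous FP.
have Fcl z : continuous (fun x : XV => F x z : R^o).
  move=> x'; have : (x, z) @[x --> x'] --> (x', z).
    exact: (@cvg_pair _ _ _ _ (nbhs x') (nbhs z) _ _ _ id (cst z) cvg_id (cvg_cst z)).
  by move=> /(@cvg_comp _ _ _ _ (fun p => F p.1 p.2 : R^o)); apply; exact: (Fc (x', z)).
have Fcr z : continuous (fun y : XV => F z y : R^o).
  move=> y'; have : (z, y) @[y --> y'] --> (z, y').
    exact: (@cvg_pair _ _ _ _ (nbhs z) (nbhs y') _ _ _ (cst z) id (cvg_cst z) cvg_id).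
  by move=> /(@cvg_comp _ _ _ _ (fun p => F p.1 p.2 : R^o)); apply; exact: (Fc (z, y')).
rewrite -subr_ge0; move: x y.
suff H1 x y : W y -> 0 <= c2 * `|x| * `|y| - `|F x y|.
  move=> x y; apply: (dense_subspace_ge0 (f := fun y => c2 * `|x| * `|y| - `|F x y|) dW).
    by move=> z; exact: (cvgB (cvgMr (cvg_norm cvg_id)) (cvg_norm (Fcr x z))).
  by move=> z; exact: H1.
move=> Wy; move: x.
apply: (dense_subspace_ge0 (f := fun x => c2 * `|x| * `|y| - `|F x y|) dW).
  move=> z.
  exact: (cvgB (cvgMl (cvgMr (cvg_norm cvg_id))) (cvg_norm (Fcl y z))).
move=> x [a Ba ax]; have [b Bb bx] := Wy.
rewrite subr_ge0 (cform_ext FP Ba Bb)// (le_trans (eta_le Ba Bb))// ax bx.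
by rewrite !(form_norm_domain domainP).
Qed.

(** The constant c0 + c1 arises from E[x] = |x|^2 - |j x|^2, which converts the lower bound by c0
    E[x] into one by the full norm of the form domain; density does the rest. *)
Lemma continuity_form_ge x :
  c0 * `|x| ^+ 2 - (c0 + c1) * pivot_form j x x <= F x x.
Proof.
pose f (x : XV) := F x x - (c0 * `|x| ^+ 2 - (c0 + c1) * `|(j x : XL)| ^+ 2).
rewrite pivot_form_sqr -subr_ge0 -/(f x); apply: (dense_subspace_ge0 dW).
  have jc : continuous (fun x : XV => `|(j x : XL)| : R^o).
    move=> z; apply/(@cvgrPdist_lt _ _ _ _ (nbhs_filter z)) => e e0.
    apply/nbhs_ballP; exists e => //= y.
    rewrite -ball_normE/= => zy.
    rewrite (le_lt_trans (ler_dist_dist (j z : XL) (j y : XL)))// (le_lt_trans _ zy)//.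
    suff -> : (j z : XL) - j y = j (z - y) by exact: j_le.
    have := form_domain_linear domainP (-1) y z.
    by rewrite !scaleN1r ![- _ + _]addrC => <-.
  move=> z; have Fz : (F x x : R^o) @[x --> z] --> (F z z : R^o).
    have : (x, x) @[x --> z] --> (z, z).
      exact: (@cvg_pair _ _ _ _ (nbhs z) (nbhs z) _ _ _ id id cvg_id cvg_id).
    move=> /(@cvg_comp _ _ _ _ (fun p => F p.1 p.2 : R^o)); apply.
    by have Fc := cform_continuous FP; exact: (Fc (z, z)).
  have nz : `|x| @[x --> z] --> `|z|.
    exact: (cvg_norm cvg_id).
  have nz2 : `|x| ^+ 2 @[x --> z] --> `|z| ^+ 2.
    exact: (cvgM nz nz).
  have jz2 : (`|(j x : XL)| ^+ 2 : R) @[x --> z] --> (`|(j z : XL)| ^+ 2 : R).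
    exact: (cvgM (jc z) (jc z)).
  have FFz : Filter (nbhs z) := nbhs_filter z.
  exact: (cvgB Fz (cvgB (cvgMr (a := c0) nz2) (cvgMr (a := c0 + c1) jz2))).
move=> y [a Ba ay]; rewrite /f subr_ge0 (cform_ext FP Ba Ba)//.
apply: le_trans (eta_ge Ba); rewrite (form_domain_sqr domainP) ay.
rewrite -[X in _ <= _ - c1 * X]/(`|(j y : XL)| ^+ 2).
by rewrite le_eqVlt; apply/orP; left; apply/eqP; ring.
Qed.

End fixed_vector.

Let Na_ge0 (a : N) : 0 <= complex.Re `|a|.
Proof. by have := normr_ge0 a; rewrite lecE => /andP[]. Qed.

(** The pairing is Lipschitz in [eta] with constant |a| |b|. The measurability of [h] concerns
    preimages of open sets, so this makes t |-> F t x y Lebesgue measurable on the core. *)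
Lemma open_pairing a (b : H) (r : R) : A a ->
  open [set eta : H | r < complex.Re (inner (ract a eta) b)].
Proof.
move=> Aa; rewrite openE => eta /= reta.
pose g (x : H) := @re_inner R H (ract a x) b.
pose e := g eta - r; have e0 : 0 < e by rewrite subr_gt0.
pose Na := complex.Re `|a|.
pose M := Na * `|(b : realified H)| + 1.
have M0 : 0 < M by rewrite ltr_wpDl// mulr_ge0// Na_ge0.
have eM : 0 < (e / M)%:C%C :> R[i] by rewrite ltcR divr_gt0.
apply/nbhs_ballP; exists (e / M)%:C%C => //= x.
rewrite -ball_normE/= realified_norm_lt//= => etax.
rewrite -[ltRHS]/(g x).
suff : g eta - g x < e by rewrite /e ltrD2l ltrN2.
rewrite -(ipBl re_inner_hilbert) (le_lt_trans (ler_norm _))//.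
rewrite (le_lt_trans (ip_le re_inner_hilbert _ _))//.
have ract_le : `|(ract a eta - ract a x : realified H)| <= Na * `|(eta - x : realified H)|.
  rewrite -lecR rmorphM/= -!realified_normE.
  have -> : Na%:C%C = `|a| by rewrite /Na RRe_real// ger0_real.
  have := ract_bounded bimoduleP (eta - x) Aa.
  have := ract_linear bimoduleP Aa (-1) x eta.
  by rewrite !scaleN1r ![- _ + _]addrC => <-.
rewrite (le_lt_trans (ler_wpM2r (normr_ge0 _) ract_le))//.
rewrite mulrAC (@le_lt_trans _ _ (Na * `|(b : realified H)| * (e / M)))//.
  by rewrite ler_wpM2l ?mulr_ge0 ?Na_ge0// ltW.
by rewrite mulrCA gtr_pMr// ltr_pdivrMr// mul1r /M ltrDl.
Qed.

End continuity_form_properties.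

Theorem corollary10p5 (R : realType)
    (* the Dirichlet space; L2 is the completion of the square-integrable part
       of N, iota the canonical map *)
    (N : wstarAlgType R) (tau : N -> \bar R)
    (L2 : hilbertType R) (iota : N -> L2)
    (D : set L2) (E : L2 -> L2 -> R[i])
    (dirichlet : dirichlet_space tau iota D E)
    (* D(E) as a Hilbert space, separable *)
    (V : hilbertType R) (j : V -> L2) (domain : form_domain D E j)
    (separable : exists S : set V, countable S /\ dense S)
    (* the regular subalgebra, the bimodule and the gradient *)
    (A : set N) (regular : regular_subalgebra tau iota D j A)
    (H : hilbertType R) (tens : N -> N -> H) (lact ract : N -> H -> H)
    (bimodule : tangent_bimodule tau iota D E A tens lact ract)
    (grad : L2 -> H)
    (gradientP : gradient tau iota D E A tens lact ract grad)
    (T : R) (T_gt0 : 0 < T)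
    (h : R -> H) (h_measurable : lebesgue_measurable T h)
    (c0 c1 c2 : R) (c0_gt0 : 0 < c0) (c2_gt0 : 0 < c2)
    (h_coercive : forall t a, t \in `[0, T] -> form_algebra tau iota D A a ->
      complex.Re (inner (ract a (h t)) (grad (iota a))) >=
        c0 * complex.Re (E (iota a) (iota a))
        - c1 * complex.Re `|iota a| ^+ 2)
    (h_bounded : forall t a b, t \in `[0, T] ->
      form_algebra tau iota D A a -> form_algebra tau iota D A b ->
      `|complex.Re (inner (ract a (h t)) (grad (iota b)))| <=
        c2 * form_norm E (iota a) * form_norm E (iota b)) :
  let extension (F : R -> realified V -> realified V -> R) :=
    forall t, t \in `[0, T] ->
      continuity_form iota j (form_algebra tau iota D A) ract grad (h t) (F t) in
  (exists F, extension F) /\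
  forall F, extension F ->
  forall (u0 : V) (b : R -> dual (realified V)), bochner_L2 T b ->
    evolution_solution T j F b u0.
Proof.
have [tauP iotaP [P [S [Q [_ [_ _ _ formP _]]]]]] := dirichlet.
have dW := form_core_dense tauP iotaP formP domain regular.
split.
  have /choice[F FP] : forall t, exists F : realified V -> realified V -> R,
      t \in `[0, T] ->
      continuity_form iota j (form_algebra tau iota D A) ract grad (h t) F.
    move=> t; have [tT|tT] := boolP (t \in `[0, T]); last by exists (fun _ _ => 0).
    have [F FP] := continuity_form_exists tauP iotaP formP domain regular bimodule
      gradientP (ltW c2_gt0) (fun a b => h_bounded t a b tT).
    by exists F.
  by exists F => t; exact: FP.
move=> F FP u0 b b_L2.
pose lam := c0 + c1.
(* A common bound: c2 for the given forms, c0 + |lam| for the replacement form [good0]. *)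
pose C := c2 + c0 + `|lam|.
have C0 : 0 <= C by rewrite !addr_ge0 ?(ltW c2_gt0) ?(ltW c0_gt0).
pose good (G : realified V -> realified V -> R) := [/\ bilinear_form G,
  forall x y, `|G x y| <= C * `|x| * `|y| &
  forall x, c0 * `|x| ^+ 2 - lam * pivot_form j x x <= G x x].
have j_le := form_domain_le formP domain.
have j_eq0 := form_domain_eq0 formP domain.
have j_lin := form_domain_linear domain.
have hV : real_hilbert (@re_inner R V) := re_inner_hilbert.
have hK : real_hilbert (@re_inner R L2) := re_inner_hilbert.
have goodF t : t \in (`[0, T]%classic : set (measurableTypeR R)) -> good (F t).
  rewrite inE => tT; have Ft := FP t tT; split.
  - exact: continuity_form_bilinear Ft.
  - move=> x y; have := continuity_form_le tauP iotaP formP domain regular Ft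
      (fun a b => h_bounded t a b tT) x y.
    move=> /le_trans; apply; rewrite -!mulrA ler_wpM2r ?mulr_ge0//.
    by rewrite /C -addrA lerDl addr_ge0// ltW.
  - move=> x; exact: (continuity_form_ge tauP iotaP formP domain regular Ft
      (fun a => h_coercive t a tT) x).
(* The form used on the exceptional null set satisfies the lower bound with equality. *)
have good0 : good (fun x y => c0 * re_inner x y - lam * pivot_form j x y).
  have sig := pivot_form_semi_inner j_lin.
  split.
  - have [iBl iBr] := ip_bilinear hV.
    split=> k x y z; first by rewrite iBl (siDl sig)// (siZl sig)//; ring.
    by rewrite iBr (siDr sig)// (siZr sig)//; ring.
  - move=> x y; rewrite (le_trans (ler_normB _ _))// !normrM (ger0_norm (ltW c0_gt0)).
    have := form_norm_le sig (pivot_form_le j_le) x y; rewrite mul1r => pxy.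
    have nxy := ip_le hV x y.
    rewrite (le_trans (lerD (ler_wpM2l (ltW c0_gt0) nxy)
      (ler_wpM2l (normr_ge0 lam) pxy)))//.
    rewrite -mulrDl -mulrA ler_wpM2r ?mulr_ge0//.
    by rewrite /C -addrA lerDr ltW.
  - by move=> x; rewrite (ip_norm hV).
have [S0 [cS dS]] := separable.
have [d_ dW_ d_dense] := @separable_dense_sequence R (realified V) S0 _ cS
  (dense_realified dS) (let: And3 _ _ dW' := dW in dW').
(* The [d_ i] lie in the core, so [F t (d_ i) (d_ k)] is the pairing with [h t], and its superlevel
   sets are preimages of open sets under [h]. *)
have mF i k (a : R) : completed_algebra_gen (@lebesgue_measure R)
    (`[0, T] `&` [set t | a < F t (d_ i) (d_ k)]).
  have [[ai Bi iE] [ak Bk kE]] := (dW_ i, dW_ k).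
  have Ai : A ai by case: Bi => [[]].
  have := h_measurable _ (open_pairing bimodule (grad (iota ak)) a Ai).
  congr completed_algebra_gen; apply/seteqP; split => t /= [tT];
    by rewrite (cform_ext (FP t tT) Bi Bk).
have [Fm [gFm mFm FFm]] := borel_modification d_dense
  (fun G (gG : good G) => let: And3 bG lG _ := gG in conj bG lG) good0 goodF mF.
apply: (@form_evolution_solution R V L2 j T j_lin j_le j_eq0 d_ d_dense T_gt0
  F Fm C c0 lam b u0) => //.
- by move=> t /goodF[].
- by move=> t x y /goodF[].
- by move=> t; case: (gFm t).
- by move=> t x y; case: (gFm t).
- by move=> t x; case: (gFm t) => _ _; exact.
Qed.
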